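(* Consider the closed-loop system described in the context, with nominal values $r_e\in\mathbb{R}$, $d_e\in L^2(0,L)$. Let $\kappa>0$ be a decay rate for which the Input-to-State Stability property (S) of the context holds (such a $\kappa$ exists). There exists $\overline{C}_3>0$ such that, for every $\epsilon\in[0,1)$, there exists $\overline{C}_4(\epsilon)>0$ such that, along every closed-loop trajectory and for every $t\geq0$, $$\vert y_x(t,0)-r(t)\vert\leq\overline{C}_3e^{-\kappa t}\left(\vert\Delta u_D(0)\vert+\vert\Delta\zeta(0)\vert+\Vert\Delta w(0)\Vert_{H_0^1(0,L)}+\Vert\mathcal{A}\Delta w(0)\Vert_{L^2(0,L)}\right)+\overline{C}_4(\epsilon)\sup_{0\leq s\leq t}e^{-\epsilon\kappa(t-s)}\left\{\vert\Delta r(s)\vert+\Vert\Delta d(s)\Vert+\Vert\dot d(s)\Vert\right\}.$$ Moreover, the constants $\overline{C}_3,\overline{C}_4(\epsilon)$ can be chosen independently of $r_e$ and $d_e$.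
   Context: Notation. $\mathbb{R}_+=[0,+\infty)$, $\mathbb{N}=\{0,1,2,\dots\}$. Fix $L>0$, $D>0$ and a real-valued $c\in L^\infty(0,L)$. $\langle f,g\rangle=\int_0^L f(x)g(x)\,dx$ on $L^2(0,L)$; $\Vert\cdot\Vert$ is the $L^2(0,L)$ norm for functions, the Euclidean norm for vectors and the induced norm for matrices; $\Vert f\Vert_{H_0^1(0,L)}=\Vert f'\Vert_{L^2(0,L)}$; $\dot d$ is the time derivative of $d$. Spectral data. $\mathcal{A}f=f''+cf$ on $D(\mathcal{A})=H^2(0,L)\cap H_0^1(0,L)$, a self-adjoint operator with compact resolvent in $L^2(0,L)$. $(e_j)_{j\geq1}$ is a Hilbert basis of $L^2(0,L)$ of real eigenfunctions, $\mathcal{A}e_j=\lambda_je_j$, with $\lambda_1>\lambda_2>\cdots\to-\infty$. $n\in\mathbb{N}$ is the integer with $\lambda_j\geq0$ for $1\leq j\leq n$ and $\lambda_j\leq\lambda_{n+1}<0$ for $j\geq n+1$ ($n=0$ allowed). Put $a(x)=\frac{x}{L}c(x)$, $b(x)=-\frac{x}{L}$, $a_j=\langle a,e_j\rangle$, $b_j=\langle b,e_j\rangle$, $\alpha=\frac1L-\sum_{j\geq n+1}\frac{e_j'(0)}{\lambda_j}a_j$, $\beta=-\sum_{j\geq n+1}\frac{e_j'(0)}{\lambda_j}b_j$. Matrices. $A_1\in\mathbb{R}^{(n+1)\times(n+1)}$ has zero first row, first column $(0,a_1,\dots,a_n)^\top$, and lower-right $n\times n$ block $\mathrm{diag}(\lambda_1,\dots,\lambda_n)$;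 $B_1=(1,b_1,\dots,b_n)^\top$; $L_1=(\alpha,e_1'(0),\dots,e_n'(0))$; $A=\begin{pmatrix}A_1&0\\L_1&0\end{pmatrix}\in\mathbb{R}^{(n+2)\times(n+2)}$, $B=\begin{pmatrix}B_1\\\beta\end{pmatrix}\in\mathbb{R}^{n+2}$. A gain $K\in\mathbb{R}^{1\times(n+2)}$ is fixed such that $A_K=A+e^{-DA}BK$ is Hurwitz. Closed-loop system. Data: $r:\mathbb{R}_+\to\mathbb{R}$ continuous, $d:\mathbb{R}_+\to L^2(0,L)$ continuously differentiable, $y_0\in H^2(0,L)\cap H_0^1(0,L)$, $z_0\in\mathbb{R}$. The system is $y_t=y_{xx}+c(x)y+d(t,x)$, $\dot z(t)=y_x(t,0)-r(t)$, $y(t,0)=0$, $y(t,L)=u_D(t):=u(t-D)$, $y(0,\cdot)=y_0$, $z(0)=z_0$, where $u(t)=0$ for $t<0$ and $u(t)=\int_0^tv(\tau)\,d\tau$ for $t\geq0$. Write $v_D(t)=v(t-D)$, $w(t,x)=y(t,x)-\frac{x}{L}u_D(t)$, $w_j(t)=\langle w(t,\cdot),e_j\rangle$, $\zeta(t)=z(t)-\sum_{j\geq n+1}\frac{e_j'(0)}{\lambda_j}w_j(t)$, $X=(u_D,w_1,\dots,w_n,\zeta)^\top\in\mathbb{R}^{n+2}$. The control is $v(t)=0$ for $t<0$ and $v(t)=KZ(t)$ for $t\geq0$, with $Z(t)=X(t)+\int_{t-D}^te^{A(t-D-\tau)}Bv(\tau)\,d\tau$. Thus $w_t=\mathcal{A}w+a\,u_D+b\,v_D+d$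 with $w(t,\cdot)\in D(\mathcal{A})$, $w(0)=y_0$, and $\dot z(t)=w_x(t,0)+\frac1Lu_D(t)-r(t)$. Equilibrium and deviations. For $r_e\in\mathbb{R}$, $d_e\in L^2(0,L)$, let $d_{e,j}=\langle d_e,e_j\rangle$, $\Gamma_e=\big(0,d_{e,1},\dots,d_{e,n},-r_e-\sum_{j\geq n+1}\frac{e_j'(0)}{\lambda_j}d_{e,j}\big)^\top$, $Z_e=X_e=-A_K^{-1}\Gamma_e=:(u_e,w_{1,e},\dots,w_{n,e},\zeta_e)^\top$, $w_{j,e}=-\frac{a_j}{\lambda_j}u_e-\frac{d_{e,j}}{\lambda_j}$ for $j\geq n+1$, $w_e=\sum_{j\geq1}w_{j,e}e_j\in D(\mathcal{A})$. Deviations: $\Delta r=r-r_e$, $\Delta d=d-d_e$, $\Delta u_D=u_D-u_e$, $\Delta\zeta=\zeta-\zeta_e$, $\Delta w=w-w_e$. Property (S) for $\kappa>0$: there exists $\overline{C}_1>0$ such that, for every $\epsilon\in[0,1)$, there exists $\overline{C}_2(\epsilon)>0$ such that, along every closed-loop trajectory and for all $t\geq0$, $\Delta u_D(t)^2+\Delta\zeta(t)^2+\Vert\Delta w(t)\Vert_{H_0^1(0,L)}^2\leq\overline{C}_1e^{-2\kappa t}\big(\Delta u_D(0)^2+\Delta\zeta(0)^2+\Vert\Delta w(0)\Vert_{H_0^1(0,L)}^2\big)+\overline{C}_2(\epsilon)\sup_{0\leq s\leq t}e^{-2\epsilon\kappa(t-s)}\{\Delta r(s)^2+\Vert\Delta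 d(s)\Vert^2\}$, with $\kappa,\overline{C}_1,\overline{C}_2(\epsilon)$ independent of $r_e,d_e$. *)

(* Defs.v *)
From HB Require Import structures.
From mathcomp Require Import all_boot all_order all_algebra.
From mathcomp Require Import complex.
From mathcomp Require Import all_classical all_reals all_analysis.

Set Implicit Arguments.
Unset Strict Implicit.
Unset Printing Implicit Defensive.
Import Order.TTheory GRing.Theory Num.Theory.
Import numFieldNormedType.Exports.

Local Open Scope classical_set_scope.
Local Open Scope ring_scope.

(* Functions on (0,L) are represented by total functions R -> R whose values
   outside [0,L] are irrelevant: every notion below only looks at the
   restriction to [0,L], or to (0,L). *)

Definition L2 (R : realType) (L : R) (f : R -> R) : Prop :=
  (f \_ `[0, L]) \in Lfun (@lebesgue_measure R) 2%:E.

Definition Linfty (R : realType) (L : R) (f : R -> R) : Prop :=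
  (f \_ `[0, L]) \in Lfun (@lebesgue_measure R) +oo%E.

Definition L2norm (R : realType) (L : R) (f : R -> R) : R :=
  fine ('N[@lebesgue_measure R]_2%:E [EFin \o (f \_ `[0, L])]).

Definition inner (R : realType) (L : R) (f g : R -> R) : R :=
  \int[@lebesgue_measure R]_(x in `[0, L]) (f x * g x).

(* f is the absolutely continuous representative of an element of H^1(0,L)
   whose weak derivative is g. *)
Definition is_weak_derivative (R : realType) (L : R) (f g : R -> R) : Prop :=
  L2 L g /\
  forall x, 0 <= x <= L ->
    f x = f 0 + \int[@lebesgue_measure R]_(s in `[0, x]) g s.

Definition H1 (R : realType) (L : R) (f : R -> R) : Prop :=
  exists g, is_weak_derivative L f g.

Definition H2 (R : realType) (L : R) (f : R -> R) : Prop :=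
  exists2 g, is_weak_derivative L f g & H1 L g.

(* The weak derivatives f' and f'', which are determined up to a null set; f''
   is taken through the absolutely continuous representative of f'. *)
Definition wderiv (R : realType) (L : R) (f : R -> R) : R -> R :=
  xget (fun=> 0) [set g | is_weak_derivative L f g].

Definition wderiv2 (R : realType) (L : R) (f : R -> R) : R -> R :=
  xget (fun=> 0)
    [set h | exists2 g, is_weak_derivative L f g & is_weak_derivative L g h].

Definition H10norm (R : realType) (L : R) (f : R -> R) : R :=
  L2norm L (wderiv L f).

Definition domA (R : realType) (L : R) (f : R -> R) : Prop :=
  [/\ H2 L f, f 0 = 0 & f L = 0].

Definition opA (R : realType) (L : R) (c f : R -> R) : R -> R :=
  fun x => wderiv2 L f x + c x * f x.

(* The boundary derivative f'(0). *)
Definition dx0 (R : realType) (f : R -> R) : R :=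
  lim ((f h - f 0) / h @[h --> 0^'+]).

(* Derivatives in time on R_+, one-sided at t = 0. *)
Definition is_derive_Rplus (R : realType) (f : R -> R) (t l : R) : Prop :=
  (f s - f t) / (s - t) @[s --> within [set s | 0 <= s] t^'] --> l.

Definition L2_continuous (R : realType) (L : R) (f : R -> R -> R) : Prop :=
  forall t, 0 <= t -> L2 L (f t) /\
    L2norm L (fun x => f s x - f t x)
      @[s --> within [set s | 0 <= s] (nbhs t)] --> (0 : R).

(* f : R_+ -> L^2(0,L) is continuously differentiable, with derivative g. *)
Definition L2_C1 (R : realType) (L : R) (f g : R -> R -> R) : Prop :=
  L2_continuous L g /\
  forall t, 0 <= t -> L2 L (f t) /\
    L2norm L (fun x => (f s x - f t x) / (s - t) - g t x)
      @[s --> within [set s | 0 <= s] t^'] --> (0 : R).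

Definition hilbert_basis (R : realType) (L : R) (e : nat -> R -> R) : Prop :=
  [/\ forall j, L2 L (e j),
      forall i j, inner L (e i) (e j) = (i == j)%:R &
      forall f, L2 L f ->
        L2norm L (fun x => f x - \sum_(j < N) inner L f (e j) * e j x)
          @[N --> \oo] --> (0 : R)].

(* Indices are shifted by one: e j and lambda j, j >= 0, stand for e_{j+1} and
   lambda_{j+1}. Hence the n modes with lambda_j >= 0 have indices j < n and
   the tails of the series start at j = n. *)
Definition spectral_data (R : realType) (L : R) (c : R -> R)
    (e : nat -> R -> R) (lambda : nat -> R) : Prop :=
  [/\ hilbert_basis L e,
      forall j, domA L (e j),
      forall j, {ae @lebesgue_measure R, forall x, 0 < x < L ->
        opA L c (e j) x = lambda j * e j x},
      forall j, lambda j.+1 < lambda j &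
      lambda j @[j --> \oo] --> -oo].

Definition expmx (R : realType) (m : nat) (M : 'M[R]_m) : 'M[R]_m :=
  limn (series (fun k => (k`!%:R)^-1 *: M ^+ k)).

Definition hurwitz (R : realType) (m : nat) (M : 'M[R]_m) : Prop :=
  forall z : R[i], eigenvalue (map_mx (real_complex R) M) z ->
    complex.Re z < 0.

Section system.
Context (R : realType) (L D : R) (c : R -> R).
Context (e : nat -> R -> R) (lambda : nat -> R) (n : nat).

Definition a_coef (j : nat) : R := inner L (fun x => x / L * c x) (e j).
Definition b_coef (j : nat) : R := inner L (fun x => - (x / L)) (e j).

(* sum_{j >= n+1} e_j'(0) / lambda_j f_j *)
Definition tail (f : nat -> R) : R :=
  limn (fun N => \sum_(n <= j < N) dx0 (e j) / lambda j * f j).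

Definition alpha : R := L^-1 - tail a_coef.
Definition beta : R := - tail b_coef.

Definition A1 : 'M[R]_(1 + n) :=
  block_mx 0 0
           (\col_(j < n) a_coef j) (diag_mx (\row_(j < n) lambda j)).
Definition B1 : 'cV[R]_(1 + n) := col_mx 1%:M (\col_(j < n) b_coef j).
Definition L1 : 'rV[R]_(1 + n) :=
  row_mx alpha%:M (\row_(j < n) dx0 (e j)).

Definition matA : 'M[R]_(1 + n + 1) := block_mx A1 0 L1 0.
Definition matB : 'cV[R]_(1 + n + 1) := col_mx B1 beta%:M.
Definition matAK (K : 'rV[R]_(1 + n + 1)) : 'M[R]_(1 + n + 1) :=
  matA + expmx ((- D) *: matA) *m matB *m K.

Definition input (v : R -> R) (t : R) : R :=
  if t < 0 then 0
  else \int[@lebesgue_measure R]_(s in `[0, t]) v s.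
Definition u_D (v : R -> R) (t : R) : R := input v (t - D).

Definition w_of (y : R -> R -> R) (v : R -> R) (t x : R) : R :=
  y t x - x / L * u_D v t.

Definition zeta_of (y : R -> R -> R) (z v : R -> R) (t : R) : R :=
  z t - tail (fun j => inner L (w_of y v t) (e j)).

Definition X_of (y : R -> R -> R) (z v : R -> R) (t : R) :
    'cV[R]_(1 + n + 1) :=
  col_mx (col_mx (u_D v t)%:M (\col_(j < n) inner L (w_of y v t) (e j)))
         (zeta_of y z v t)%:M.

Definition Z_of (y : R -> R -> R) (z v : R -> R) (t : R) :
    'cV[R]_(1 + n + 1) :=
  X_of y z v t +
  \col_i (\int[@lebesgue_measure R]_(tau in `[t - D, t])
            ((expmx ((t - D - tau) *: matA) *m matB) i ord0 * v tau)).

(* dd is the time derivative of d. The integrated input is meaningful because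
   v is continuous on R_+. The solution y is classical, in C^1(R_+; L^2(0,L))
   with values in H^2(0,L); since y(t,.) is an absolutely continuous
   representative, the boundary conditions hold pointwise. *)
Record closed_loop (K : 'rV[R]_(1 + n + 1)) (r : R -> R)
    (d dd : R -> R -> R) (y0 : R -> R) (z0 : R)
    (y : R -> R -> R) (z v : R -> R) : Prop := ClosedLoop {
  cl_r : {within [set t | 0 <= t], continuous r} ;
  cl_d : L2_C1 L d dd ;
  cl_y0 : domA L y0 ;
  cl_v_cont : {within [set t | 0 <= t], continuous v} ;
  cl_v_neg : forall t, t < 0 -> v t = 0 ;
  cl_v : forall t, 0 <= t -> v t = (K *m Z_of y z v t) ord0 ord0 ;
  cl_y_H2 : forall t, 0 <= t -> H2 L (y t) ;
  cl_pde : L2_C1 L y (fun t x => opA L c (y t) x + d t x) ;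
  cl_bc0 : forall t, 0 <= t -> y t 0 = 0 ;
  cl_bcL : forall t, 0 <= t -> y t L = u_D v t ;
  cl_y_init : forall x, 0 <= x <= L -> y 0 x = y0 x ;
  cl_z : forall t, 0 <= t -> is_derive_Rplus z t (dx0 (y t) - r t) ;
  cl_z_init : z 0 = z0 }.

Definition Gamma_e (re : R) (de : R -> R) : 'cV[R]_(1 + n + 1) :=
  col_mx (col_mx 0 (\col_(j < n) inner L de (e j)))
         (- re - tail (fun j => inner L de (e j)))%:M.

Definition X_e (K : 'rV[R]_(1 + n + 1)) (re : R) (de : R -> R) :
    'cV[R]_(1 + n + 1) :=
  - (invmx (matAK K) *m Gamma_e re de).

Definition u_e K re de : R := usubmx (usubmx (X_e K re de)) ord0 ord0.
Definition zeta_e K re de : R := dsubmx (X_e K re de) ord0 ord0.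

(* w_{j,e} for j < n is read off X_e; this is the formula for j >= n. *)
Definition w_e_tail K re de (j : nat) : R :=
  - (a_coef j / lambda j * u_e K re de) - inner L de (e j) / lambda j.

(* we is the representative in D(A) of the L^2-sum of the w_{j,e} e_j. *)
Definition is_w_e K re de (we : R -> R) : Prop :=
  domA L we /\
  L2norm L (fun x => we x -
      (\sum_(j < n) dsubmx (usubmx (X_e K re de)) j ord0 * e j x +
       \sum_(n <= j < N) w_e_tail K re de j * e j x))
    @[N --> \oo] --> (0 : R).

Definition dev_w (y : R -> R -> R) (v : R -> R) (we : R -> R) (t x : R) : R :=
  w_of y v t x - we x.

Definition sup_upto (t : R) (f : R -> R) : R :=
  sup [set f s | s in [set s | 0 <= s <= t]].

Definition ISS (K : 'rV[R]_(1 + n + 1)) (kappa : R) : Prop :=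
  exists2 C1 : R, 0 < C1 &
  forall eps : R, 0 <= eps < 1 ->
  exists2 C2 : R, 0 < C2 &
  forall (re : R) (de we : R -> R), L2 L de -> is_w_e K re de we ->
  forall r d dd y0 z0 y z v, closed_loop K r d dd y0 z0 y z v ->
  forall t, 0 <= t ->
    (u_D v t - u_e K re de) ^+ 2 + (zeta_of y z v t - zeta_e K re de) ^+ 2
      + H10norm L (dev_w y v we t) ^+ 2 <=
    C1 * expR (- 2 * kappa * t) *
      ((u_D v 0 - u_e K re de) ^+ 2 + (zeta_of y z v 0 - zeta_e K re de) ^+ 2
       + H10norm L (dev_w y v we 0) ^+ 2)
    + C2 * sup_upto t (fun s => expR (- 2 * eps * kappa * (t - s)) *
        ((r s - re) ^+ 2 + L2norm L (fun x => d s x - de x) ^+ 2)).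

End system.

(* Main.v *)
Require Import Defs.
From mathcomp Require Import all_boot all_order all_algebra.
From mathcomp Require Import complex.
From mathcomp Require Import all_classical all_reals all_analysis.
From mathcomp Require Import measurable_realfun ess_sup_inf ring lra.

Set Implicit Arguments.
Unset Strict Implicit.
Unset Printing Implicit Defensive.
Import Order.TTheory GRing.Theory Num.Theory.
Import numFieldNormedType.Exports.

Local Open Scope classical_set_scope.
Local Open Scope ring_scope.

(* With h(x) = 1 - x/L, Green's formula gives f'(0) = <f, c h> - <A f, h> for f
   in D(A), and at the equilibrium w_e'(0) + u_e/L = r_e. Hence y_x(t,0) - r(t)
   is controlled by Delta u_D, Delta r, the L^2 norm of Delta w and
   <A Delta w, h> = <y_t, h> - Delta u_D <a, h> - <Delta d, h>; (S) bounds all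
   of these but <y_t, h>. The coefficients p_j of y_t satisfy
     p_j' = lambda_j p_j + (a_j + lambda_j b_j) v_D + <d', e_j>,
   which is used on the window [max(0, t-1), t] only. The unbounded term
   lambda_j b_j v_D is harmless without any derivative of v, since
   |lambda_j| e^(lambda_j (t-s)) integrates to at most 1 + e^|lambda_1|; the
   initial value is bounded by A Delta w(0) when t <= 1, and otherwise by
   Delta w(t-1), because lambda e^lambda is bounded above lambda_1. Decay thus
   comes from (S) alone, and kappa need not be compared with lambda_(n+1).
   Finally v_D(t) = K Z(t-D) is bounded by Delta X(t) and by Delta r, Delta d on
   [t-D, t]: the predictor satisfies e^(DA) Z(t-D) = X(t) up to an integral of
   the perturbations. *)

(** * Square-integrable functions on [0, L] *)

(** (S) controls Delta w in H_0^1 only, and <A Delta w, h> cannot be reduced to that norm by moving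
    A onto h: since h(0) = 1, this brings back the flux itself. Hence y_t is brought in, and with it
    d' and A Delta w(0) in the final estimate. The control is switched on at time 0, so v_D may jump
    at t = D. The evolution identities that contain v_D hold off D only, and the mean-value
    arguments allow for one exceptional time. No infinite series is differentiated in time. Partial
    sums are bounded uniformly in N, by pairing bounded weights with products of L^2 coefficients,
    and Parseval's identity gives the limit at the very end. Everything is written in deviations
    from the equilibrium. This includes v, whose equilibrium value is 0 because A_K X_e = -Gamma_e
    forces K X_e = 0; so r_e and d_e enter no constant. All times used lie within 1 + D of t (window
    plus delay), apart from those inside (S). Moving the exponential weights from such a time to t
    costs the factor e^(kappa (1 + D)). *)

Section L2theory.
Context (R : realType) (L : R).
Local Notation mu := (@lebesgue_measure R).
Implicit Types (f g h : R -> R) (k M : R).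

Lemma integrable_EFinD (A : set R) f g : measurable A ->
  mu.-integrable A (EFin \o f) -> mu.-integrable A (EFin \o g) ->
  mu.-integrable A (EFin \o (fun x => f x + g x)).
Proof.
move=> mA intf intg.
rewrite (_ : _ \o _ = (EFin \o f) \+ (EFin \o g))%E//; exact: integrableD.
Qed.

Lemma integrable_EFinZ (A : set R) k f : measurable A ->
  mu.-integrable A (EFin \o f) ->
  mu.-integrable A (EFin \o (fun x => k * f x)).
Proof.
move=> mA intf.
rewrite (_ : _ \o _ = fun x => k%:E * (EFin \o f) x)%E//; exact: integrableZl.
Qed.

Lemma integrable_EFinB (A : set R) f g : measurable A ->
  mu.-integrable A (EFin \o f) -> mu.-integrable A (EFin \o g) ->
  mu.-integrable A (EFin \o (fun x => f x - g x)).
Proof.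
move=> mA intf intg.
rewrite (_ : _ \o _ = (EFin \o f) \- (EFin \o g))%E//; exact: integrableB.
Qed.

(** The working form of [L2]: closure properties reduce to comparing integrands by
    [le_integrable]. *)
Lemma L2P f : L2 L f <->
  measurable_fun `[0, L] f /\ mu.-integrable `[0, L] (EFin \o (fun x => f x ^+ 2)).
Proof.
have E : (fun x => (f \_ `[0, L]) x ^+ 2) = (fun x => f x ^+ 2) \_ `[0, L].
  by apply/funext => x; rewrite !patchE; case: ifP => // _; rewrite expr0n.
split=> [H|[mf intf]].
- have mf : measurable_fun `[0, L] f.
    apply/(measurable_restrictT _ _).2 => //.
    by move: H; rewrite /L2 inE => /andP[/[!inE]].
  split=> //; have := Lfun2_integrable_sqr H; rewrite E -restrict_EFin.
  by move/integrable_restrict; rewrite setTI; apply.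
- rewrite /L2 inE; apply/andP; split.
    by rewrite inE; apply/(measurable_restrictT _ _).1.
  rewrite inE /= /finite_norm unlock /= poweR_lty//.
  move/integrableP: intf => [_]; rewrite integral_mkcond/=.
  apply: le_lt_trans; rewrite le_eqVlt; apply/orP; left; apply/eqP.
  apply: eq_integral => x _.
  rewrite patchE; case: ifPn => xI; rewrite /= patchE ?xI ?(negbTE xI)/=.
    by rewrite normrX powR_mulrn.
  (* Outside [0, L] the restriction takes the default value [point], which is 0 in [R]. *)
  by rewrite -[point]/(0 : R) normr0 powR0.
Qed.

Lemma measurable_L2 f : L2 L f -> measurable_fun `[0, L] f.
Proof. by case/L2P. Qed.

Lemma sqr_L2norm f : L2 L f -> L2norm L f ^+ 2 = inner L f f.
Proof.
move=> Lf; have /L2P[mf intf] := Lf.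
have fN : 'N[mu]_2%:E[EFin \o (f \_ `[0%R, L])]%E \is a fin_num.
  rewrite ge0_fin_numE ?Lnorm_ge0//.
  by move: Lf; rewrite /L2 inE => /andP[_]; rewrite inE.
have := @powR_Lnorm _ _ _ mu (EFin \o (f \_ `[0, L])) 2.
rewrite pnatr_eq0 => /(_ isT); rewrite -(fineK fN) poweR_EFin powR_mulrn ?fine_ge0
  ?Lnorm_ge0//.
move=> /(congr1 fine)/= H; rewrite /L2norm H// /inner Rintegral_mkcond /Rintegral.
congr fine; apply: eq_integral => x _.
rewrite /= !patchE; case: ifPn => xI.
  by rewrite powR_mulrn// -normrX ger0_norm ?sqr_ge0// expr2.
by rewrite normr0 powR0.
Qed.

Lemma L2norm_ge0 f : 0 <= L2norm L f.
Proof. by rewrite fine_ge0// Lnorm_ge0. Qed.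

Lemma L2_mul_integrable f g : L2 L f -> L2 L g ->
  mu.-integrable `[0, L] (EFin \o (fun x => f x * g x)).
Proof.
move=> Lf Lg; have := @Lfun1_integrable _ _ _ mu (f \_ `[0,L] \* g \_ `[0,L]).
case => + _ => /(_ (Lfun2_mul_Lfun1 Lf Lg)).
rewrite (_ : _ \* _ = (fun x => f x * g x) \_ `[0, L]); last first.
  by apply/funext => x; rewrite /= !patchE; case: ifP => // _; rewrite mulr0.
by rewrite -restrict_EFin => /integrable_restrict; rewrite setTI; apply.
Qed.

Lemma L2_eq f g : {in `[0, L], f =1 g} -> L2 L f -> L2 L g.
Proof.
move=> fg; rewrite /L2 (_ : f \_ `[0, L] = g \_ `[0, L])//.
by apply/funext => x; rewrite !patchE; case: ifPn => // /[!inE]/fg.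
Qed.

Lemma L2D f g : L2 L f -> L2 L g -> L2 L (fun x => f x + g x).
Proof.
move=> /L2P[mf if2] /L2P[mg ig2]; apply/L2P; split; first exact: measurable_funD.
apply: (le_integrable _ _ _
  (integrable_EFinD _ (integrable_EFinZ 2 _ if2) (integrable_EFinZ 2 _ ig2))) => //.
- apply/measurable_EFinP/measurable_funX; exact: measurable_funD.
- move=> x _; rewrite lee_fin ger0_norm ?sqr_ge0//.
  have ? := sqr_ge0 (f x); have ? := sqr_ge0 (g x).
  rewrite ger0_norm; last by lra.
  by have := sqr_ge0 (f x - g x); nra.
Qed.

Lemma L2Z k f : L2 L f -> L2 L (fun x => k * f x).
Proof.
move=> /L2P[mf if2]; apply/L2P; split; first exact: measurable_funM.
rewrite (_ : (fun x => _) = (fun x => k ^+ 2 * f x ^+ 2)).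
  exact: integrable_EFinZ.
by apply/funext => x; rewrite exprMn.
Qed.

Lemma L2B f g : L2 L f -> L2 L g -> L2 L (fun x => f x - g x).
Proof.
move=> Lf Lg; apply: (L2_eq _ (L2D Lf (L2Z (-1) Lg))) => x _.
by rewrite mulN1r.
Qed.

Lemma L2_0 : L2 L (fun=> 0).
Proof.
apply/L2P; split => //.
rewrite (_ : EFin \o _ = cst 0%E); first exact: integrable0.
by apply/funext => x /=; rewrite expr0n.
Qed.

Lemma L2_sum m N (F : nat -> R -> R) : (forall j, L2 L (F j)) ->
  L2 L (fun x => \sum_(m <= j < N) F j x).
Proof.
move=> LF; elim: N => [|N IH].
  by apply: L2_eq L2_0 => x _; rewrite big_geq.
have [Nm|mN] := ltnP N m.
  by apply: L2_eq L2_0 => x _; rewrite big_geq.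
by apply: L2_eq (L2D IH (LF N)) => x _; rewrite big_nat_recr.
Qed.

Lemma innerC f g : inner L f g = inner L g f.
Proof. by apply: eq_Rintegral => x _; rewrite mulrC. Qed.

Lemma eq_inner f f' g g' : {in `[0, L], f =1 f'} -> {in `[0, L], g =1 g'} ->
  inner L f g = inner L f' g'.
Proof.
move=> ff gg; apply: eq_Rintegral => x /[!inE] xI.
by rewrite ff ?gg// inE.
Qed.

Lemma innerDl f g h : L2 L f -> L2 L g -> L2 L h ->
  inner L (fun x => f x + g x) h = inner L f h + inner L g h.
Proof.
move=> Lf Lg Lh; rewrite /inner -RintegralD ?L2_mul_integrable//.
by apply: eq_Rintegral => x _; rewrite mulrDl.
Qed.

Lemma innerZl k f h : L2 L f -> L2 L h ->
  inner L (fun x => k * f x) h = k * inner L f h.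
Proof.
move=> Lf Lh; rewrite /inner -RintegralZl ?L2_mul_integrable//.
by apply: eq_Rintegral => x _; rewrite mulrA.
Qed.

Lemma innerBl f g h : L2 L f -> L2 L g -> L2 L h ->
  inner L (fun x => f x - g x) h = inner L f h - inner L g h.
Proof.
move=> Lf Lg Lh; rewrite /inner -RintegralB ?L2_mul_integrable//.
by apply: eq_Rintegral => x _; rewrite mulrBl.
Qed.

Lemma innerDr f g h : L2 L f -> L2 L g -> L2 L h ->
  inner L h (fun x => f x + g x) = inner L h f + inner L h g.
Proof. by move=> *; rewrite innerC innerDl// !(innerC h). Qed.

Lemma innerZr k f h : L2 L f -> L2 L h ->
  inner L h (fun x => k * f x) = k * inner L h f.
Proof. by move=> *; rewrite innerC innerZl// innerC. Qed.

Lemma inner0l h : inner L (fun=> 0) h = 0.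
Proof.
by rewrite /inner /Rintegral integral0_eq// => x _; rewrite mul0r.
Qed.

Lemma inner_suml m N (F : nat -> R -> R) h : (forall j, L2 L (F j)) -> L2 L h ->
  inner L (fun x => \sum_(m <= j < N) F j x) h = \sum_(m <= j < N) inner L (F j) h.
Proof.
have Z N' : (N' <= m)%N ->
    inner L (fun x => \sum_(m <= j < N') F j x) h = 0.
  by move=> ?; rewrite -[RHS](inner0l h); apply: eq_inner => // x _; rewrite big_geq.
move=> LF Lh; elim: N => [|N IH]; first by rewrite Z// big_geq.
have [Nm|mN] := ltnP N m; first by rewrite Z// big_geq.
rewrite big_nat_recr//= -IH -innerDl//; last exact: L2_sum.
by apply: eq_inner => // x _; rewrite big_nat_recr.
Qed.

Lemma inner_ge0 f : 0 <= inner L f f.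
Proof. by apply: Rintegral_ge0 => x _; rewrite -expr2 sqr_ge0. Qed.

Lemma L2normE f : L2 L f -> L2norm L f = Num.sqrt (inner L f f).
Proof. by move=> Lf; rewrite -sqr_L2norm// sqrtr_sqr ger0_norm ?L2norm_ge0. Qed.

Lemma L2norm_eq f g : {in `[0, L], f =1 g} -> L2norm L f = L2norm L g.
Proof.
move=> fg; rewrite /L2norm (_ : f \_ `[0, L] = g \_ `[0, L])//.
by apply/funext => x; rewrite !patchE; case: ifPn => // /[!inE]/fg.
Qed.

Lemma L2_CauchySchwarz f g : L2 L f -> L2 L g ->
  `|inner L f g| <= L2norm L f * L2norm L g.
Proof.
move=> Lf Lg; rewrite -ler_sqr ?nnegrE ?mulr_ge0 ?L2norm_ge0//.
rewrite real_normK ?num_real// exprMn !sqr_L2norm//.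
set a := inner L f f; set b := inner L f g; set d := inner L g g.
(* The Gram form <k f + l g, k f + l g>; both cases below evaluate it at a suitable pair (k, l). *)
have P k l : 0 <= k ^+ 2 * a + 2 * k * l * b + l ^+ 2 * d.
  have := inner_ge0 (fun x => k * f x + l * g x).
  rewrite innerDl ?innerZl//; try exact: L2Z; try by apply: L2D; exact: L2Z.
  rewrite !(innerC _ (fun x => _ + _)) !innerDl ?innerZl//; try exact: L2Z.
  by rewrite (innerC g f) -/a -/b -/d => H; lra.
have a0 : 0 <= a := inner_ge0 f.
have d0 : 0 <= d := inner_ge0 g.
have [dE|dN0] := eqVneq d 0.
  rewrite dE mulr0; have [->|bN0] := eqVneq b 0; first by rewrite expr0n.
  (* With d = 0 the form is affine in l, and this l gives it the value - a - 2 < 0. *)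
  have := P 1 (- (a + 1) / b).
  rewrite dE mulr0 addr0 expr1n mul1r mulr1 -(mulrA 2) divfK//; lra.
have dP : 0 < d by rewrite lt_def dN0.
(* At (d, - b) the form equals d (a d - b^2). *)
have := P d (- b) => H.
have : 0 <= d * (a * d - b ^+ 2) by lra.
by rewrite pmulr_rge0// subr_ge0.
Qed.

Lemma ler_L2normD f g : L2 L f -> L2 L g ->
  L2norm L (fun x => f x + g x) <= L2norm L f + L2norm L g.
Proof.
move=> Lf Lg; rewrite -ler_sqr ?nnegrE ?addr_ge0 ?L2norm_ge0//.
have LD := L2D Lf Lg.
rewrite sqr_L2norm// innerDl// !(innerC _ (fun x => _ + _)) !innerDl//.
rewrite sqrrD !sqr_L2norm// (innerC g f).
have := ler_norm (inner L f g); have := L2_CauchySchwarz Lf Lg; lra.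
Qed.

Lemma L2normZ k f : L2 L f -> L2norm L (fun x => k * f x) = `|k| * L2norm L f.
Proof.
move=> Lf; have LZ := L2Z k Lf.
rewrite !L2normE// innerZl// innerC innerZl// mulrA -expr2.
by rewrite sqrtrM ?sqr_ge0// sqrtr_sqr.
Qed.

Lemma L2_mul_bounded f g M : measurable_fun `[0, L] f ->
  (forall x, 0 <= x <= L -> `|f x| <= M) -> L2 L g ->
  L2 L (fun x => f x * g x).
Proof.
move=> mf fM /L2P[mg ig2]; apply/L2P; split; first exact: measurable_funM.
apply: (le_integrable _ _ _ (integrable_EFinZ (M ^+ 2) _ ig2)) => //.
- by apply/measurable_EFinP/measurable_funX; exact: measurable_funM.
- move=> x /=; rewrite in_itv/= => /fM fxM; rewrite lee_fin.
  rewrite ger0_norm ?sqr_ge0// ger0_norm; last by apply: mulr_ge0; exact: sqr_ge0.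
  rewrite exprMn ler_wpM2r ?sqr_ge0//.
  by rewrite -real_normK ?num_real// lerXn2r ?nnegrE// (le_trans _ fxM).
Qed.

Lemma L2_bounded f M : measurable_fun `[0, L] f ->
  (forall x, 0 <= x <= L -> `|f x| <= M) -> L2 L f.
Proof.
move=> mf fM; apply/L2P; split=> //.
apply: measurable_bounded_integrable => //.
- exact: compact_finite_measure (@segment_compact _ 0 L).
- exact: measurable_funX.
- exists (M ^+ 2); split; first by rewrite num_real.
  move=> y My x /=; rewrite in_itv/= => /fM fxM; rewrite normrX.
  apply: (le_trans _ (ltW My)).
  by rewrite lerXn2r ?nnegrE// (le_trans _ fxM).
Qed.

Lemma L2_continuous_fun f : {within `[0, L], continuous f} -> L2 L f.
Proof.
move=> cf; have [M [_ HM]] := compact_bounded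
  (continuous_compact cf (segment_compact (a := 0) (b := L))).
apply: (@L2_bounded _ (M + 1)).
  by apply: subspace_continuous_measurable_fun.
move=> x xI; apply: (HM (M + 1)); first by rewrite ltrDl.
by exists x => //=; rewrite in_itv.
Qed.

Lemma L2_mul_continuous f g : {within `[0, L], continuous f} -> L2 L g ->
  L2 L (fun x => f x * g x).
Proof.
move=> cf Lg; have [M [_ HM]] := compact_bounded
  (continuous_compact cf (segment_compact (a := 0) (b := L))).
apply: (@L2_mul_bounded _ _ (M + 1)) => //.
  by apply: subspace_continuous_measurable_fun.
move=> x xI; apply: (HM (M + 1)); first by rewrite ltrDl.
by exists x => //=; rewrite in_itv.
Qed.

Lemma Linfty_L2 f : Linfty L f -> L2 L f.
Proof.
rewrite /Linfty inE => /andP[/[!inE]/= mf]; rewrite /finite_norm unlock /= => fy.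
(* The norm of exponent +oo is an essential supremum only on a space of positive measure, so this
   case distinction has to be resolved first. *)
have muT : (0 < mu [set: R])%E.
  rewrite (_ : [set: R] = [set` (Interval -oo%O +oo%O : interval R)]).
    have := @lebesgue_measure_itv R (Interval -oo%O +oo%O : interval R).
    by move=> -> /=; exact: ltry.
  by rewrite set_itvE.
move: fy; rewrite muT => /(@ess_supr_bounded _ _ _ mu (Num.norm \o (f \_ `[0, L])))[M HM].
have mfI : measurable_fun `[0, L] f by apply/(measurable_restrictT _ _).2.
apply/L2P; split => //; apply/integrableP; split.
  by apply/measurable_EFinP/measurable_funX.
have M2 : mu.-integrable `[0, L] (EFin \o (fun=> M ^+ 2)).
  apply: continuous_compact_integrable; first exact: segment_compact.
  by apply: continuous_subspaceT => ?; exact: cst_continuous.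
have /integrableP[_] := M2.
apply: le_lt_trans; apply: ae_ge0_le_integral => //.
- by apply: measurableT_comp => //; exact/measurable_EFinP/measurable_funX.
- apply: filterS HM => x /=; rewrite patchE.
  case: ifPn => [_ fM _|]; last by rewrite notin_setE => nI _ /nI.
  rewrite lee_fin !ger0_norm ?sqr_ge0//.
  by rewrite -real_normK ?num_real// lerXn2r ?nnegrE// (le_trans _ fM).
Qed.

End L2theory.

(** * Weak derivatives and Green's formula *)

Section interval_integrals.
Context (R : realType).
Local Notation mu := (@lebesgue_measure R).
Implicit Types (f g : R -> R) (a b x y k M : R).

Lemma integrable_sub_itv a b x y f : a <= x -> y <= b ->
  mu.-integrable `[a, b] (EFin \o f) -> mu.-integrable `[x, y] (EFin \o f).
Proof.
move=> ax yb; apply: integrableS => // t /=; rewrite !in_itv/= => /andP[xt ty].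
by rewrite (le_trans ax xt) (le_trans ty yb).
Qed.

Lemma Rintegral_itv_sub a b x y f : mu.-integrable `[a, b] (EFin \o f) ->
  a <= x -> x <= y -> y <= b ->
  \int[mu]_(t in `[a, y]) f t - \int[mu]_(t in `[a, x]) f t =
  \int[mu]_(t in `[x, y]) f t.
Proof.
move=> intf ax xy yb.
have inty : mu.-integrable `[a, y] (EFin \o f) by exact: integrable_sub_itv intf.
rewrite Rintegral_itvB//.
rewrite Rintegral_itv_obnd_cbnd//.
apply: integrableS inty => // t /=; rewrite !in_itv/= => /andP[xt ->].
by rewrite (le_trans ax (ltW xt)).
Qed.

Lemma Rintegral_cst_itv a b k : a <= b -> \int[mu]_(t in `[a, b]) k = k * (b - a).
Proof.
move=> ab; rewrite Rintegral_cst//; congr (_ * _).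
apply: (etrans (congr1 fine (lebesgue_measure_itv (Interval (BLeft a) (BRight b))))).
rewrite /= lte_fin; case: ltP => // ba.
by rewrite (@le_anti _ _ a b) ?ab ?ba// subrr.
Qed.

Lemma integrable_cst_itv a b k : mu.-integrable `[a, b] (EFin \o (fun=> k)).
Proof.
apply: continuous_compact_integrable; first exact: segment_compact.
by apply: continuous_subspaceT => ?; exact: cst_continuous.
Qed.

Lemma integrable_continuous_itv a b f : {within `[a, b], continuous f} ->
  mu.-integrable `[a, b] (EFin \o f).
Proof. by apply: continuous_compact_integrable; exact: segment_compact. Qed.

Lemma le_normr_Rintegral_itv a b f M : a <= b ->
  mu.-integrable `[a, b] (EFin \o f) ->
  (forall x, a <= x <= b -> `|f x| <= M) ->
  `|\int[mu]_(t in `[a, b]) f t| <= M * (b - a).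
Proof.
move=> ab intf fM; apply: (le_trans (le_normr_Rintegral _ intf)) => //.
rewrite -Rintegral_cst_itv//; apply: le_Rintegral => //.
  exact: (integrable_abse intf).
exact: integrable_cst_itv.
Qed.

(** Cut [a, b] into N equal pieces: the increments of [m] telescope, so |F b - F a| is at most (b -
    a) (m b - m a) / N, for every N. This stands in for the fundamental theorem when F is known
    through integrals only. *)
Lemma eq_endpoints_superlinear (F m : R -> R) a b : a <= b ->
  (forall x y, a <= x -> x <= y -> y <= b ->
    `|F y - F x| <= (y - x) * (m y - m x)) ->
  F b = F a.
Proof.
move=> ab H; apply/eqP; rewrite -subr_eq0 -normr_le0 leNgt; apply/negP => F0.
set d := (b - a) * (m b - m a).
have P N : (0 < N)%N -> N%:R * `|F b - F a| <= d.
  move=> N0; have NR : 0 < N%:R :> R by rewrite ltr0n.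
  pose p (i : nat) := a + i%:R * ((b - a) / N%:R).
  have h0 : 0 <= (b - a) / N%:R by rewrite divr_ge0 ?subr_ge0// ler0n.
  have pN : p N = b by rewrite /p mulrCA divff ?gt_eqF// mulr1 addrC subrK.
  have p0 : p 0%N = a by rewrite /p mul0r addr0.
  have pS (k : nat) : p k.+1 = p k + (b - a) / N%:R.
    by rewrite /p -addn1 natrD mulrDl mul1r addrA.
  have pm (i j : nat) : (i <= j)%N -> p i <= p j.
    by move=> ij; rewrite lerD2l ler_wpM2r// ler_nat.
  have Q (k : nat) : (k <= N)%N -> `|F (p k) - F a| <= (b - a) / N%:R * (m (p k) - m a).
    elim: k => [_|k IH kN]; first by rewrite p0 !subrr normr0 mulr0.
    have ak : a <= p k by rewrite -[leLHS]p0 pm.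
    have kb : p k.+1 <= b by rewrite -[leRHS]pN pm.
    have := H (p k) (p k.+1) ak (pm _ _ (leqnSn k)) kb.
    rewrite {2}pS addrAC subrr add0r => Hk.
    rewrite (_ : F (p k.+1) - F a = (F (p k.+1) - F (p k)) + (F (p k) - F a));
      last by ring.
    apply: (le_trans (ler_normD _ _)).
    apply: (le_trans (lerD Hk (IH (ltnW kN)))).
    by rewrite -mulrDr le_eqVlt; apply/orP; left; apply/eqP; ring.
  have := Q N (leqnn _); rewrite pN => {}Q.
  rewrite mulrC -ler_pdivlMr// /d (le_trans Q)//.
  by rewrite mulrAC.
have d0 : 0 <= d by apply: le_trans (P 1%N isT); rewrite mul1r.
pose N := (Num.truncn (d / `|F b - F a|)).+1.
have := P N isT; rewrite leNgt => /negP; apply.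
by rewrite -ltr_pdivrMr// truncnS_gt.
Qed.
End interval_integrals.

Section weak_derivatives.
Context (R : realType) (L : R) (L_gt0 : 0 < L).
Local Notation mu := (@lebesgue_measure R).
Implicit Types (f g h : R -> R) (k x : R).

Lemma L2_cst k : L2 L (fun=> k).
Proof. by apply: L2_continuous_fun; apply: continuous_subspaceT => ?;
  exact: cst_continuous. Qed.

Lemma L2_integrable f : L2 L f -> mu.-integrable `[0, L] (EFin \o f).
Proof.
move=> /(L2_mul_integrable (L2_cst 1)).
by rewrite (_ : (fun x => 1 * f x) = f)//; apply/funext => x; rewrite mul1r.
Qed.

Lemma weak_derivative_continuous f g : is_weak_derivative L f g ->
  {within `[0, L], continuous f}.
Proof.
move=> [Lg fg]; apply: (@subspace_eq_continuous _ _ _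
  (fun x => f 0 + \int[mu]_(s in `[0, x]) g s)).
  by move=> x /[!inE]/=; rewrite in_itv/= => /fg.
have := parameterized_integral_continuous (ltW L_gt0) (L2_integrable Lg).
move=> H x; apply: cvgD; [exact: cvg_cst | exact: H].
Qed.

Lemma weak_derivative_L2 f g : is_weak_derivative L f g -> L2 L f.
Proof. by move=> /weak_derivative_continuous/L2_continuous_fun. Qed.

Lemma weak_derivative_sub f g x y : is_weak_derivative L f g ->
  0 <= x -> x <= y -> y <= L -> f y - f x = \int[mu]_(s in `[x, y]) g s.
Proof.
move=> [Lg fg] x0 xy yL.
rewrite -(Rintegral_itv_sub (L2_integrable Lg) x0 xy yL) (fg x) ?(fg y); first ring.
  by rewrite (le_trans x0 xy).
by rewrite x0 (le_trans xy yL).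
Qed.

Lemma weak_derivativeD f1 g1 f2 g2 : is_weak_derivative L f1 g1 ->
  is_weak_derivative L f2 g2 ->
  is_weak_derivative L (fun x => f1 x + f2 x) (fun x => g1 x + g2 x).
Proof.
move=> [Lg1 fg1] [Lg2 fg2]; split; first exact: L2D.
move=> x xL; have /andP[x0 x1] := xL.
rewrite RintegralD//; last 2 first.
- exact: integrable_sub_itv (L2_integrable Lg1).
- exact: integrable_sub_itv (L2_integrable Lg2).
by rewrite (fg1 x)// (fg2 x)//; ring.
Qed.

Lemma weak_derivativeZ k f g : is_weak_derivative L f g ->
  is_weak_derivative L (fun x => k * f x) (fun x => k * g x).
Proof.
move=> [Lg fg]; split; first exact: L2Z.
move=> x xL; have /andP[x0 x1] := xL.
rewrite RintegralZl//; last exact: integrable_sub_itv (L2_integrable Lg).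
by rewrite (fg x)//; ring.
Qed.

Lemma weak_derivativeB f1 g1 f2 g2 : is_weak_derivative L f1 g1 ->
  is_weak_derivative L f2 g2 ->
  is_weak_derivative L (fun x => f1 x - f2 x) (fun x => g1 x - g2 x).
Proof.
move=> H1 H2; have := weak_derivativeD H1 (weak_derivativeZ (-1) H2).
rewrite (_ : (fun x => f1 x + -1 * f2 x) = (fun x => f1 x - f2 x)).
  rewrite (_ : (fun x => g1 x + -1 * g2 x) = (fun x => g1 x - g2 x))//.
  by apply/funext => x; rewrite mulN1r.
by apply/funext => x; rewrite mulN1r.
Qed.

Lemma weak_derivative_cst k : is_weak_derivative L (fun=> k) (fun=> 0).
Proof.
split; first exact: L2_cst.
by move=> x /andP[x0 _]; rewrite Rintegral_cst_itv// mul0r addr0.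
Qed.

Lemma weak_derivative_id : is_weak_derivative L id (fun=> 1).
Proof.
split; first exact: L2_cst.
by move=> x /andP[x0 _]; rewrite Rintegral_cst_itv//=; ring.
Qed.

(* The increments of f^2 - 2 int_0^x g f are at most (int_x^y |g|)^2, hence at
   most (y - x) int_x^y g^2, which is superlinear in the mesh. *)
Lemma integration_by_parts_sqr f g : is_weak_derivative L f g ->
  2 * inner L g f = f L ^+ 2 - f 0 ^+ 2.
Proof.
move=> fg; have Lf := weak_derivative_L2 fg; have [Lg _] := fg.
have Ig := L2_integrable Lg.
have Igf := L2_mul_integrable Lg Lf.
have [_ Ig2] := (L2P L g).1 Lg.
pose F x := f x ^+ 2 - 2 * \int[mu]_(s in `[0, x]) (g s * f s).
pose m x := \int[mu]_(s in `[0, x]) (g s ^+ 2).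
suff : F L = F 0.
  rewrite /F set_itv1 Rintegral_set1 mulr0 subr0 => <-.
  by rewrite /inner; ring.
apply: (@eq_endpoints_superlinear _ F m _ _ (ltW L_gt0)) => x y x0 xy yL.
rewrite /m (Rintegral_itv_sub Ig2 x0 xy yL).
have IgA : mu.-integrable `[x, y] (EFin \o g) := integrable_sub_itv x0 yL Ig.
have Ig2A : mu.-integrable `[x, y] (EFin \o (fun s => g s ^+ 2)) :=
  integrable_sub_itv x0 yL Ig2.
have IgfA : mu.-integrable `[x, y] (EFin \o (fun s => g s * f s)) :=
  integrable_sub_itv x0 yL Igf.
have IaA : mu.-integrable `[x, y] (EFin \o (fun s => `|g s|)) := integrable_abse IgA.
set A := \int[mu]_(s in `[x, y]) `|g s|.
have A0 : 0 <= A by exact: Rintegral_ge0.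
have FE : F y - F x = \int[mu]_(s in `[x, y]) ((f y + f x) * g s - 2 * (g s * f s)).
  rewrite RintegralB// ?RintegralZl//; last 2 first.
  - exact: integrable_EFinZ.
  - exact: integrable_EFinZ.
  rewrite -(weak_derivative_sub fg)// -(Rintegral_itv_sub Igf x0 xy yL) /F; ring.
have FA : `|F y - F x| <= A ^+ 2.
  have IB : mu.-integrable `[x, y]
      (EFin \o (fun s => (f y + f x) * g s - 2 * (g s * f s))).
    by apply: integrable_EFinB => //; exact: integrable_EFinZ.
  rewrite FE; apply: (le_trans (le_normr_Rintegral _ IB)) => //.
  rewrite expr2 -RintegralZl//; apply: le_Rintegral => //.
  - exact: integrable_abse IB.
  - exact: integrable_EFinZ.
  move=> s; rewrite /= in_itv/= => /andP[xs sy].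
  (* The two differences are the integrals of g over [s, y] and [x, s], so their moduli add up to at
     most A. *)
  rewrite (_ : _ - _ = ((f y - f s) - (f s - f x)) * g s); last by ring.
  rewrite normrM ler_wpM2r//; apply: (le_trans (ler_normB _ _)).
  rewrite !(weak_derivative_sub fg) ?(le_trans x0 xs) ?(le_trans sy yL)//.
  rewrite addrC; apply: (@le_trans _ _ (\int[mu]_(t in `[x, s]) `|g t| + \int[mu]_(t
    in `[s, y]) `|g t|)).
    by apply: lerD; apply: le_normr_Rintegral => //; apply: integrable_sub_itv IgA.
  by rewrite -(Rintegral_itv_sub IaA xs sy (lexx _)) addrC subrK.
apply: (le_trans FA).
move: xy; rewrite le_eqVlt => /predU1P[xy|xy].
  by rewrite /A -xy set_itv1 Rintegral_set1 subrr mul0r expr0n.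
have d0 : 0 < y - x by rewrite subr_gt0.
(* Cauchy-Schwarz on [x, y]: the integrand is ((y - x) |g| - A)^2, and its integral is (y - x) times
   (y - x) int g^2 - A^2. *)
have : 0 <= \int[mu]_(s in `[x, y])
    ((y - x) ^+ 2 * g s ^+ 2 - (2 * (y - x) * A * `|g s| - A ^+ 2)).
  apply: Rintegral_ge0 => s _.
  rewrite (_ : _ - _ = ((y - x) * `|g s| - A) ^+ 2) ?sqr_ge0//.
  by rewrite -(real_normK (num_real (g s))); ring.
have I1 : mu.-integrable `[x, y] (EFin \o (fun s => (y - x) ^+ 2 * g s ^+ 2)).
  exact: integrable_EFinZ.
have I2 : mu.-integrable `[x, y] (EFin \o (fun s => 2 * (y - x) * A * `|g s|)).
  exact: integrable_EFinZ.
have I3 := integrable_cst_itv x y (A ^+ 2).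
rewrite RintegralB// ?integrable_EFinB// RintegralB// [X in X - _]RintegralZl// [X in
  _ - (X - _)]RintegralZl//.
rewrite Rintegral_cst_itv; last exact: ltW.
rewrite -/A => H.
suff : 0 <= (y - x) * ((y - x) * \int[mu]_(t in `[x, y]) g t ^+ 2 - A ^+ 2).
  by rewrite pmulr_rge0// subr_ge0.
apply: (le_trans H).
by rewrite le_eqVlt; apply/orP; left; apply/eqP; ring.
Qed.

(** Polarisation of [integration_by_parts_sqr]. *)
Lemma integration_by_parts_weak f1 g1 f2 g2 :
  is_weak_derivative L f1 g1 -> is_weak_derivative L f2 g2 ->
  inner L g1 f2 + inner L f1 g2 = f1 L * f2 L - f1 0 * f2 0.
Proof.
move=> H1 H2; have Lf1 := weak_derivative_L2 H1; have Lf2 := weak_derivative_L2 H2.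
have [Lg1 _] := H1; have [Lg2 _] := H2.
have := integration_by_parts_sqr (weak_derivativeD H1 H2).
have := integration_by_parts_sqr H1; have := integration_by_parts_sqr H2.
rewrite innerDl//; last exact: L2D.
rewrite !innerDr// (innerC _ f1 g2); lra.
Qed.

Lemma Green f1 g1 h1 f2 g2 h2 :
  is_weak_derivative L f1 g1 -> is_weak_derivative L g1 h1 ->
  is_weak_derivative L f2 g2 -> is_weak_derivative L g2 h2 ->
  inner L h1 f2 - inner L f1 h2 =
  (g1 L * f2 L - f1 L * g2 L) - (g1 0 * f2 0 - f1 0 * g2 0).
Proof.
move=> H1 K1 H2 K2.
have := integration_by_parts_weak K1 H2; have := integration_by_parts_weak H1 K2.
by lra.
Qed.

(** The difference quotient at 0 is the mean of g over [0, x]. This links the pointwise limit [dx0]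
    to the boundary values that occur in Green's formula. *)
Lemma dx0_weak_derivative f g : is_weak_derivative L f g ->
  {within `[0, L], continuous g} -> dx0 f = g 0.
Proof.
move=> fg /(continuous_within_itvP _ L_gt0)[_ cg _].
have [Lg _] := fg.
apply/cvg_lim => //; apply/cvgrPdist_le => /= eps eps0.
have /cvgrPdist_le/(_ _ eps0) := cg; rewrite /at_right.
move=> [d /= d0 Hd]; near=> x.
have x0 : 0 < x by [].
have xL : x <= L by near: x; apply: nbhs_right_le.
have xd : x < d by near: x; apply: nbhs_right_lt.
have Ix : mu.-integrable `[0, x] (EFin \o g).
  exact: integrable_sub_itv (L2_integrable Lg).
rewrite (weak_derivative_sub fg (lexx 0) (ltW x0) xL).
rewrite (_ : _ - _ = x^-1 * \int[mu]_(s in `[0, x]) (g 0 - g s)); last first.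
  rewrite RintegralB// ?integrable_cst_itv// (Rintegral_cst_itv _ (ltW x0)).
  by rewrite subr0; field; rewrite gt_eqF.
rewrite normrM normfV (gtr0_norm x0) [x^-1 * _]mulrC ler_pdivrMr//.
rewrite -[X in _ <= _ * X]subr0; apply: le_normr_Rintegral_itv; first exact: ltW.
  by apply: integrable_EFinB => //; exact: integrable_cst_itv.
move=> s /andP[]; rewrite le_eqVlt => /predU1P[<- _|s0 sx].
  by rewrite subrr normr0 ltW.
apply: Hd => //=; rewrite sub0r normrN gtr0_norm//; exact: le_lt_trans sx xd.
Unshelve. all: by end_near. Qed.

Lemma Rintegral_normr_le g : L2 L g ->
  \int[mu]_(s in `[0, L]) `|g s| <= Num.sqrt L * L2norm L g.
Proof.
move=> Lg; have /L2P[mg ig2] := Lg.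
have La : L2 L (fun s => `|g s|).
  apply/L2P; split; first exact: measurableT_comp.
  rewrite (_ : (fun x => _) = (fun x => g x ^+ 2))//.
  by apply/funext => x; rewrite real_normK// num_real.
have -> : L2norm L g = L2norm L (fun s => `|g s|).
  rewrite !L2normE//; congr Num.sqrt; apply: eq_Rintegral => x _.
  by rewrite -!expr2 real_normK// num_real.
rewrite (_ : Num.sqrt L = L2norm L (fun=> 1)); last first.
  rewrite L2normE; last exact: L2_cst.
  by rewrite /inner Rintegral_cst_itv ?ltW//; congr Num.sqrt; ring.
apply: le_trans (L2_CauchySchwarz (L2_cst 1) La).
apply: le_trans (ler_norm _).
by rewrite /inner le_eqVlt; apply/orP; left; apply/eqP; apply: eq_Rintegral => s _;
  rewrite mul1r.
Qed.

Lemma weak_derivative_bound f g x : is_weak_derivative L f g -> 0 <= x <= L ->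
  `|f x| <= `|f 0| + Num.sqrt L * L2norm L g.
Proof.
move=> [Lg fg] xL; have /andP[x0 x1] := xL; rewrite fg//.
apply: (le_trans (ler_normD _ _)); rewrite lerD2l.
have Ig := L2_integrable Lg; have Ia : mu.-integrable `[0, L] (EFin \o (fun s =>
  `|g s|)) := integrable_abse Ig.
apply: le_trans (Rintegral_normr_le Lg).
apply: (le_trans (le_normr_Rintegral _ (integrable_sub_itv (lexx _) x1 Ig))) => //.
rewrite -subr_ge0 (Rintegral_itv_sub Ia)//; exact: Rintegral_ge0.
Qed.

Lemma L2norm_le_bound f M : L2 L f -> 0 <= M ->
  (forall x, 0 <= x <= L -> `|f x| <= M) -> L2norm L f <= M * Num.sqrt L.
Proof.
move=> Lf M0 fM; rewrite -ler_sqr ?nnegrE ?L2norm_ge0 ?mulr_ge0 ?sqrtr_ge0//.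
rewrite sqr_L2norm// exprMn (sqr_sqrtr (ltW L_gt0)) -[X in _ <= _ * X]subr0.
rewrite -(Rintegral_cst_itv _ (ltW L_gt0)); apply: le_Rintegral => //.
- exact: L2_mul_integrable.
- exact: integrable_cst_itv.
move=> x /=; rewrite in_itv/= => /fM xM.
by rewrite -expr2 -real_normK ?num_real// lerXn2r ?nnegrE.
Qed.

Lemma Poincare f g : is_weak_derivative L f g -> f 0 = 0 ->
  L2norm L f <= L * L2norm L g.
Proof.
move=> fg f0; rewrite -{2}(sqr_sqrtr (ltW L_gt0)) expr2 mulrAC.
apply: L2norm_le_bound (weak_derivative_L2 fg) _ _.
  by rewrite mulr_ge0 ?sqrtr_ge0 ?L2norm_ge0.
by move=> x /(weak_derivative_bound fg); rewrite f0 normr0 add0r.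
Qed.

Lemma H10norm_Poincare f : H1 L f -> f 0 = 0 -> L2norm L f <= L * H10norm L f.
Proof.
move=> [g fg]; apply: Poincare; rewrite /wderiv.
by have := @xgetPex _ (fun=> 0) [set g | is_weak_derivative L f g]; apply; exists g.
Qed.

End weak_derivatives.

(** * Eigenfunction expansions *)

Section spectral.
Context (R : realType) (L : R) (e : nat -> R -> R) (basis : hilbert_basis L e).
Local Notation mu := (@lebesgue_measure R).
Implicit Types (f g h : R -> R) (k M x : R) (w : nat -> R).
Local Notation "f `_[ j ]" := (inner L f (e j)) (at level 3, format "f `_[ j ]").

Lemma basis_L2 j : L2 L (e j). Proof. by have [] := basis. Qed.
#[local] Hint Resolve basis_L2 : core.

Lemma L2norm_basis j : L2norm L (e j) = 1.
Proof.
have [_ H _] := basis.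
by rewrite L2normE// H eqxx sqrtr1.
Qed.

Lemma coef_le f j : L2 L f -> `|f`_[j]| <= L2norm L f.
Proof.
by move=> Lf; rewrite -[leRHS]mulr1 -(L2norm_basis j); exact: L2_CauchySchwarz.
Qed.

Lemma Parseval f g : L2 L f -> L2 L g ->
  (fun N => \sum_(0 <= j < N) f`_[j] * g`_[j]) @ \oo --> inner L f g.
Proof.
move=> Lf Lg; have [_ _ /(_ f Lf) H] := basis.
have LS N : L2 L (fun x => \sum_(0 <= j < N) f`_[j] * e j x).
  by apply: L2_sum => j; exact: L2Z.
apply/cvgrPdist_le => eps eps0.
have g0 : 0 < L2norm L g + 1 by rewrite ltr_wpDl// L2norm_ge0.
have /cvgrPdist_le/(_ (eps / (L2norm L g + 1))) := H.
rewrite divr_gt0// => /(_ isT); apply: filterS => N.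
rewrite sub0r normrN ger0_norm ?L2norm_ge0// => HN.
have -> : inner L f g - \sum_(0 <= j < N) f`_[j] * g`_[j] =
    inner L (fun x => f x - \sum_(0 <= j < N) f`_[j] * e j x) g.
  rewrite innerBl// inner_suml//; last by move=> j; exact: L2Z.
  congr (_ - _); apply: eq_bigr => j _; rewrite innerZl//.
  by rewrite (innerC _ (e j)).
apply: (le_trans (L2_CauchySchwarz (L2B Lf (LS N)) Lg)).
have E : L2norm L (fun x => f x - \sum_(0 <= j < N) f`_[j] * e j x) <=
    eps / (L2norm L g + 1).
  rewrite (le_trans _ HN)// le_eqVlt; apply/orP; left; apply/eqP.
  by apply: L2norm_eq => x _; rewrite big_mkord.
apply: (le_trans (ler_wpM2r (L2norm_ge0 L g) E)).
by rewrite mulrAC ler_pdivrMr// ler_wpM2l ?(ltW eps0)// lerDl.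
Qed.

Lemma Bessel f N : L2 L f -> \sum_(0 <= j < N) f`_[j] ^+ 2 <= L2norm L f ^+ 2.
Proof.
move=> Lf; have := Parseval Lf Lf; rewrite -sqr_L2norm// => H.
have -> : \sum_(0 <= j < N) f`_[j] ^+ 2 = \sum_(0 <= j < N) f`_[j] * f`_[j].
  by apply: eq_bigr => j _; rewrite expr2.
rewrite -(cvg_lim _ H)//; apply: nondecreasing_cvgn_le; last by apply/cvg_ex;
  eexists; exact: H.
apply/nondecreasing_seqP => m; rewrite big_nat_recr//= lerDl -expr2.
exact: sqr_ge0.
Qed.

(** With the absolute values inside the sum, the bound survives multiplication by any bounded
    weights. All the exponential and cut-off factors below are handled in this way. *)
Lemma sum_coef_le f g N : L2 L f -> L2 L g ->
  \sum_(0 <= j < N) `|f`_[j] * g`_[j]| <= L2norm L f * L2norm L g.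
Proof.
move=> Lf Lg; have := L2norm_ge0 L f; rewrite le_eqVlt => /predU1P[f0|f0].
  rewrite big1 -?f0 ?mul0r// => j _; have := coef_le j Lf.
  by rewrite -f0 normr_le0 => /eqP ->; rewrite mul0r normr0.
have := L2norm_ge0 L g; rewrite le_eqVlt => /predU1P[g0|g0].
  rewrite big1 -?g0 ?mulr0// => j _; have := coef_le j Lg.
  by rewrite -g0 normr_le0 => /eqP ->; rewrite mulr0 normr0.
set A := L2norm L f in f0 *; set B := L2norm L g in g0 *.
(* Young's inequality x y <= (B/A) x^2 / 2 + (A/B) y^2 / 2; with these weights Bessel bounds each
   half by A B / 2. *)
apply: (@le_trans _ _ (\sum_(0 <= j < N)
    ((B / A) / 2 * f`_[j] ^+ 2 + (A / B) / 2 * g`_[j] ^+ 2))).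
  apply: ler_sum => j _.
  rewrite -subr_ge0 normrM -(real_normK (num_real f`_[j])).
  rewrite -(real_normK (num_real g`_[j])).
  set x := `|f`_[j]|; set y := `|g`_[j]|.
  rewrite (_ : _ - _ = (2 * A * B)^-1 * (B * x - A * y) ^+ 2); last first.
    by field; rewrite !gt_eqF.
  by rewrite mulr_ge0 ?sqr_ge0// invr_ge0 !mulr_ge0// ltW.
rewrite big_split/= -!mulr_sumr.
have HA := Bessel N Lf; have HB := Bessel N Lg; rewrite -/A -/B in HA HB.
apply: (@le_trans _ _ (B / A / 2 * A ^+ 2 + A / B / 2 * B ^+ 2)).
  by apply: lerD; apply: ler_wpM2l => //; rewrite !divr_ge0// ltW.
by rewrite le_eqVlt; apply/orP; left; apply/eqP; field; rewrite !gt_eqF.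
Qed.

Lemma weighted_sum_le w f g M N : 0 <= M -> (forall j, `|w j| <= M) ->
  L2 L f -> L2 L g ->
  `|\sum_(0 <= j < N) w j * (f`_[j] * g`_[j])| <= M * (L2norm L f * L2norm L g).
Proof.
move=> M0 wM Lf Lg; apply: (le_trans (ler_norm_sum _ _ _)).
apply: (@le_trans _ _ (\sum_(0 <= j < N) M * `|f`_[j] * g`_[j]|)).
  by apply: ler_sum => j _; rewrite normrM ler_wpM2r.
by rewrite -mulr_sumr ler_wpM2l// sum_coef_le.
Qed.

Lemma weighted_sum_cvg w f g M : 0 <= M -> (forall j, `|w j| <= M) ->
  L2 L f -> L2 L g ->
  cvgn (fun N => \sum_(0 <= j < N) w j * (f`_[j] * g`_[j])).
Proof.
move=> M0 wM Lf Lg; apply: (@normed_cvg _ _ (fun j => w j * (f`_[j] * g`_[j]))).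
rewrite (_ : [normed series _]%classic = fun N =>
  \sum_(0 <= j < N) `|w j * (f`_[j] * g`_[j])|)//.
apply: nondecreasing_is_cvgn.
  by apply/nondecreasing_seqP => m; rewrite big_nat_recr//= lerDl.
exists (M * (L2norm L f * L2norm L g)) => _ [N _ <-].
apply: (@le_trans _ _ (\sum_(0 <= j < N) M * `|f`_[j] * g`_[j]|)).
  by apply: ler_sum => j _; rewrite normrM ler_wpM2r.
by rewrite -mulr_sumr ler_wpM2l// sum_coef_le.
Qed.

End spectral.

(** * The operator A and its boundary terms *)

Section operator.
Context (R : realType) (L : R) (c : R -> R).
Context (L_gt0 : 0 < L) (c_Linfty : Linfty L c).
Local Notation mu := (@lebesgue_measure R).
Implicit Types (f g h : R -> R) (k M x : R) (w : nat -> R).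

(* The derivative of f through which wderiv2 L f is taken. *)
Definition wderiv1 f : R -> R :=
  xget (fun=> 0)
    [set g | is_weak_derivative L f g /\ is_weak_derivative L g (wderiv2 L f)].

Lemma wderiv1P f : H2 L f -> is_weak_derivative L f (wderiv1 f) /\
  is_weak_derivative L (wderiv1 f) (wderiv2 L f).
Proof.
move=> [g fg [h gh]]; rewrite /wderiv1.
have [g' fg' gh'] : exists2 g, is_weak_derivative L f g & is_weak_derivative L g
  (wderiv2 L f).
  by apply: (@xgetPex _ (fun=> 0) [set h | exists2 g, is_weak_derivative L f g &
    is_weak_derivative L g h]); exists h, g.
apply: (@xgetPex _ (fun=> 0) [set g | is_weak_derivative L f g /\
  is_weak_derivative L g (wderiv2 L f)]).
by exists g'.
Qed.

Lemma H2_L2 f : H2 L f -> L2 L f.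
Proof. by move=> /wderiv1P[fg _]; exact: weak_derivative_L2 fg. Qed.

Lemma L2_mul_c f : {within `[0, L], continuous f} -> L2 L (fun x => c x * f x).
Proof.
move=> cf; apply: (L2_eq (f := fun x => f x * c x)); last first.
  exact/L2_mul_continuous/Linfty_L2.
by move=> x _; rewrite mulrC.
Qed.

Lemma H2_continuous f : H2 L f -> {within `[0, L], continuous f}.
Proof. by move=> /wderiv1P[fg _]; exact: weak_derivative_continuous fg. Qed.

Lemma L2_wderiv2 f : H2 L f -> L2 L (wderiv2 L f).
Proof. by move=> /wderiv1P[_ []]. Qed.

Lemma opA_L2 f : H2 L f -> L2 L (opA L c f).
Proof. by move=> H; apply: L2D (L2_wderiv2 H) (L2_mul_c (H2_continuous H)). Qed.

Lemma dx0_H2 f : H2 L f -> dx0 f = wderiv1 f 0.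
Proof.
move=> /wderiv1P[fg gh]; apply: dx0_weak_derivative fg _ => //.
exact: weak_derivative_continuous gh.
Qed.

Lemma opA_Green f f1 f2 g : H2 L f -> is_weak_derivative L g f1 ->
  is_weak_derivative L f1 f2 ->
  inner L (opA L c f) g - inner L f (fun x => f2 x + c x * g x) =
  (wderiv1 f L * g L - f L * f1 L) - (wderiv1 f 0 * g 0 - f 0 * f1 0).
Proof.
move=> Hf gf1 f12; have [ff1 ff2] := wderiv1P Hf.
rewrite -(Green L_gt0 ff1 ff2 gf1 f12).
have [Lf2 _] := f12.
have Cg := weak_derivative_continuous L_gt0 gf1.
rewrite /opA innerDl//.
- rewrite innerDr//; last 2 first.
  + exact: L2_mul_c.
  + exact: H2_L2.
  rewrite [X in _ + X - _](_ : _ = inner L f (fun x => c x * g x)); first by ring.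
  by apply: eq_Rintegral => x _; ring.
- exact: L2_wderiv2.
- exact/L2_mul_c/H2_continuous.
- exact: L2_continuous_fun.
Qed.

Lemma opA_symmetric f g : H2 L f -> H2 L g ->
  inner L (opA L c f) g - inner L f (opA L c g) =
  (wderiv1 f L * g L - f L * wderiv1 g L) - (wderiv1 f 0 * g 0 - f 0 * wderiv1 g 0).
Proof. by move=> Hf /wderiv1P[]; exact: opA_Green. Qed.

Lemma weak_derivative_affine (p q : R) :
  is_weak_derivative L (fun x => p + q * x) (fun=> q).
Proof.
have := weak_derivativeD (weak_derivative_cst L p) (weak_derivativeZ q
  (weak_derivative_id L)).
by rewrite (_ : (fun x => 0 + q * 1) = (fun=> q))//; apply/funext => x; ring.
Qed.

(* Equal to 1 at 0 and to 0 at L, so that pairing with it in Green's formula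
   leaves only the boundary term f'(0). *)
Definition hat x : R := 1 - x / L.

Lemma hat_weak_derivative : is_weak_derivative L hat (fun=> - L^-1).
Proof.
have := weak_derivative_affine 1 (- L^-1).
by rewrite (_ : (fun x => _) = hat)//; apply/funext => x; rewrite /hat; ring.
Qed.

Lemma hat_L2 : L2 L hat.
Proof. exact: (weak_derivative_L2 L_gt0 hat_weak_derivative). Qed.

Lemma chat_L2 : L2 L (fun x => c x * hat x).
Proof. exact/L2_mul_c/(weak_derivative_continuous L_gt0 hat_weak_derivative). Qed.

Lemma opA_hat f : H2 L f ->
  inner L (opA L c f) hat = inner L f (fun x => c x * hat x)
    + f L / L - wderiv1 f 0 - f 0 / L.
Proof.
move=> Hf; have := opA_Green Hf hat_weak_derivative (weak_derivative_cst L _).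
have -> : (fun x => 0 + c x * hat x) = (fun x => c x * hat x).
  by apply/funext => x; rewrite add0r.
rewrite {3 4}/hat mul0r subr0 divff ?gt_eqF// subrr mulr0 mulr1.
by lra.
Qed.

Lemma ramp_weak_derivative : is_weak_derivative L (fun x => x / L) (fun=> L^-1).
Proof.
have := weak_derivative_affine 0 (L^-1).
by rewrite (_ : (fun x => _) = (fun x => x / L))//; apply/funext => x; ring.
Qed.

Lemma ramp_L2 : L2 L (fun x => x / L).
Proof. exact: (weak_derivative_L2 L_gt0 ramp_weak_derivative). Qed.

Lemma aramp_L2 : L2 L (fun x => x / L * c x).
Proof.
apply: (@L2_eq _ _ (fun x => c x * (x / L))); first by move=> x _; rewrite mulrC.
exact/L2_mul_c/(weak_derivative_continuous L_gt0 ramp_weak_derivative).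
Qed.

Lemma opA_ramp f : H2 L f ->
  inner L (opA L c f) (fun x => x / L) = inner L f (fun x => x / L * c x)
    + wderiv1 f L - f L / L + f 0 / L.
Proof.
move=> Hf; have := opA_Green Hf ramp_weak_derivative (weak_derivative_cst L _).
have -> : (fun x => 0 + c x * (x / L)) = (fun x => x / L * c x).
  by apply/funext => x; rewrite add0r mulrC.
rewrite mul0r divff ?gt_eqF// mulr1 mulr0.
by lra.
Qed.
End operator.

(** * Coefficients of A f and the tail series of boundary derivatives *)

Section tails.
Context (R : realType) (L : R) (c : R -> R) (e : nat -> R -> R).
Context (lambda : nat -> R) (n : nat).
Context (L_gt0 : 0 < L) (c_Linfty : Linfty L c).
Context (spec : spectral_data L c e lambda).
Context (lambda_lt0 : forall j, (n <= j)%N -> lambda j <= lambda n < 0).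
Local Notation mu := (@lebesgue_measure R).
Local Notation hat := (hat L).
Local Notation wderiv1 := (wderiv1 L).
Implicit Types (f g h : R -> R) (k M x : R) (w : nat -> R).
Local Notation "f `_[ j ]" := (inner L f (e j)) (at level 3, format "f `_[ j ]").

Lemma spec_basis : hilbert_basis L e. Proof. by have [] := spec. Qed.
#[local] Hint Resolve spec_basis : core.
Lemma spec_domA j : domA L (e j). Proof. by have [] := spec. Qed.
Lemma spec_H2 j : H2 L (e j). Proof. by have [] := spec_domA j. Qed.
Lemma spec_L2 j : L2 L (e j). Proof. exact/H2_L2/spec_H2. Qed.
#[local] Hint Resolve spec_domA spec_H2 spec_L2 : core.

Lemma inner_opA_basis f j : L2 L f ->
  inner L f (opA L c (e j)) = lambda j * f`_[j].
Proof.
move=> Lf; rewrite -innerZr//.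
have [_ _ /(_ j) H _ _] := spec.
have LA : L2 L (opA L c (e j)) by exact: opA_L2.
have LZ : L2 L (fun x => lambda j * e j x) by exact: L2Z.
(* The eigenvalue equation holds almost everywhere on the open interval, so the endpoints are first
   removed from the integrals. *)
have oo g : L2 L g -> inner L f g = \int[mu]_(x in `]0, L[) (f x * g x).
  move=> Lg; have Ifg := L2_mul_integrable Lf Lg.
  rewrite /inner -Rintegral_itv_bndo_bndc; last first.
    by apply: integrableS Ifg => // x /=; rewrite !in_itv/= => /andP[-> /ltW].
  rewrite -Rintegral_itv_obnd_cbnd//.
  apply: integrableS Ifg => // x /=; rewrite !in_itv/= => /andP[x0 x1].
  by rewrite !ltW.
have mo g : L2 L g -> measurable_fun `]0, L[ (fun x => (f x * g x)%:E).
  move=> Lg; apply/measurable_EFinP/measurable_funM.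
    by apply: measurable_funS (measurable_L2 Lf) => // x /=;
      rewrite !in_itv/= => /andP[/ltW -> /ltW].
  by apply: measurable_funS (measurable_L2 Lg) => // x /=;
    rewrite !in_itv/= => /andP[/ltW -> /ltW].
rewrite !oo// /Rintegral; congr fine; apply: ae_eq_integral => //.
- exact: mo.
- exact: mo.
move: H; apply: filterS; first exact: (ae_filter_ringOfSetsType mu).
by move=> x + /=; rewrite in_itv/= => /[apply] ->.
Qed.

(** Green's formula leaves the boundary term - f(L) e_j'(L). Pairing A e_j with x / L evaluates
    e_j'(L) as - (a_j + lambda_j b_j). The case f(L) <> 0 is that of y(t, .), whose value at L is
    the delayed input. *)
Lemma opA_coef f j : H2 L f -> f 0 = 0 ->
  (opA L c f)`_[j] = lambda j * f`_[j] + f L * (a_coef L c e j + lambda j * b_coef L e j).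
Proof.
move=> Hf f0; have [_ e0 eL] := spec_domA j.
have Lr := ramp_L2 L_gt0; have Lf := H2_L2 L_gt0 Hf.
have := opA_symmetric L_gt0 c_Linfty Hf (spec_H2 j).
rewrite f0 e0 eL inner_opA_basis//.
have := opA_ramp L_gt0 c_Linfty (spec_H2 j); rewrite e0 eL.
rewrite (innerC _ _ (fun x => x / L)) inner_opA_basis//.
rewrite (innerC _ _ (fun x => x / L * c x)) -/(a_coef L c e j).
have -> : b_coef L e j = - inner L (fun x => x / L) (e j).
  rewrite -[RHS]mulN1r -innerZl// /b_coef; apply: eq_inner => // x _.
  by rewrite mulN1r.
rewrite !mul0r => H1 H2'.
rewrite (_ : _ + lambda j * _ = - wderiv1 (e j) L); lra.
Qed.

Lemma domA_coef f j : domA L f -> (opA L c f)`_[j] = lambda j * f`_[j].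
Proof. by move=> [Hf f0 fL]; rewrite opA_coef// fL mul0r addr0. Qed.

Lemma dx0_domA f : domA L f ->
  dx0 f = inner L f (fun x => c x * hat x) - inner L (opA L c f) hat.
Proof.
move=> [Hf f0 fL]; have := opA_hat L_gt0 c_Linfty Hf.
by rewrite f0 fL (dx0_H2 L_gt0 Hf) mul0r => ->; ring.
Qed.

Lemma dx0_basis j : dx0 (e j) = (fun x => c x * hat x)`_[j] - lambda j * hat`_[j].
Proof.
have Lh := hat_L2 L_gt0; rewrite dx0_domA//.
by rewrite (innerC _ (opA _ _ _)) inner_opA_basis// (innerC _ (e j)).
Qed.

(** [wtail] and [wind] extend the weights 1 / lambda_j and 1 by zero below n: the tail sums then
    start at 0 and are covered by [weighted_sum_le]. *)
Definition wtail j : R := if (n <= j)%N then (lambda j)^-1 else 0.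
Definition wind j : R := if (n <= j)%N then 1 else 0.

Lemma wtail_le j : `|wtail j| <= `|lambda n|^-1.
Proof.
rewrite /wtail; case: ifPn => [nj|_]; last by rewrite normr0 invr_ge0.
have /andP[H1 H2] := lambda_lt0 nj.
rewrite normfV lef_pV2 ?posrE ?normr_gt0 ?lt_eqF ?(le_lt_trans H1 H2)//.
by rewrite !ltr0_norm ?(le_lt_trans H1 H2)// lerN2.
Qed.

Lemma wind_le j : `|wind j| <= 1.
Proof. by rewrite /wind; case: ifP; rewrite ?normr1 ?normr0. Qed.

Lemma sum_nat_ind (F : nat -> R) N :
  \sum_(n <= j < N) F j = \sum_(0 <= j < N) (if (n <= j)%N then F j else 0).
Proof.
elim: N => [|N IH]; first by rewrite !big_geq.
rewrite [RHS]big_nat_recr//= -IH; case: leqP => nN; first by rewrite big_nat_recr.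
by rewrite !big_geq ?addr0// ltnW.
Qed.

(* Bounded on L^2 because
   e_j'(0) / lambda_j = <c hat, e_j> / lambda_j - <hat, e_j> by dx0_basis. *)
Definition tailf f : R := tail e lambda n (fun j => f`_[j]).

Lemma tail_sumE f N : \sum_(n <= j < N) dx0 (e j) / lambda j * f`_[j] =
  \sum_(0 <= j < N) wtail j * (f`_[j] * (fun x => c x * hat x)`_[j]) -
  \sum_(0 <= j < N) wind j * (f`_[j] * hat`_[j]).
Proof.
rewrite sum_nat_ind -sumrB; apply: eq_bigr => j _; rewrite /wtail /wind.
case: ifPn => nj; last by ring.
have /andP[H1 H2] := lambda_lt0 nj.
by rewrite dx0_basis; field; rewrite lt_eqF// (le_lt_trans H1).
Qed.

Lemma tailf_cvgn f : L2 L f ->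
  (fun N => \sum_(n <= j < N) dx0 (e j) / lambda j * f`_[j]) @ \oo --> tailf f.
Proof.
move=> Lf; rewrite /tailf /tail.
rewrite (_ : (fun N => _) = (fun N =>
  \sum_(0 <= j < N) wtail j * (f`_[j] * (fun x => c x * hat x)`_[j]) -
  \sum_(0 <= j < N) wind j * (f`_[j] * hat`_[j]))); last first.
  by apply/funext => N; exact: tail_sumE.
apply: is_cvgB.
- apply: (weighted_sum_cvg spec_basis _ wtail_le) => //; exact: chat_L2.
- apply: (weighted_sum_cvg spec_basis _ wind_le) => //; exact: hat_L2.
Qed.

Lemma tailfD f g : L2 L f -> L2 L g -> tailf (fun x => f x + g x) = tailf f + tailf g.
Proof.
move=> Lf Lg; apply/cvg_lim => //.
rewrite (_ : (fun N => _) = (fun N => \sum_(n <= j < N) dx0 (e j) / lambda j * f`_[j]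
  + \sum_(n <= j < N) dx0 (e j) / lambda j * g`_[j])).
  by apply: cvgD; exact: tailf_cvgn.
apply/funext => N; rewrite -big_split; apply: eq_bigr => j _.
by rewrite innerDl//=; ring.
Qed.

Lemma tailfZ k f : L2 L f -> tailf (fun x => k * f x) = k * tailf f.
Proof.
move=> Lf; apply/cvg_lim => //.
rewrite (_ : (fun N => _) = (fun N => k * \sum_(n <= j < N) dx0 (e j) / lambda j *
  f`_[j])).
  by apply: cvgM; [exact: cvg_cst | exact: tailf_cvgn].
apply/funext => N; rewrite mulr_sumr; apply: eq_bigr => j _.
by rewrite innerZl//=; ring.
Qed.

Lemma eq_tailf f g : {in `[0, L], f =1 g} -> tailf f = tailf g.
Proof.
move=> fg; rewrite /tailf; congr tail; apply/funext => j; exact: eq_inner.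
Qed.

Lemma tailfB f g : L2 L f -> L2 L g -> tailf (fun x => f x - g x) = tailf f - tailf g.
Proof.
move=> Lf Lg; rewrite -[in RHS]mulN1r -tailfZ// -tailfD//; last exact: L2Z.
by apply: eq_tailf => x _; rewrite mulN1r.
Qed.

Definition tailf_bound : R :=
  `|lambda n|^-1 * L2norm L (fun x => c x * hat x) + L2norm L hat.

Lemma tailf_bound_ge0 : 0 <= tailf_bound.
Proof. by rewrite addr_ge0 ?mulr_ge0 ?L2norm_ge0 ?invr_ge0. Qed.

Lemma tailf_le f : L2 L f -> `|tailf f| <= tailf_bound * L2norm L f.
Proof.
have Lh := hat_L2 L_gt0; have Lc := chat_L2 L_gt0 c_Linfty.
move=> Lf; have := cvg_norm (tailf_cvgn Lf) => H.
apply: (cvgr_to_le (H _)); apply: nearW => N; rewrite tail_sumE.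
apply: (le_trans (ler_normB _ _)); rewrite mulrDl; apply: lerD.
  rewrite -mulrA [X in _ <= _ * X]mulrC.
  apply: (weighted_sum_le spec_basis _ _ wtail_le) => //; exact: chat_L2.
rewrite -[X in _ <= X]mul1r [X in _ <= _ * X]mulrC.
apply: (weighted_sum_le spec_basis _ _ wind_le) => //; exact: hat_L2.
Qed.

(** Parseval in both terms of [dx0_domA] gives f'(0) as the sum of all e_j'(0) f_j, and for j >= n
    one has f_j = <A f, e_j> / lambda_j. The infinite part of the flux thus becomes one bounded
    functional of A f. *)
Lemma dx0_tail f : domA L f ->
  dx0 f = \sum_(0 <= j < n) dx0 (e j) * f`_[j] + tailf (opA L c f).
Proof.
move=> Df; have [Hf _ _] := Df.
have H : (fun N => \sum_(0 <= j < N) dx0 (e j) * f`_[j]) @ \oo --> dx0 f.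
  rewrite dx0_domA// (_ : (fun N => _) = (fun N =>
    \sum_(0 <= j < N) f`_[j] * (fun x => c x * hat x)`_[j] -
    \sum_(0 <= j < N) (opA L c f)`_[j] * hat`_[j])).
    apply: cvgB; apply: Parseval => //.
    - exact: H2_L2.
    - exact: chat_L2.
    - exact: opA_L2.
    - exact: hat_L2.
  apply/funext => N; rewrite -sumrB; apply: eq_bigr => j _.
  by rewrite dx0_basis domA_coef//; ring.
have H' : (fun N => \sum_(0 <= j < n) dx0 (e j) * f`_[j] +
    \sum_(n <= j < N) dx0 (e j) / lambda j * (opA L c f)`_[j]) @ \oo -->
    \sum_(0 <= j < n) dx0 (e j) * f`_[j] + tailf (opA L c f).
  by apply: cvgD; [exact: cvg_cst | apply: tailf_cvgn; exact: opA_L2].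
apply: (cvg_unique _ H); first exact: Rhausdorff.
apply: cvg_trans H'; apply: near_eq_cvg; near=> N.
have nN : (n <= N)%N by near: N; exact: nbhs_infty_ge.
rewrite (@big_cat_nat _ _ _ n 0%N N)//=. congr (_ + _).
apply: eq_big_nat => j /andP[nj _].
have /andP[H1 H2] := lambda_lt0 nj.
by rewrite domA_coef//; field; rewrite lt_eqF// (le_lt_trans H1).
Unshelve. all: by end_near. Qed.
End tails.

(** * Derivatives in one real variable and the matrix exponential *)

Section pointwise_derivatives.
Context (R : realType).
Implicit Types (f g : R -> R) (x l k : R).

Lemma rderiv_eq f g x l l' : f =1 g -> l = l' -> is_derive x 1 f l ->
  is_derive x 1 g l'.
Proof. by move=> /funext -> ->. Qed.

Lemma rderivD f g x l k : is_derive x 1 f l -> is_derive x 1 g k ->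
  is_derive x 1 (fun y => f y + g y) (l + k).
Proof. by move=> df dg; exact: is_deriveD. Qed.

Lemma rderivB f g x l k : is_derive x 1 f l -> is_derive x 1 g k ->
  is_derive x 1 (fun y => f y - g y) (l - k).
Proof. by move=> df dg; exact: is_deriveB. Qed.

Lemma rderivN f x l : is_derive x 1 f l -> is_derive x 1 (fun y => - f y) (- l).
Proof. by move=> df; exact: is_deriveN. Qed.

Lemma rderivM f g x l k : is_derive x 1 f l -> is_derive x 1 g k ->
  is_derive x 1 (fun y => f y * g y) (l * g x + f x * k).
Proof.
move=> df dg; apply: rderiv_eq (is_deriveM df dg) => //.
by rewrite /GRing.scale /=; ring.
Qed.

Lemma rderiv_cst k x : is_derive x 1 (fun=> k : R) 0.
Proof. exact: is_derive_cst. Qed.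

Lemma rderivZ k f x l : is_derive x 1 f l -> is_derive x 1 (fun y => k * f y) (k * l).
Proof. by move=> /(rderivM (rderiv_cst k x)); rewrite mul0r add0r. Qed.

Lemma rderiv_id x : is_derive x (1 : R) (fun y => y) 1.
Proof. exact: is_derive_id. Qed.

Lemma rderiv_comp f g x l k : is_derive (g x) 1 f l -> is_derive x 1 g k ->
  is_derive x 1 (fun y => f (g y)) (l * k).
Proof. by move=> df dg; exact: (is_derive1_comp df dg). Qed.

Lemma rderiv_sum (I : Type) (r : seq I) (F : I -> R -> R) (dF : I -> R) x :
  (forall i, is_derive x 1 (F i) (dF i)) ->
  is_derive x 1 (fun y => \sum_(i <- r) F i y) (\sum_(i <- r) dF i).
Proof.
move=> dF'; elim: r => [|i r IH].
  apply: rderiv_eq (rderiv_cst 0 x); last by rewrite big_nil.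
  by move=> y; rewrite big_nil.
apply: rderiv_eq (rderivD (dF' i) IH); last by rewrite big_cons.
by move=> y; rewrite big_cons.
Qed.

Lemma rderiv_expR f x l : is_derive x 1 f l ->
  is_derive x 1 (fun y => expR (f y)) (expR (f x) * l).
Proof. by apply: rderiv_comp. Qed.

Lemma within_continuousD (A : set R) f g : {within A, continuous f} ->
  {within A, continuous g} -> {within A, continuous (fun x => f x + g x)}.
Proof. by move=> cf cg x; apply: cvgD; [exact: cf | exact: cg]. Qed.

Lemma within_continuousB (A : set R) f g : {within A, continuous f} ->
  {within A, continuous g} -> {within A, continuous (fun x => f x - g x)}.
Proof. by move=> cf cg x; apply: cvgB; [exact: cf | exact: cg]. Qed.

Lemma within_continuousM (A : set R) f g : {within A, continuous f} ->
  {within A, continuous g} -> {within A, continuous (fun x => f x * g x)}.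
Proof. by move=> cf cg x; apply: cvgM; [exact: cf | exact: cg]. Qed.

Lemma within_continuous_cst (A : set R) k : {within A, continuous (fun=> k)}.
Proof. by apply: continuous_subspaceT => ?; exact: cst_continuous. Qed.

Lemma within_continuous_sum (A : set R) (I : Type) (s : seq I) (F : I -> R -> R) :
  (forall i, {within A, continuous (F i)}) ->
  {within A, continuous (fun x => \sum_(i <- s) F i x)}.
Proof.
move=> cF; elim: s => [|i s IH].
  rewrite (_ : (fun x => _) = (fun=> 0)); first exact: within_continuous_cst.
  by apply/funext => x; rewrite big_nil.
rewrite (_ : (fun x => _) = (fun x => F i x + \sum_(i <- s) F i x)).
  exact: within_continuousD.
by apply/funext => x; rewrite big_cons.
Qed.

Lemma nonincreasing_MVT f (df : R -> R) a b : a <= b ->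
  (forall x, a < x < b -> is_derive x 1 f (df x)) ->
  (forall x, a < x < b -> df x <= 0) ->
  {within `[a, b], continuous f} -> f b <= f a.
Proof.
move=> ab fd df0 cf; move: ab; rewrite le_eqVlt => /predU1P[->//|ab].
have fd' x : x \in `]a, b[ -> is_derive x 1 f (df x) by rewrite in_itv/=; exact: fd.
have [y + E'] := MVT ab fd' cf; rewrite in_itv/= => yab.
by rewrite -subr_le0 E' mulr_le0_ge0 ?subr_ge0 ?(ltW ab)// df0.
Qed.

(** The exceptional point is meant for the time D, where v_D may jump. If it lies inside the
    interval, monotonicity is used on either side of it and continuity joins the two halves. *)
Lemma nonincreasing_except f (df : R -> R) a b d : a <= b ->
  (forall x, a < x < b -> x != d -> is_derive x 1 f (df x)) ->
  (forall x, a < x < b -> x != d -> df x <= 0) ->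
  {within `[a, b], continuous f} -> f b <= f a.
Proof.
move=> ab fd df0 cf.
have sub x y : a <= x -> y <= b -> {within `[x, y], continuous f}.
  move=> ax yb; apply: continuous_subspaceW cf => z /=.
  by rewrite !in_itv/= => /andP[/(le_trans ax) -> /le_trans ->].
have P x y : a <= x -> x <= y -> y <= b -> d \notin `]x, y[ -> f y <= f x.
  move=> ax xy yb nd; apply: (nonincreasing_MVT xy (df := df)); last exact: sub.
  - move=> z /andP[xz zy]; apply: fd; first by rewrite (le_lt_trans ax)//
    (lt_le_trans zy).
    by apply: contraNneq nd => <-; rewrite in_itv/= xz zy.
  - move=> z /andP[xz zy]; apply: df0; first by rewrite (le_lt_trans ax)//
    (lt_le_trans zy).
    by apply: contraNneq nd => <-; rewrite in_itv/= xz zy.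
have [|nd] := boolP (d \in `]a, b[); last exact: P.
rewrite in_itv/= => /andP[ad db].
apply: (@le_trans _ _ (f d)); apply: P => //; try exact: ltW.
  by rewrite in_itv/= ltxx.
by rewrite in_itv/= ltxx andbF.
Qed.

Lemma dominated_except f g (df dg : R -> R) a b d : a <= b ->
  (forall x, a < x < b -> x != d -> is_derive x 1 f (df x)) ->
  (forall x, a < x < b -> x != d -> is_derive x 1 g (dg x)) ->
  (forall x, a < x < b -> x != d -> `|df x| <= dg x) ->
  {within `[a, b], continuous f} -> {within `[a, b], continuous g} ->
  `|f b - f a| <= g b - g a.
Proof.
move=> ab fd gd df0 cf cg.
have H1 : f b - g b <= f a - g a.
  apply: (@nonincreasing_except (fun x => f x - g x) (fun x => df x - dg x) _ _ d ab).
  - by move=> x xab xd; apply: rderivB; [exact: fd | exact: gd].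
  - by move=> x xab xd; rewrite subr_le0 (le_trans (ler_norm _))// df0.
  - by move=> x; apply: cvgB; [exact: cf | exact: cg].
have H2 : - f b - g b <= - f a - g a.
  apply: (@nonincreasing_except (fun x => - f x - g x) (fun x => - df x - dg x) _ _ d ab).
  - by move=> x xab xd; apply: rderivB; [apply: rderivN; exact: fd | exact: gd].
  - move=> x xab xd; rewrite subr_le0 (le_trans (ler_norm _))// normrN; exact: df0.
  - by move=> x; apply: cvgB; [apply: cvgN; exact: cf | exact: cg].
by rewrite ler_norml; apply/andP; split; lra.
Qed.

Lemma lipschitz_except f (df : R -> R) a b d M : a <= b ->
  (forall x, a < x < b -> x != d -> is_derive x 1 f (df x)) ->
  (forall x, a < x < b -> x != d -> `|df x| <= M) ->
  {within `[a, b], continuous f} -> `|f b - f a| <= M * (b - a).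
Proof.
move=> ab fd df0 cf; rewrite mulrBr.
apply: (@dominated_except _ (fun x => M * x) df (fun=> M) _ _ d) => //.
- by move=> x _ _; apply: rderiv_eq (rderivZ M (rderiv_id x)) => //; rewrite mulr1.
- by apply: continuous_subspaceT => x; apply: cvgM; [exact: cvg_cst | exact: cvg_id].
Qed.

End pointwise_derivatives.

Lemma cvg_bigsum (R : realType) (T : Type) (F : set_system T) (FF : Filter F)
    (I : Type) (r : seq I) (f : I -> T -> R) (l : I -> R) :
  (forall i, f i @ F --> l i) ->
  (fun x => \sum_(i <- r) f i x) @ F --> \sum_(i <- r) l i.
Proof.
move=> H; elim: r => [|i r IH].
  rewrite big_nil (_ : (fun x => _) = (fun=> 0)); first exact: cvg_cst.
  by apply/funext => x; rewrite big_nil.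
rewrite big_cons (_ : (fun x => _) = (fun x => f i x + \sum_(i <- r) f i x)).
  by apply: cvgD.
by apply/funext => x; rewrite big_cons.
Qed.

Section matrix_exponential.
Context (R : realType).

Lemma cvg_mx (m n : nat) (u : nat -> 'M[R]_(m, n)) (A : 'M[R]_(m, n)) :
  (forall i j, (fun N => u N i j) @ \oo --> A i j) -> u @ \oo --> A.
Proof.
move=> H B [P HP sB]; apply: (@filterS _ _ _ [set N | forall i j, P i j (u N i j)]).
  by move=> N HN; apply: sB.
have HF i j : \oo [set N | P i j (u N i j)] by exact: (H i j) (HP i j).
apply: (@filter_forall _ _ (fun i => [set N | forall j, P i j (u N i j)]) \oo _) => i.
apply: (@filter_forall _ _ (fun j => [set N | P i j (u N i j)]) \oo _) => j; exact: HF.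
Qed.

Context (m : nat).
Implicit Types (M : 'M[R]_m) (x : R).

(** A crude bound compatible with powers: the factor m pays for the sum in a matrix product. *)
Definition mxbound M : R := m%:R * (\sum_i \sum_j `|M i j|) + 1.

Lemma mxbound_ge1 M : 1 <= mxbound M.
Proof.
rewrite lerDr mulr_ge0//; apply: sumr_ge0 => i _; exact: sumr_ge0.
Qed.

Lemma expmx_entry_le M k i j : `|(M ^+ k) i j| <= mxbound M ^+ k.
Proof.
have C1 := mxbound_ge1 M.
elim: k i j => [|k IH] i j.
  by rewrite !expr0 mxE; case: (_ == _); rewrite ?normr1 ?normr0.
rewrite exprSr mxE; apply: (le_trans (ler_norm_sum _ _ _)).
apply: (@le_trans _ _ (\sum_(l < m) mxbound M ^+ k * (\sum_i \sum_j `|M i j|))).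
  apply: ler_sum => l _; rewrite normrM; apply: ler_pM => //.
  rewrite (bigD1 l)//= (bigD1 j)//= -addrA lerDl.
  by rewrite addr_ge0//; apply: sumr_ge0 => ? _ //; exact: sumr_ge0.
rewrite sumr_const card_ord -mulr_natl mulrCA exprSr ler_wpM2l//.
  by rewrite exprn_ge0// (le_trans ler01).
by rewrite lerDl.
Qed.

(* The Taylor coefficients of the p-th derivative of x |-> (e^(x M))_(i,j). *)
Definition expc M (i j : 'I_m) p k : R := (k`!%:R)^-1 * (M ^+ (k + p)) i j.

Lemma expc_cvg M i j p x : cvgn (pseries (expc M i j p) x).
Proof.
apply: normed_cvg.
apply: (@series_le_cvg _ _ (fun k => mxbound M ^+ p * exp_coeff (mxbound M * `|x|)
  k)) => //.
- by move=> k /=; exact: normr_ge0.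
- move=> k; have C0 := le_trans ler01 (mxbound_ge1 M).
  apply: mulr_ge0; first exact: exprn_ge0.
  by apply: exp_coeff_ge0; exact: mulr_ge0.
- move=> k /=; rewrite /expc /exp_coeff !normrM normfV normrX.
  rewrite [`|k`!%:R|]ger0_norm//.
  apply: (@le_trans _ _ (k`!%:R^-1 * mxbound M ^+ (k + p) * `|x| ^+ k)).
    rewrite ler_wpM2r ?exprn_ge0// ler_wpM2l ?invr_ge0//; exact: expmx_entry_le.
  by rewrite exprD /exp_coeff/= exprMn le_eqVlt; apply/orP; left; apply/eqP; ring.
- rewrite (_ : series _ = (fun N => mxbound M ^+ p * series (exp_coeff (mxbound M *
  `|x|)) N)).
    apply: is_cvgM; [exact: is_cvg_cst | exact: is_cvg_series_exp_coeff].
  by apply/funext => N; rewrite /series/= mulr_sumr.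
Qed.

Lemma expc_diffs M i j p : pseries_diffs (expc M i j p) = expc M i j p.+1.
Proof.
apply/funext => k; rewrite /pseries_diffs /expc factS natrM addnS addSn.
by rewrite mulrA invfM mulrA divff ?mul1r// pnatr_eq0.
Qed.

Lemma expmxE M x i j : expmx (x *: M) i j = limn (pseries (expc M i j 0) x).
Proof.
have H : series (fun k => (k`!%:R)^-1 *: (x *: M) ^+ k) @ \oo -->
    \matrix_(i, j) limn (pseries (expc M i j 0) x).
  apply: cvg_mx => a b; rewrite mxE.
  rewrite (_ : (fun N => _) = pseries (expc M a b 0) x); first exact: expc_cvg.
  apply/funext => N; rewrite /pseries /series /= summxE; apply: eq_bigr => k _.
  rewrite /expc addn0 mxE -mulrA; congr (_ * _); rewrite mulrC.
  elim: k a b => [|k IH] a b; first by rewrite !expr0 mul1r.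
  rewrite !exprSr !mxE mulr_sumr; apply: eq_bigr => l _.
  by rewrite IH !mxE; ring.
by rewrite /expmx (cvg_lim _ H)// mxE.
Qed.

Lemma expmx_mulE M x i j : (expmx (x *: M) *m M) i j = limn (pseries (expc M i j 1) x).
Proof.
symmetry; apply/cvg_lim => //; rewrite mxE.
rewrite (_ : pseries _ _ = fun N => \sum_l pseries (expc M i l 0) x N * M l j).
  apply: cvg_bigsum => l; apply: cvgM; last exact: cvg_cst.
  rewrite expmxE; exact: expc_cvg.
apply/funext => N; rewrite /pseries /series /=.
under [RHS]eq_bigr do rewrite mulr_suml.
rewrite exchange_big/=; apply: eq_bigr => k _.
rewrite /expc addn1 exprSr mxE mulr_sumr mulr_suml; apply: eq_bigr => l _.
by rewrite addn0; ring.
Qed.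

(** Termwise differentiation of the power series of an entry turns [expc M i j 0] into
    [expc M i j 1], whose sum is identified by [expmx_mulE]. The radius |x| + 1 provides convergence
    beyond |x|. *)
Lemma is_derive_expmx M x i j :
  is_derive x 1 (fun y => expmx (y *: M) i j) ((expmx (x *: M) *m M) i j).
Proof.
rewrite expmx_mulE -expc_diffs.
apply: (@rderiv_eq _ (fun y => limn (pseries (expc M i j 0) y)) _ _ _ _ _ erefl).
  by move=> y; rewrite expmxE.
apply: (@pseries_snd_diffs _ _ (`|x| + 1)); rewrite ?expc_diffs; try exact: expc_cvg.
by rewrite [ltRHS]ger0_norm ?addr_ge0// ltrDl.
Qed.

Lemma expmx0 : expmx (0 : 'M[R]_m) = 1.
Proof.
apply/matrixP => i j; rewrite -(scale0r (0 : 'M[R]_m)) expmxE.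
apply/cvg_lim => //; rewrite -cvg_shiftS /=.
rewrite (_ : (fun n => _) = (fun=> (1 : 'M[R]_m) i j)); first exact: cvg_cst.
apply/funext => N; rewrite /pseries /series /= big_nat_recl//= big1 ?addr0.
  by rewrite /expc fact0 expr0 invr1 !mul1r mulr1.
by move=> k _; rewrite exprS mul0r mulr0.
Qed.

Lemma expmx_row M i : (forall j, M i j = 0) ->
  forall x j, expmx (x *: M) i j = (i == j)%:R.
Proof.
move=> M0 x j; rewrite expmxE; apply/cvg_lim => //; rewrite -cvg_shiftS /=.
rewrite (_ : (fun n => _) = (fun=> (1 : 'M[R]_m) i j)); first by rewrite mxE;
  exact: cvg_cst.
apply/funext => N; rewrite /pseries /series /= big_nat_recl//= big1 ?addr0.
  by rewrite /expc fact0 !expr0 invr1 mul1r mulr1.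
move=> k _; rewrite /expc addn0 exprS mxE big1 ?mulr0 ?mul0r// => l _.
by rewrite M0 mul0r.
Qed.

End matrix_exponential.

(** * Functions of time *)

Section half_line.
Context (R : realType).
Local Notation mu := (@lebesgue_measure R).
Local Notation Rp := [set t : R | 0 <= t].
Implicit Types (f g q : R -> R) (a b t x l : R).

Lemma continuous_RpP f : {within Rp, continuous f} <->
  (forall t, 0 <= t -> f s @[s --> within Rp (nbhs t)] --> f t).
Proof. exact: subspace_continuousP. Qed.

Lemma within_RpP f t l : f s @[s --> within Rp (nbhs t)] --> l <->
  (forall eps, 0 < eps -> exists2 d, 0 < d &
     forall s, 0 <= s -> `|s - t| < d -> `|f s - l| <= eps).
Proof.
split=> [H eps eps0|H].
  have /cvgrPdist_le/(_ _ eps0) [d /= d0 Hd] := H.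
  exists d => // s s0 sd; rewrite distrC; apply: Hd => //=.
  by rewrite distrC.
apply/cvgrPdist_le => eps eps0; have [d d0 Hd] := H eps eps0.
exists d => //= s /= sd s0; rewrite distrC; apply: Hd => //.
by rewrite distrC.
Qed.

Lemma is_derive_RplusP f t l : is_derive_Rplus f t l <->
  (forall eps, 0 < eps -> exists2 d, 0 < d &
     forall s, 0 <= s -> s != t -> `|s - t| < d ->
       `|(f s - f t) / (s - t) - l| <= eps).
Proof.
split=> [H eps eps0|H].
  have /cvgrPdist_le/(_ _ eps0) [d /= d0 Hd] := H.
  exists d => // s s0 sd st; rewrite distrC; apply: Hd => //=.
  by rewrite distrC.
apply/cvgrPdist_le => eps eps0; have [d d0 Hd] := H eps eps0.
exists d => //= s /= sd s0 st; rewrite distrC; apply: Hd => //.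
by rewrite distrC.
Qed.

Lemma is_derive_Rplus_gt0 f t l : 0 < t -> is_derive_Rplus f t l ->
  is_derive t 1 f l.
Proof.
move=> t0 /is_derive_RplusP H.
have C : h^-1 *: (f (h *: 1 + t) - f t) @[h --> 0^'] --> l.
  apply/cvgrPdist_le => eps eps0; have [d d0 Hd] := H _ eps0.
  exists (Num.min d t); first by rewrite /= lt_min d0.
  move=> h /=; rewrite sub0r normrN lt_min => /andP[hd ht] h0.
  have := Hd (h + t); rewrite addrK distrC [h *: 1]mulr1 [_ *: _]mulrC; apply => //.
  - have := ler_norm (- h); rewrite normrN => hh; lra.
  - by rewrite -subr_eq0 addrK.
by split; [apply: cvgP C | apply: cvg_lim C].
Qed.

Lemma is_derive_Rplus_continuous f : (forall t, 0 <= t -> exists l, is_derive_Rplus f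
  t l) ->
  {within Rp, continuous f}.
Proof.
move=> H; apply/continuous_RpP => t t0; apply/within_RpP => eps eps0.
have [l /is_derive_RplusP/(_ 1 ltr01)[d d0 Hd]] := H t t0.
have l0 : 0 < `|l| + 1 by rewrite ltr_wpDl.
exists (Num.min d (eps / (`|l| + 1))); first by rewrite lt_min d0 divr_gt0.
move=> s s0; rewrite lt_min => /andP[sd se].
have [->|st] := eqVneq s t; first by rewrite subrr normr0 ltW.
have st0 : s - t != 0 by rewrite subr_eq0.
have {}Hd := Hd s s0 st sd.
have E : `|(f s - f t) / (s - t)| <= `|l| + 1.
  by rewrite -lerBlDl (le_trans _ Hd)// lerB_dist.
rewrite -(divfK st0 (f s - f t)) normrM.
apply: (le_trans (ler_wpM2r _ E)) => //.
by rewrite mulrC -ler_pdivlMr// ltW.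
Qed.

Lemma continuous_sub_itv f a b : 0 <= a -> {within Rp, continuous f} ->
  {within `[a, b], continuous f}.
Proof.
move=> a0; apply: continuous_subspaceW => x /=; rewrite in_itv/= => /andP[ax _].
exact: le_trans ax.
Qed.

Lemma continuous_at_gt0 f t : 0 < t -> {within Rp, continuous f} ->
  {for t, continuous f}.
Proof.
move=> t0 /continuous_RpP/(_ t (ltW t0))/within_RpP H.
apply/cvgrPdist_le => eps eps0; have [d d0 Hd] := H _ eps0.
exists (Num.min d t); first by rewrite /= lt_min d0.
move=> s /=; rewrite lt_min => /andP[sd st]; rewrite distrC; apply: Hd.
  by have := ler_norm (t - s); lra.
by rewrite distrC.
Qed.

(** * Primitives of signals that vanish before time 0 and may jump there *)

Section causal.
Context (q : R -> R) (cq : {within Rp, continuous q}).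
Context (q_neg : forall t, t < 0 -> q t = 0).

Lemma causal_integrable a b : mu.-integrable `[a, b] (EFin \o q).
Proof.
have I0 : mu.-integrable `[0, b] (EFin \o q).
  by apply: integrable_continuous_itv; exact: continuous_sub_itv.
rewrite (_ : EFin \o q = (EFin \o q) \_ (`[0, +oo[)); last first.
  apply/funext => x; rewrite patchE; case: ifPn => //.
  by rewrite notin_setE/= in_itv/= andbT => /negP; rewrite -ltNge => /q_neg /= ->.
apply/integrable_restrict => //.
apply: integrableS I0 => //; first exact: measurableI.
by move=> x /=; rewrite !in_itv/= andbT => -[/andP[_ ->] ->].
Qed.

Lemma causal_primitive_continuous a b :
  {within `[a, b], continuous (fun x => \int[mu]_(t in `[a, x]) q t)}.
Proof.
have [ab|ba] := leP a b.
  exact/parameterized_integral_continuous/causal_integrable.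
rewrite set_itv_ge ?bnd_simp -?ltNge//; exact: continuous_subspace0.
Qed.

Lemma causal_continuous_at x : x != 0 -> {for x, continuous q}.
Proof.
rewrite neq_lt => /orP[x0|x0]; last exact: continuous_at_gt0.
have E : \near x, cst 0 x = q x.
  near=> y; rewrite q_neg//; near: y; exact: lt_nbhsl.
rewrite /prop_for /continuous_at q_neg//; apply: cvg_trans (near_eq_cvg E) _.
exact: cvg_cst.
Unshelve. all: by end_near. Qed.

Lemma causal_primitive_derive a x : a < x -> x != 0 ->
  is_derive x 1 (fun x => \int[mu]_(t in `[a, x]) q t) (q x).
Proof.
move=> ax x0; have x1 : x < x + 1 by rewrite ltrDl.
have [D E] := continuous_FTC1_closed x1 (causal_integrable a (x + 1)) ax
  (causal_continuous_at x0).
split => //; by rewrite -derive1E.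
Qed.

(** Since q vanishes before 0, the lower limit can be any a <= 0. A strictly negative a turns 0 into
    an interior point, and one integral then covers both branches of [input]. *)
Lemma input_primitive a x : a <= 0 -> a <= x ->
  input q x = \int[mu]_(t in `[a, x]) q t.
Proof.
move=> a0 ax; rewrite /input; case: ltP => x0.
  rewrite (@eq_Rintegral _ _ _ mu _ (fun=> 0)) ?Rintegral_cst_itv ?mul0r//.
  by move=> t; rewrite inE/= in_itv/= => /andP[_ tx]; rewrite q_neg// (le_lt_trans tx).
rewrite -(Rintegral_itv_sub (causal_integrable a x) a0 x0 (lexx _)).
rewrite [X in _ - X](_ : _ = 0) ?subr0//.
rewrite -(Rintegral_itv_bndo_bndc (r := 0)); last first.
  apply: integrableS (causal_integrable a 0) => // t /=.
  by rewrite !in_itv/= => /andP[-> /ltW].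
rewrite (@eq_Rintegral _ _ _ mu _ (fun=> 0)).
  by rewrite /Rintegral integral0_eq.
by move=> t; rewrite inE/= in_itv/= => /andP[_ /q_neg].
Qed.

Lemma input_derive x : x != 0 -> is_derive x 1 (input q) (q x).
Proof.
move=> x0; pose a := Num.min 0 x - 1.
have a0 : a < 0 by rewrite ltrBlDr add0r gt_min ltr01.
have ax : a < x by rewrite ltrBlDr gt_min ltrDl ltr01 orbT.
apply: near_eq_is_derive (causal_primitive_derive ax x0).
near=> y; rewrite (@input_primitive a) ?ltW//; near: y; exact: lt_nbhsr.
Unshelve. all: by end_near. Qed.

Lemma input_continuous : continuous (input q).
Proof.
move=> x; pose a := Num.min 0 x - 1.
have a0 : a < 0 by rewrite ltrBlDr add0r gt_min ltr01.
have ax : a < x by rewrite ltrBlDr gt_min ltrDl ltr01 orbT.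
have ax1 : a < x + 1 by rewrite (lt_trans ax)// ltrDl.
have /(continuous_within_itvP _ ax1)[+ _ _] := causal_primitive_continuous (b :=
  x + 1) (a := a).
move=> /(_ x); rewrite in_itv/= ax ltrDl ltr01 => /(_ isT).
rewrite /continuous_at -input_primitive ?ltW// => H.
apply: cvg_trans H; apply: near_eq_cvg.
near=> y; rewrite (@input_primitive a) ?ltW//; near: y; exact: lt_nbhsr.
Unshelve. all: by end_near. Qed.
End causal.

(** [sup] has a default value on unbounded sets; continuity on the compact interval makes it a true
    supremum. *)
Lemma sup_upto_ub f t s : {within `[0, t], continuous f} -> 0 <= s <= t ->
  f s <= sup_upto t f.
Proof.
move=> cf st; apply: ub_le_sup; last by exists s.
have [M [_ HM]] := compact_bounded (continuous_compact cf (@segment_compact _ 0 t)).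
exists (M + 1) => _ [u ut <-]; apply: (le_trans (ler_norm _)).
apply: (HM (M + 1)); first by rewrite ltrDl.
by exists u => //=; rewrite in_itv.
Qed.

Lemma sup_upto_le f t M : 0 <= t -> (forall s, 0 <= s <= t -> f s <= M) ->
  sup_upto t f <= M.
Proof.
move=> t0 H; apply: ge_sup; first by exists (f 0), 0 => //=; rewrite lexx.
by move=> _ [s st <-]; exact: H.
Qed.

Section functional.
Context (L : R) (Lam : (R -> R) -> R) (M : R).
Context (LamB : forall f g, L2 L f -> L2 L g -> Lam (fun x => f x - g x) = Lam f - Lam g).
Context (LamZ : forall k f, L2 L f -> Lam (fun x => k * f x) = k * Lam f).
Context (Lam_le : forall f, L2 L f -> `|Lam f| <= M * L2norm L f).
Context (M_ge0 : 0 <= M).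

(** Stated for an abstract bounded linear functional because it serves both the coefficients <.,
    e_j> and the tail functional [tailf]. *)
Lemma functional_derive (f g : R -> R -> R) t : L2_C1 L f g -> 0 <= t ->
  is_derive_Rplus (fun s => Lam (f s)) t (Lam (g t)).
Proof.
move=> [Hg Hf] t0; apply/is_derive_RplusP => eps eps0.
have [Lgt _] := Hg t t0; have [Lft H] := Hf t t0.
have M1 : 0 < M + 1 by rewrite ltr_wpDl.
have /cvgrPdist_le/(_ (eps / (M + 1)) (divr_gt0 eps0 M1)) [d /= d0 Hd] := H.
exists d => // s s0 st sd; have [Lfs _] := Hf s s0.
have Lq : L2 L (fun x => (f s x - f t x) / (s - t)).
  apply: L2_eq (L2Z (s - t)^-1 (L2B Lfs Lft)) => x _; exact: mulrC.
have -> : (Lam (f s) - Lam (f t)) / (s - t) - Lam (g t) =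
    Lam (fun x => (f s x - f t x) / (s - t) - g t x).
  rewrite LamB// -LamB// mulrC -LamZ; last exact: L2B.
  by congr (Lam _ - _); apply/funext => x; rewrite mulrC.
apply: (le_trans (Lam_le (L2B Lq Lgt))).
have := Hd s; rewrite /ball/= distrC => /(_ sd st s0).
rewrite sub0r normrN ger0_norm ?L2norm_ge0// ler_pdivlMr// => {}Hd.
apply: le_trans Hd; rewrite mulrC ler_wpM2l ?L2norm_ge0//; lra.
Qed.

End functional.

Lemma L2_C1_continuous L (f g : R -> R -> R) : L2_C1 L f g -> L2_continuous L f.
Proof.
move=> [Hg Hf] t t0; have [Lgt _] := Hg t t0; have [Lft H] := Hf t t0.
split=> //; apply/within_RpP => eps eps0.
have /cvgrPdist_le/(_ 1 ltr01) [d /= d0 Hd] := H.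
have N0 : 0 < L2norm L (g t) + 1 by rewrite ltr_wpDl// L2norm_ge0.
exists (Num.min d (eps / (L2norm L (g t) + 1))); first by rewrite lt_min d0 divr_gt0.
move=> s s0; rewrite lt_min => /andP[sd se]; have [Lfs _] := Hf s s0.
rewrite subr0 ger0_norm ?L2norm_ge0//.
have [st|st] := eqVneq s t.
  rewrite (@L2norm_eq _ _ _ (fun x => 0 * f t x)); last by move=> x _;
    rewrite st subrr mul0r.
  by rewrite L2normZ// normr0 mul0r ltW.
have st0 : s - t != 0 by rewrite subr_eq0.
have Lq : L2 L (fun x => (f s x - f t x) / (s - t)).
  apply: L2_eq (L2Z (s - t)^-1 (L2B Lfs Lft)) => x _; exact: mulrC.
have := Hd s; rewrite /ball/= distrC => /(_ sd st s0).
rewrite sub0r normrN ger0_norm ?L2norm_ge0// => {}Hd.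
have Lqg := L2B Lq Lgt.
rewrite (@L2norm_eq _ _ _ (fun x => (s - t) * (((f s x - f t x) / (s - t) - g t x) +
  g t x))); last first.
  by move=> x _; rewrite subrK mulrC divfK.
rewrite L2normZ; last exact: L2D.
have := ler_L2normD Lqg Lgt => H1.
apply: (@le_trans _ _ (`|s - t| * (L2norm L (g t) + 1))).
  by rewrite ler_wpM2l//; lra.
by rewrite -ler_pdivlMr// ltW.
Qed.

Lemma L2norm_dist L (f g h : R -> R) : L2 L f -> L2 L g -> L2 L h ->
  `|L2norm L (fun x => f x - h x) - L2norm L (fun x => g x - h x)| <=
  L2norm L (fun x => f x - g x).
Proof.
move=> Lf Lg Lh.
have P (f' g' : R -> R) : L2 L f' -> L2 L g' ->
    L2norm L (fun x => f' x - h x) <= L2norm L (fun x =>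
      g' x - h x) + L2norm L (fun x => f' x - g' x).
  move=> Lf' Lg'; apply: le_trans (ler_L2normD (L2B Lg' Lh) (L2B Lf' Lg')).
  by rewrite le_eqVlt; apply/orP; left; apply/eqP/L2norm_eq => x _; ring.
have E : L2norm L (fun x => g x - f x) = L2norm L (fun x => f x - g x).
  rewrite -[RHS]mul1r -(normrN1 R) -L2normZ; last exact: L2B.
  by apply: L2norm_eq => x _; ring.
have := P f g Lf Lg; have := P g f Lg Lf; rewrite E ler_norml => H1 H2.
by apply/andP; split; lra.
Qed.

Lemma L2norm_continuous L (f : R -> R -> R) h : L2_continuous L f -> L2 L h ->
  {within Rp, continuous (fun s => L2norm L (fun x => f s x - h x))}.
Proof.
move=> H Lh; apply/continuous_RpP => t t0; apply/within_RpP => eps eps0.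
have [Lft /within_RpP/(_ eps eps0)[d d0 Hd]] := H t t0.
exists d => // s s0 sd; have [Lfs _] := H s s0.
apply: (le_trans (L2norm_dist Lfs Lft Lh)).
by have := Hd s s0 sd; rewrite subr0 ger0_norm ?L2norm_ge0.
Qed.
End half_line.

(** * The equilibrium *)

(** A real kernel vector, read over the complex numbers, would be an eigenvector for the eigenvalue
    0, whose real part is not negative. *)
Lemma hurwitz_unitmx (R : realType) (m : nat) (M : 'M[R]_m) :
  hurwitz M -> M \in unitmx.
Proof.
move=> H; rewrite unitmxE unitfE; apply/negP => /eqP d0.
have /det0P[v v0 vM] : \det M == 0 by rewrite d0.
have /H : eigenvalue (map_mx (real_complex R) M) 0.
  apply/eigenvalueP; exists (map_mx (real_complex R) v).
    by rewrite -map_mxM vM map_mx0 scale0r.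
  by rewrite map_mx_eq0.
by rewrite ltxx.
Qed.

Section plant.
Context (R : realType) (n : nat).
Definition ix_u : 'I_(1 + n + 1) := lshift 1 (lshift n ord0).
Definition ix_w (j : 'I_n) : 'I_(1 + n + 1) := lshift 1 (rshift 1 j).
Definition ix_z : 'I_(1 + n + 1) := rshift (1 + n) ord0.

Lemma sum_ix (F : 'I_(1 + n + 1) -> R) :
  \sum_i F i = F ix_u + \sum_(j < n) F (ix_w j) + F ix_z.
Proof. by rewrite big_split_ord big_split_ord /= !big_ord1. Qed.

Lemma ix_ind (P : 'I_(1 + n + 1) -> Prop) :
  P ix_u -> (forall j, P (ix_w j)) -> P ix_z -> forall i, P i.
Proof.
move=> Pu Pw Pz i; case: (split_ordP i) => k ->; last by rewrite [k]ord1; exact: Pz.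
case: (split_ordP k) => l ->; last exact: Pw.
by rewrite [l]ord1; exact: Pu.
Qed.

Lemma col_ixE (u : R) (w : 'cV[R]_n) (z : R) :
  [/\ (col_mx (col_mx u%:M w) z%:M : 'cV_(1 + n + 1)) ix_u 0 = u,
      (forall j, (col_mx (col_mx u%:M w) z%:M : 'cV_(1 + n + 1)) (ix_w j) 0 = w j 0) &
      (col_mx (col_mx u%:M w) z%:M : 'cV_(1 + n + 1)) ix_z 0 = z].
Proof.
split=> [|j|]; first by rewrite col_mxEu col_mxEu mxE.
  by rewrite col_mxEu col_mxEd.
by rewrite col_mxEd mxE.
Qed.

Context (L : R) (c : R -> R) (e : nat -> R -> R) (lambda : nat -> R).
Local Notation A := (matA L c e lambda n).
Local Notation B := (matB L e lambda n).

Lemma matB_u : B ix_u 0 = 1.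
Proof. by rewrite col_mxEu col_mxEu mxE. Qed.
Lemma matB_w j : B (ix_w j) 0 = b_coef L e j.
Proof. by rewrite col_mxEu col_mxEd mxE. Qed.
Lemma matB_z : B ix_z 0 = beta L e lambda n.
Proof. by rewrite col_mxEd mxE. Qed.

Lemma matA_u k : A ix_u k = 0.
Proof.
elim/ix_ind: k => [|j|].
- by rewrite block_mxEul block_mxEul mxE.
- by rewrite block_mxEul block_mxEur mxE.
- by rewrite block_mxEur mxE.
Qed.

Lemma matA_mul_u (X : 'cV[R]_(1 + n + 1)) : (A *m X) ix_u 0 = 0.
Proof. by rewrite mxE big1// => k _; rewrite matA_u mul0r. Qed.

Lemma matA_mul_w (X : 'cV[R]_(1 + n + 1)) j :
  (A *m X) (ix_w j) 0 = a_coef L c e j * X ix_u 0 + lambda j * X (ix_w j) 0.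
Proof.
rewrite mxE sum_ix /matA /A1.
rewrite [X in _ + X](_ : _ = 0) ?addr0; last by rewrite block_mxEur mxE mul0r.
rewrite block_mxEul block_mxEdl !mxE; congr (_ + _).
rewrite (bigD1 j)//= block_mxEul block_mxEdr !mxE eqxx mulr1n big1 ?addr0// => k kj.
by rewrite block_mxEul block_mxEdr !mxE eq_sym (negbTE kj) mulr0n mul0r.
Qed.

Lemma matA_mul_z (X : 'cV[R]_(1 + n + 1)) :
  (A *m X) ix_z 0 = alpha L c e lambda n * X ix_u 0 +
    \sum_(j < n) dx0 (e j) * X (ix_w j) 0.
Proof.
rewrite mxE sum_ix /matA /L1.
rewrite [X in _ + X](_ : _ = 0) ?addr0; last by rewrite block_mxEdr mxE mul0r.
rewrite block_mxEdl row_mxEl !mxE mulr1n; congr (_ + _).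
by apply: eq_bigr => j _; rewrite block_mxEdl row_mxEr mxE.
Qed.

Context (D : R) (K : 'rV[R]_(1 + n + 1)).
Context (AK_hurwitz : hurwitz (matAK L D c e lambda K)).
Context (re : R) (de : R -> R).
Local Notation Xe := (X_e L D c e lambda K re de).
Local Notation ue := (u_e L D c e lambda K re de).
Local Notation ze := (zeta_e L D c e lambda K re de).

Lemma X_e_u : Xe ix_u 0 = ue. Proof. by rewrite /u_e !mxE. Qed.
Lemma X_e_w j : Xe (ix_w j) 0 = dsubmx (usubmx Xe) j 0. Proof. by rewrite !mxE. Qed.
Lemma X_e_z : Xe ix_z 0 = ze. Proof. by rewrite /zeta_e !mxE. Qed.

Lemma Gamma_eE :
  [/\ Gamma_e L e lambda n re de ix_u 0 = 0,
      (forall j, Gamma_e L e lambda n re de (ix_w j) 0 = inner L de (e j)) &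
      Gamma_e L e lambda n re de ix_z 0 = - re - tail e lambda n (fun j =>
        inner L de (e j))].
Proof.
split=> [|j|]; first by rewrite col_mxEu col_mxEu mxE.
  by rewrite col_mxEu col_mxEd mxE.
by rewrite col_mxEd mxE.
Qed.

Lemma matAK_X_e : matAK L D c e lambda K *m Xe = - Gamma_e L e lambda n re de.
Proof. by rewrite /X_e mulmxN mulmxA mulmxV ?mul1mx// hurwitz_unitmx. Qed.

(** This is the first row of A_K X_e = - Gamma_e. The first row of A is zero, so e^(-DA) B has the
    same first entry as B, namely 1, and the first entry of Gamma_e is 0. *)
Lemma K_X_e : K *m Xe = 0.
Proof.
have [G0 _ _] := Gamma_eE.
have : (matAK L D c e lambda K *m Xe) ix_u 0 = 0.
  by rewrite matAK_X_e mxE G0 oppr0.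
rewrite /matAK mulmxDl mxE matA_mul_u add0r -mulmxA mxE big_ord1.
rewrite [X in X * _](_ : _ = 1).
  by rewrite mul1r => H; apply/matrixP => i j; rewrite !ord1 H mxE.
rewrite mxE (bigD1 ix_u)//= expmx_row; last exact: matA_u.
rewrite eqxx mul1r matB_u big1 ?addr0// => k kN.
by rewrite expmx_row; [rewrite eq_sym (negbTE kN) mul0r | exact: matA_u].
Qed.

Lemma matA_X_e : A *m Xe = - Gamma_e L e lambda n re de.
Proof. by rewrite -matAK_X_e /matAK mulmxDl -(mulmxA _ K) K_X_e mulmx0 addr0. Qed.

Context (L_gt0 : 0 < L) (c_Linfty : Linfty L c).
Context (spec : spectral_data L c e lambda).
Context (lambda_lt0 : forall j, (n <= j)%N -> lambda j <= lambda n < 0).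
Context (Lde : L2 L de) (we : R -> R) (Hwe : is_w_e L D c e lambda K re de we).
Local Notation T := (tailf L e lambda n).

(** The equilibrium profile is known only as an L^2 limit of partial sums, whose j-th coefficient is
    eventually constant; [coef_le] carries it to the limit. *)
Lemma w_e_coef j : inner L we (e j) =
  if insub j is Some i then Xe (ix_w i) 0 else w_e_tail L D c e lambda K re de j.
Proof.
have [Dwe Hl] := Hwe; have [Hw _ _] := Dwe; have Lwe := H2_L2 L_gt0 Hw.
have [_ orth _] := spec_basis spec.
have Le := spec_L2 L_gt0 spec.
set cf := fun j : nat => if insub j is Some i then Xe (ix_w i) 0 else w_e_tail L D c
  e lambda K re de j.
have SE N x : \sum_(j < n) dsubmx (usubmx Xe) j ord0 * e j x +
    \sum_(n <= j < N) w_e_tail L D c e lambda K re de j * e j x =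
    \sum_(0 <= j < n) cf j * e j x + \sum_(n <= j < N) cf j * e j x.
  rewrite big_mkord; congr (_ + _).
    by apply: eq_bigr => i _; rewrite /cf valK -X_e_w.
  apply: eq_big_nat => i /andP[ni _].
  by rewrite /cf insubF// ltnNge ni.
apply/eqP; rewrite -subr_eq0 -normr_le0; apply/ler_addgt0Pr => eps eps0.
rewrite add0r.
have /cvgrPdist_le/(_ _ eps0) := Hl.
(* N reaches n, so that the two sums join, and exceeds j, so that the term in e_j is present. *)
move=> [N0 _ HN]; pose N := maxn (maxn n j.+1) N0.
have jN : (j < N)%N by rewrite /N !leq_max leqnn orbT.
have nN : (n <= N)%N by rewrite /N !leq_max leqnn.
have := HN N (leq_maxr _ _); rewrite sub0r normrN ger0_norm ?L2norm_ge0// => {}HN.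
rewrite (@L2norm_eq _ _ _ (fun x => we x - \sum_(0 <= j < N) cf j * e j x)) in HN;
  last first.
  by move=> x _; rewrite SE (@big_cat_nat _ _ _ n 0 N).
have LS : L2 L (fun x => \sum_(0 <= j < N) cf j * e j x).
  by apply: L2_sum => i; exact: L2Z.
have := coef_le (spec_basis spec) j (L2B Lwe LS).
rewrite innerBl// inner_suml//; last by move=> i; exact: L2Z.
rewrite (bigD1_seq j) ?mem_index_iota ?iota_uniq//=.
rewrite innerZl// orth eqxx mulr1 big1 ?addr0; last first.
  by move=> i ij; rewrite innerZl// orth (negbTE ij) mulr0.
by move=> /le_trans; apply.
Qed.

Lemma w_e_w (j : 'I_n) : inner L we (e j) = Xe (ix_w j) 0.
Proof. by rewrite w_e_coef valK. Qed.

(** The j-th coefficient of A w_e + u_e a + d_e = 0. For j < n it is a row of A X_e = - Gamma_e, for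
    j >= n the formula that defines w_{j,e}. *)
Lemma equilibrium_coef j :
  lambda j * inner L we (e j) + a_coef L c e j * ue + inner L de (e j) = 0.
Proof.
rewrite w_e_coef; case: insubP => [i _ <-|].
  have [_ Gw _] := Gamma_eE.
  have := congr1 (fun M : 'cV_(1 + n + 1) => M (ix_w i) 0) matA_X_e.
  by rewrite /= matA_mul_w [RHS]mxE Gw X_e_u => H; lra.
rewrite -leqNgt => nj; have /andP[H1 H2] := lambda_lt0 nj.
by rewrite /w_e_tail; field; rewrite lt_eqF// (le_lt_trans H1).
Qed.

Lemma equilibrium_zeta :
  alpha L c e lambda n * ue + \sum_(j < n) dx0 (e j) * inner L we (e j) = re + T de.
Proof.
have [_ _ Gz] := Gamma_eE.
have := congr1 (fun M : 'cV_(1 + n + 1) => M ix_z 0) matA_X_e.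
rewrite /= matA_mul_z [RHS]mxE Gz X_e_u -/(T de) opprB opprK.
rewrite addrC [in RHS]addrC => <-; rewrite addrC; congr (_ + _).
by apply: eq_bigr => j _; rewrite w_e_w.
Qed.

Lemma alphaE : alpha L c e lambda n = L^-1 - T (fun x => x / L * c x).
Proof. by []. Qed.

Lemma tailf_coef f g : (forall j, inner L f (e j) = inner L g (e j)) -> T f = T g.
Proof. by move=> fg; rewrite /tailf; congr tail; apply/funext. Qed.

(** A w_e has the coefficients of - u_e a - d_e, so [dx0_tail] turns the flux into the last row of A
    X_e = - Gamma_e. *)
Lemma equilibrium_dx0 : dx0 we + ue / L = re.
Proof.
have [Dwe _] := Hwe; have [Hw _ _] := Dwe.
have La := aramp_L2 L_gt0 c_Linfty.
rewrite (dx0_tail L_gt0 c_Linfty spec lambda_lt0 Dwe).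
rewrite (@tailf_coef _ (fun x => - ue * (x / L * c x) - de x)); last first.
  move=> j; rewrite (domA_coef L_gt0 c_Linfty spec j Dwe).
  rewrite innerBl// ?innerZl//; try exact: (spec_L2 L_gt0 spec); last exact: L2Z.
  by have := equilibrium_coef j; rewrite -/(a_coef L c e j); lra.
rewrite (tailfB L_gt0 c_Linfty spec lambda_lt0)//; last exact: L2Z.
rewrite (tailfZ L_gt0 c_Linfty spec lambda_lt0)//.
by have := equilibrium_zeta; rewrite alphaE big_mkord; lra.
Qed.

End plant.

(** * Closed-loop trajectories *)

Section H2_vector_space.
Context (R : realType) (L : R) (L_gt0 : 0 < L).
Implicit Types f g : R -> R.

Lemma H2B f g : H2 L f -> H2 L g -> H2 L (fun x => f x - g x).
Proof.
move=> [f1 ff1 [f2 f12]] [g1 gg1 [g2 g12]].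
exists (fun x => f1 x - g1 x); first exact: weak_derivativeB.
by exists (fun x => f2 x - g2 x); exact: weak_derivativeB.
Qed.

Lemma H2_rampZ u : H2 L (fun x => x / L * u).
Proof.
have := weak_derivativeZ u (ramp_weak_derivative L).
rewrite (_ : (fun x => u * (x / L)) = (fun x => x / L * u)); last first.
  by apply/funext => x; rewrite mulrC.
by move=> H; exists (fun=> u * L^-1) => //; exists (fun=> 0); exact: weak_derivative_cst.
Qed.

Lemma dx0B f g : H2 L f -> H2 L g ->
  dx0 (fun x => f x - g x) = dx0 f - dx0 g.
Proof.
move=> Hf Hg; have [ff1 ff2] := wderiv1P Hf; have [gg1 gg2] := wderiv1P Hg.
rewrite (dx0_H2 L_gt0 Hf) (dx0_H2 L_gt0 Hg).
apply: (dx0_weak_derivative L_gt0 (weak_derivativeB ff1 gg1)).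
exact: (weak_derivative_continuous L_gt0 (weak_derivativeB ff2 gg2)).
Qed.

Lemma dx0_rampZ u : dx0 (fun x => x / L * u) = u / L.
Proof.
have := weak_derivativeZ u (ramp_weak_derivative L).
rewrite (_ : (fun x => u * (x / L)) = (fun x => x / L * u)); last first.
  by apply/funext => x; rewrite mulrC.
move=> H; apply: (dx0_weak_derivative L_gt0 H).
by apply: continuous_subspaceT => ?; exact: cst_continuous.
Qed.
End H2_vector_space.

Lemma Rintegral_bigsum (R : realType) (A : set R) (I : Type) (s : seq I)
    (F : I -> R -> R) : measurable A ->
  (forall i, (@lebesgue_measure R).-integrable A (EFin \o F i)) ->
  (@lebesgue_measure R).-integrable A (EFin \o (fun x => \sum_(i <- s) F i x)) /\
  \int[@lebesgue_measure R]_(x in A) (\sum_(i <- s) F i x) =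
  \sum_(i <- s) \int[@lebesgue_measure R]_(x in A) F i x.
Proof.
move=> mA IF; elim: s => [|i s [IH1 IH2]].
  rewrite (_ : (fun x => _) = (fun=> 0)); last by apply/funext => x; rewrite big_nil.
  by split; [exact: integrable0 | rewrite big_nil /Rintegral integral0_eq].
rewrite (_ : (fun x => _) = (fun x => F i x + \sum_(i <- s) F i x)); last first.
  by apply/funext => x; rewrite big_cons.
split; first exact: integrable_EFinD.
by rewrite RintegralD// IH2 big_cons.
Qed.

(** * The kernel of the predictor feedback *)

Section feedback_kernel.
Context (R : realType) (m : nat) (D : R) (A : 'M[R]_m) (K : 'rV[R]_m).

(** Normalised so that, along a delay interval of length D ending at t, th = t - sg decreases from
    D, where the kernel is K, to 0, where it is K e^(-DA). *)
Definition kern (th : R) : 'rV[R]_m := K *m expmx ((th - D) *: A).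

Lemma kernE th i : kern th 0 i = \sum_l K 0 l * expmx ((th - D) *: A) l i.
Proof. by rewrite mxE. Qed.

Lemma expmx_shift_derive (a th : R) l i :
  is_derive th 1 (fun th => expmx ((th - a) *: A) l i)
    ((expmx ((th - a) *: A) *m A) l i).
Proof.
have Hs := rderivB (rderiv_id th) (rderiv_cst a th); rewrite subr0 in Hs.
apply: rderiv_eq (@rderiv_comp _ (fun x => expmx (x *: A) l i) (fun t => t - a)
  th _ _ (is_derive_expmx A (th - a) l i) Hs) => //; exact: mulr1.
Qed.

Lemma kern_derive (th : R) i :
  is_derive th 1 (fun th => kern th 0 i) ((kern th *m A) 0 i).
Proof.
have H := rderiv_sum (index_enum 'I_m) (fun l =>
  rderivZ (K 0 l) (expmx_shift_derive D th l i)).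
apply: rderiv_eq H; first by move=> x; rewrite kernE.
by rewrite /kern -mulmxA [RHS]mxE.
Qed.

Lemma derive_continuous (f : R -> R) (df : R -> R) :
  (forall x : R, is_derive x 1 f (df x)) -> continuous f.
Proof.
move=> H x; apply: differentiable_continuous; apply/derivable1_diffP.
by have [] := H x.
Qed.

Lemma kern_continuous i : continuous (fun th => kern th 0 i).
Proof. exact: (derive_continuous (fun th => kern_derive th i)). Qed.

Lemma kernD : kern D = K.
Proof. by rewrite /kern subrr scale0r expmx0 mulmx1. Qed.

Lemma kern_bounded : exists2 M, 0 <= M &
  forall th i, 0 <= th <= D -> `|kern th 0 i| <= M.
Proof.
have cf : {within `[0, D], continuous (fun th => \sum_i `|kern th 0 i|)}.
  apply: continuous_subspaceT => th; apply: cvg_bigsum => i; apply: cvg_norm.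
  exact: kern_continuous.
have [M [_ HM]] := compact_bounded (continuous_compact cf (@segment_compact _ 0 D)).
exists (`|M| + 1); first by rewrite addr_ge0.
move=> th i thD; apply: (@le_trans _ _ `|\sum_i `|kern th 0 i| |).
  rewrite [leRHS]ger0_norm; last exact: sumr_ge0.
  by rewrite (bigD1 i)//= lerDl; exact: sumr_ge0.
apply: (HM (`|M| + 1)); first by rewrite (le_lt_trans (ler_norm _))// ltrDl.
by exists th => //=; rewrite in_itv.
Qed.
End feedback_kernel.

(** * Evolution of the deviations along a trajectory *)

Section trajectory.
Context (R : realType) (L D : R) (c : R -> R) (e : nat -> R -> R).
Context (lambda : nat -> R) (n : nat) (K : 'rV[R]_(1 + n + 1)).
Context (L_gt0 : 0 < L) (D_gt0 : 0 < D) (c_Linfty : Linfty L c).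
Context (spec : spectral_data L c e lambda).
Context (lambda_lt0 : forall j, (n <= j)%N -> lambda j <= lambda n < 0).
Context (AK_hurwitz : hurwitz (matAK L D c e lambda K)).
Context (re : R) (de we : R -> R) (Lde : L2 L de).
Context (Hwe : is_w_e L D c e lambda K re de we).
Context (r : R -> R) (d dd : R -> R -> R) (y0 : R -> R) (z0 : R).
Context (y : R -> R -> R) (z v : R -> R).
Context (cl : closed_loop L D c e lambda K r d dd y0 z0 y z v).

Local Notation ue := (u_e L D c e lambda K re de).
Local Notation ze := (zeta_e L D c e lambda K re de).
Local Notation Xe := (X_e L D c e lambda K re de).
Local Notation A := (matA L c e lambda n).
Local Notation B := (matB L e lambda n).
Local Notation T := (tailf L e lambda n).
Local Notation Rp := [set t : R | 0 <= t].
Local Notation "f `_[ j ]" := (inner L f (e j)) (at level 3, format "f `_[ j ]").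
Local Notation u := (u_D D v).
Local Notation w := (w_of L D y v).
Local Notation zeta := (zeta_of L D e lambda n y z v).
Local Notation Dw := (dev_w L D y v we).

Let Le j : L2 L (e j) := spec_L2 L_gt0 spec j.
#[local] Hint Resolve Le : core.

Lemma we_H2 : H2 L we. Proof. by have [[]] := Hwe. Qed.
Lemma we_L2 : L2 L we. Proof. exact: (H2_L2 L_gt0 we_H2). Qed.

Lemma y_H2 t : 0 <= t -> H2 L (y t). Proof. exact: (cl_y_H2 cl). Qed.
Lemma y_L2 t : 0 <= t -> L2 L (y t). Proof. by move=> /y_H2; exact: (H2_L2 L_gt0). Qed.
Lemma d_L2 t : 0 <= t -> L2 L (d t). Proof.
  by move=> t0; have [_ /(_ t t0)[]] := cl_d cl. Qed.
Lemma dd_L2 t : 0 <= t -> L2 L (dd t). Proof.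
  by move=> t0; have [/(_ t t0)[]] := cl_d cl. Qed.

Lemma w_domA t : 0 <= t -> domA L (w t).
Proof.
move=> t0; split.
- exact: (H2B (y_H2 t0) (H2_rampZ L _)).
- by rewrite /w_of (cl_bc0 cl)// !mul0r subrr.
- by rewrite /w_of (cl_bcL cl)// divff ?gt_eqF// mul1r subrr.
Qed.

Lemma w_H2 t : 0 <= t -> H2 L (w t). Proof. by move=> /w_domA[]. Qed.
Lemma w_L2 t : 0 <= t -> L2 L (w t). Proof. by move=> /w_H2; exact: (H2_L2 L_gt0). Qed.

Lemma Dw_domA t : 0 <= t -> domA L (Dw t).
Proof.
move=> t0; have [Hw w0 wL] := w_domA t0; have [[Hwe' we0 weL] _] := Hwe.
by split; [exact: H2B | rewrite /dev_w w0 we0 subrr | rewrite /dev_w wL weL subrr].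
Qed.

Lemma w_coef t j : 0 <= t -> (w t)`_[j] = (y t)`_[j] + u t * b_coef L e j.
Proof.
move=> t0; have Lr := ramp_L2 L_gt0; have Ly := y_L2 t0.
have -> : b_coef L e j = - (fun x => x / L)`_[j].
  by rewrite -[RHS]mulN1r -innerZl// /b_coef; apply: eq_inner => // x _; rewrite mulN1r.
rewrite mulrN -innerZl// -innerBl//; last exact: L2Z.
by apply: eq_inner => // x _; rewrite /w_of mulrC.
Qed.

Lemma opA_y_coef t j : 0 <= t ->
  (opA L c (y t))`_[j] = lambda j * (w t)`_[j] + a_coef L c e j * u t.
Proof.
move=> t0; rewrite (opA_coef L_gt0 c_Linfty spec j (y_H2 t0) (cl_bc0 cl t0)).
by rewrite (cl_bcL cl t0) w_coef//; ring.
Qed.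

Definition Du t : R := u t - ue.
Definition Dcoef j t : R := (w t)`_[j] - we`_[j].
Definition Dzeta t : R := zeta t - ze.
(* The j-th coefficient of y_t, by rateE. *)
Definition rate j t : R :=
  lambda j * Dcoef j t + a_coef L c e j * Du t + ((d t)`_[j] - de`_[j]).

Lemma Dcoef_dev t j : 0 <= t -> Dcoef j t = (Dw t)`_[j].
Proof. by move=> t0; rewrite /Dcoef -innerBl//; [exact: w_L2|exact: we_L2]. Qed.

(** y_t vanishes at the equilibrium: subtracting [equilibrium_coef] replaces w, u_D and d by their
    deviations. *)
Lemma rateE j t : 0 <= t ->
  rate j t = (fun x => opA L c (y t) x + d t x)`_[j].
Proof.
move=> t0; rewrite innerDl//; last 2 first.
- exact: (opA_L2 L_gt0 c_Linfty (y_H2 t0)).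
- exact: d_L2.
rewrite opA_y_coef// /rate /Dcoef /Du.
have := equilibrium_coef AK_hurwitz L_gt0 spec lambda_lt0 Hwe j.
by lra.
Qed.

Lemma v_causal : {within Rp, continuous v} /\ (forall t, t < 0 -> v t = 0).
Proof. by split; [exact: (cl_v_cont cl) | exact: (cl_v_neg cl)]. Qed.

Lemma u_derive s : s != D -> is_derive s 1 u (v (s - D)).
Proof.
move=> sD; have [vc vn] := v_causal.
have H : is_derive (s - D) 1 (input v) (v (s - D)).
  by apply: input_derive => //; rewrite subr_eq0.
have Hs := rderivB (rderiv_id s) (rderiv_cst D s); rewrite subr0 in Hs.
by apply: rderiv_eq (@rderiv_comp _ (input v) (fun t => t - D) s _ _ H Hs) => //;
  rewrite mulr1.
Qed.

Lemma u_continuous : continuous u.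
Proof.
have [vc vn] := v_causal; move=> s.
apply: (@continuous_comp _ _ _ (fun t => t - D) (input v)).
  by apply: cvgB; [exact: cvg_id | exact: cvg_cst].
exact: input_continuous.
Qed.

Lemma coef_functional phi : L2 L phi ->
  [/\ (forall f g, L2 L f -> L2 L g -> inner L (fun x =>
    f x - g x) phi = inner L f phi - inner L g phi),
    (forall k f, L2 L f -> inner L (fun x => k * f x) phi = k * inner L f phi),
    (forall f, L2 L f -> `|inner L f phi| <= L2norm L phi * L2norm L f) & 0 <= L2norm
      L phi].
Proof.
move=> Lp; split=> [f g Lf Lg|k f Lf|f Lf|]; first exact: innerBl.
- exact: innerZl.
- by rewrite mulrC; exact: L2_CauchySchwarz.
- exact: L2norm_ge0.
Qed.

Lemma y_coef_derive j t : 0 <= t ->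
  is_derive_Rplus (fun s => (y s)`_[j]) t (rate j t).
Proof.
move=> t0; rewrite rateE//; have [P1 P2 P3 P4] := coef_functional (Le j).
exact: (functional_derive (Lam := fun f => f`_[j]) P1 P2 P3 P4 (cl_pde cl)).
Qed.

Lemma d_coef_derive j t : 0 <= t ->
  is_derive_Rplus (fun s => (d s)`_[j]) t (dd t)`_[j].
Proof.
move=> t0; have [P1 P2 P3 P4] := coef_functional (Le j).
exact: (functional_derive (Lam := fun f => f`_[j]) P1 P2 P3 P4 (cl_d cl)).
Qed.

Lemma Du_derive s : s != D -> is_derive s 1 Du (v (s - D)).
Proof.
by move=> sD; apply: rderiv_eq (rderivB (u_derive sD) (rderiv_cst ue s)) => //;
  rewrite subr0.
Qed.

Lemma Dcoef_derive j s : 0 < s -> s != D ->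
  is_derive s 1 (Dcoef j) (rate j s + b_coef L e j * v (s - D)).
Proof.
move=> s0 sD.
(* w is differentiated through y, which is C^1 in time; the possible jump of v_D at D is then
   confined to the explicit term in u_D. *)
have H := rderivB (rderivD (is_derive_Rplus_gt0 s0 (@y_coef_derive j s (ltW s0)))
  (rderivM (u_derive sD) (rderiv_cst (b_coef L e j) s))) (rderiv_cst we`_[j] s).
apply: near_eq_is_derive (rderiv_eq (fun=> erefl) _ H); last by ring.
near=> t; rewrite /Dcoef w_coef// ltW//; near: t; exact: lt_nbhsr.
Unshelve. all: by end_near. Qed.

(** y_t is only known to be continuous in time. Its coefficients are nevertheless differentiable off
    D, because [rate] writes them in terms of differentiable quantities. *)
Lemma rate_derive j s : 0 < s -> s != D ->
  is_derive s 1 (rate j) (lambda j * rate j s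
    + (lambda j * b_coef L e j + a_coef L c e j) * v (s - D) + (dd s)`_[j]).
Proof.
move=> s0 sD.
apply: rderiv_eq (rderivD (rderivD (rderivZ (lambda j) (Dcoef_derive j s0 sD))
  (rderivZ (a_coef L c e j) (Du_derive sD)))
  (rderivB (is_derive_Rplus_gt0 s0 (@d_coef_derive j s (ltW s0))) (rderiv_cst de`_[j]
    s))) => //.
by ring.
Qed.

Lemma Rp_continuousT (f : R -> R) : continuous f -> {within Rp, continuous f}.
Proof. exact: continuous_subspaceT. Qed.

Lemma Du_continuous : {within Rp, continuous Du}.
Proof.
by apply: Rp_continuousT => s; apply: cvgB; [exact: u_continuous | exact: cvg_cst].
Qed.

Lemma y_coef_continuous j : {within Rp, continuous (fun s => (y s)`_[j])}.
Proof.
by apply: is_derive_Rplus_continuous => t t0; eexists; exact: y_coef_derive.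
Qed.

Lemma d_coef_continuous j : {within Rp, continuous (fun s => (d s)`_[j])}.
Proof.
by apply: is_derive_Rplus_continuous => t t0; eexists; exact: d_coef_derive.
Qed.

Lemma Dcoef_continuous j : {within Rp, continuous (Dcoef j)}.
Proof.
apply: (@subspace_eq_continuous _ _ _
  (fun s => (y s)`_[j] + u s * b_coef L e j - we`_[j])).
  by move=> s; rewrite inE/= => s0; rewrite -[RHS]/(Dcoef j s) /Dcoef w_coef.
apply: within_continuousB; last exact: within_continuous_cst.
apply: within_continuousD; first exact: y_coef_continuous.
apply: within_continuousM; last exact: within_continuous_cst.
exact: (Rp_continuousT u_continuous).
Qed.

Lemma rate_continuous j : {within Rp, continuous (rate j)}.
Proof.
apply: within_continuousD; last first.
  apply: within_continuousB; last exact: within_continuous_cst.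
  exact: d_coef_continuous.
apply: within_continuousD.
  apply: within_continuousM; [exact: within_continuous_cst | exact: Dcoef_continuous].
apply: within_continuousM; [exact: within_continuous_cst | exact: Du_continuous].
Qed.

(** The tail functional splits along w = y - (x/L) u_D, and [beta] is its value at x/L. As for the
    coefficients, the C^1 part y is separated from u_D. *)
Lemma zetaE t : 0 <= t -> zeta t = z t - T (y t) + u t * beta L e lambda n.
Proof.
move=> t0; have Lr := ramp_L2 L_gt0; have Ly := y_L2 t0.
have -> : beta L e lambda n = T (fun x => x / L).
  rewrite /beta -[tail _ _ _ _]/(T (fun x => - (x / L))) -[RHS]opprK; congr (- _).
  rewrite -mulN1r -(tailfZ L_gt0 c_Linfty spec lambda_lt0)//.
  by apply: eq_tailf => x _; rewrite mulN1r.
have E : T (w t) = T (y t) - u t * T (fun x => x / L).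
  rewrite -(tailfZ L_gt0 c_Linfty spec lambda_lt0 _ Lr).
  rewrite -(tailfB L_gt0 c_Linfty spec lambda_lt0 Ly (L2Z _ Lr)).
  by apply: eq_tailf => x _; rewrite /w_of mulrC.
by rewrite /zeta_of -/(T (w t)) E; ring.
Qed.

Lemma dx0_y t : 0 <= t -> dx0 (y t) = dx0 (w t) + u t / L.
Proof.
move=> t0; rewrite (_ : w t = fun x => y t x - x / L * u t)//.
by rewrite (dx0B L_gt0 (y_H2 t0) (H2_rampZ L _)) (dx0_rampZ L_gt0) subrK.
Qed.

(** This cancellation is the reason for the correction in zeta: the tail of the flux is T(A w),
    while A y has the coefficients of A w + u_D a, so only the first n modes and u_D remain. *)
Lemma zeta_flux t : 0 <= t -> dx0 (y t) - T (opA L c (y t)) =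
  alpha L c e lambda n * u t + \sum_(j < n) dx0 (e j) * (w t)`_[j].
Proof.
move=> t0; rewrite dx0_y// (dx0_tail L_gt0 c_Linfty spec lambda_lt0 (w_domA t0)).
have La := aramp_L2 L_gt0 c_Linfty; have LA := opA_L2 L_gt0 c_Linfty (w_H2 t0).
have -> : T (opA L c (y t)) = T (fun x => opA L c (w t) x + u t * (x / L * c x)).
  apply: tailf_coef => j; rewrite innerDl// ?innerZl//; last exact: L2Z.
  rewrite (domA_coef L_gt0 c_Linfty spec j (w_domA t0)) opA_y_coef// -/(a_coef L c e j).
  by ring.
rewrite (tailfD L_gt0 c_Linfty spec lambda_lt0)//; last exact: L2Z.
rewrite (tailfZ L_gt0 c_Linfty spec lambda_lt0)// alphaE big_mkord; ring.
Qed.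

Lemma tail_functional :
  [/\ (forall f g, L2 L f -> L2 L g -> T (fun x => f x - g x) = T f - T g),
    (forall k f, L2 L f -> T (fun x => k * f x) = k * T f),
    (forall f, L2 L f -> `|T f| <= tailf_bound L c lambda n * L2norm L f)
    & 0 <= tailf_bound L c lambda n].
Proof.
split=> [f g Lf Lg|k f Lf|f Lf|].
- exact: (tailfB L_gt0 c_Linfty spec lambda_lt0).
- exact: (tailfZ L_gt0 c_Linfty spec lambda_lt0).
- exact: (tailf_le L_gt0 c_Linfty spec lambda_lt0).
- exact: tailf_bound_ge0.
Qed.

Lemma Dzeta_derive s : 0 < s -> s != D ->
  is_derive s 1 Dzeta (alpha L c e lambda n * Du s
    + \sum_(j < n) dx0 (e j) * Dcoef j s + beta L e lambda n * v (s - D)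
    + (- (r s - re) - T (fun x => d s x - de x))).
Proof.
move=> s0 sD; have s0' := ltW s0.
have [P1 P2 P3 P4] := tail_functional.
have Ty := functional_derive (Lam := T) P1 P2 P3 P4 (cl_pde cl) s0'.
have H := rderivB (rderivD (rderivB (is_derive_Rplus_gt0 s0 (cl_z cl s0'))
  (is_derive_Rplus_gt0 s0 Ty))
   (rderivM (u_derive sD) (rderiv_cst (beta L e lambda n) s))) (rderiv_cst ze s).
apply: near_eq_is_derive (rderiv_eq (fun=> erefl) _ H).
  near=> t; rewrite /Dzeta zetaE// ltW//; near: t; exact: lt_nbhsr.
have LA := opA_L2 L_gt0 c_Linfty (y_H2 s0'); have Ld := d_L2 s0'.
rewrite (tailfD L_gt0 c_Linfty spec lambda_lt0 LA Ld) (P1 _ _ Ld Lde).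
have := zeta_flux s0'.
have := equilibrium_zeta AK_hurwitz L_gt0 spec Hwe.
have -> : \sum_(j < n) dx0 (e j) * Dcoef j s =
    \sum_(j < n) dx0 (e j) * (w s)`_[j] - \sum_(j < n) dx0 (e j) * we`_[j].
  by rewrite -sumrB; apply: eq_bigr => j _; rewrite -mulrBr.
rewrite /Du; lra.
Unshelve. all: by end_near. Qed.

Lemma Dzeta_continuous : {within Rp, continuous Dzeta}.
Proof.
apply: (@subspace_eq_continuous _ _ _
  (fun s => z s - T (y s) + u s * beta L e lambda n - ze)).
  by move=> s; rewrite inE/= => s0; rewrite -[RHS]/(Dzeta s) /Dzeta zetaE.
have [P1 P2 P3 P4] := tail_functional.
have cz : {within Rp, continuous z}.
  by apply: is_derive_Rplus_continuous => t t0; eexists; exact: (cl_z cl).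
have cT : {within Rp, continuous (fun s => T (y s))}.
  apply: is_derive_Rplus_continuous => t t0; eexists.
  exact: (functional_derive (Lam := T) P1 P2 P3 P4 (cl_pde cl)).
apply: within_continuousB; last exact: within_continuous_cst.
apply: within_continuousD; first exact: within_continuousB.
apply: within_continuousM; last exact: within_continuous_cst.
exact: (Rp_continuousT u_continuous).
Qed.

(** * The finite-dimensional deviation and the predictor *)

Definition DX t : 'cV[R]_(1 + n + 1) := X_of L D e lambda n y z v t - Xe.

Lemma DX_u t : DX t (ix_u n) 0 = Du t.
Proof. by rewrite /DX mxE [X in _ + X]mxE X_e_u; congr (_ - _);
  have [] := col_ixE (u t) (\col_(j < n) (w t)`_[j]) (zeta t). Qed.

Lemma DX_w t (j : 'I_n) : DX t (ix_w j) 0 = Dcoef j t.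
Proof.
rewrite /DX mxE [X in _ + X]mxE -(w_e_w L_gt0 spec Hwe); congr (_ - _).
by have [_ -> _] := col_ixE (u t) (\col_(j < n) (w t)`_[j]) (zeta t); rewrite mxE.
Qed.

Lemma DX_z t : DX t (ix_z n) 0 = Dzeta t.
Proof. by rewrite /DX mxE [X in _ + X]mxE X_e_z; congr (_ - _);
  have [] := col_ixE (u t) (\col_(j < n) (w t)`_[j]) (zeta t). Qed.

Definition DGamma t : 'cV[R]_(1 + n + 1) :=
  col_mx (col_mx 0%:M (\col_(j < n) ((d t)`_[j] - de`_[j])))
         (- (r t - re) - T (fun x => d t x - de x))%:M.

Lemma DGamma_u t : DGamma t (ix_u n) 0 = 0.
Proof. by rewrite /DGamma col_mxEu col_mxEu mxE. Qed.

Lemma DGamma_w t (j : 'I_n) : DGamma t (ix_w j) 0 = (d t)`_[j] - de`_[j].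
Proof. by rewrite /DGamma col_mxEu col_mxEd mxE. Qed.

Lemma DGamma_z t :
  DGamma t (ix_z n) 0 = - (r t - re) - T (fun x => d t x - de x).
Proof. by rewrite /DGamma col_mxEd mxE eqxx. Qed.

Lemma DX_derive s i : 0 < s -> s != D ->
  is_derive s 1 (fun t => DX t i 0)
    ((A *m DX s) i 0 + B i 0 * v (s - D) + DGamma s i 0).
Proof.
move=> s0 sD.
move: (DX s) (DX_u s) (DX_w s) => X Xu Xw.
move: (DGamma s) (DGamma_u s) (DGamma_w s) (DGamma_z s) => G Gu Gw Gz.
elim/ix_ind: i => [|j|].
- rewrite matA_mul_u matB_u Gu; apply: rderiv_eq (Du_derive sD); last by ring.
  by move=> t; rewrite DX_u.
- rewrite matA_mul_w matB_w Gw Xu Xw.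
  apply: rderiv_eq (Dcoef_derive j s0 sD); last by rewrite /rate; ring.
  by move=> t; rewrite DX_w.
- rewrite matA_mul_z matB_z Gz Xu.
  rewrite (eq_bigr (fun j : 'I_n => dx0 (e j) * Dcoef j s)); last first.
    by move=> j _; rewrite Xw.
  apply: rderiv_eq (Dzeta_derive s0 sD) => //.
  by move=> t; rewrite DX_z.
Qed.

Lemma DX_continuous i : {within Rp, continuous (fun t => DX t i 0)}.
Proof.
elim/ix_ind: i => [|j|].
- by rewrite (_ : (fun t => _) = Du); [exact: Du_continuous | apply/funext => t;
  rewrite DX_u].
- by rewrite (_ : (fun t => _) = Dcoef j);
  [exact: Dcoef_continuous | apply/funext => t; rewrite DX_w].
- by rewrite (_ : (fun t => _) = Dzeta); [exact: Dzeta_continuous | apply/funext =>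
  t; rewrite DX_z].
Qed.

Lemma DGamma_le t : 0 <= t -> \sum_i `|DGamma t i 0| <=
  (1 + n%:R + tailf_bound L c lambda n) * (`|r t - re| + L2norm L (fun x =>
    d t x - de x)).
Proof.
move=> t0; have Ld := d_L2 t0; have LB := L2B Ld Lde.
rewrite sum_ix DGamma_u DGamma_z normr0 add0r.
set N := L2norm L _; have N0 : 0 <= N := L2norm_ge0 _ _.
have H1 : \sum_(j < n) `|DGamma t (ix_w j) 0| <= n%:R * N.
  apply: (@le_trans _ _ (\sum_(j < n) N)).
    apply: ler_sum => j _; rewrite DGamma_w -innerBl//.
    exact: (coef_le (spec_basis spec)).
  by rewrite sumr_const card_ord mulr_natl.
have [_ _ /(_ _ LB) H2 H3] := tail_functional.
have H4 := ler_normB (- (r t - re)) (T (fun x => d t x - de x)); rewrite normrN in H4.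
have r0 := normr_ge0 (r t - re).
have n0 : 0 <= n%:R :> R by [].
have := mulr_ge0 n0 r0; have := mulr_ge0 H3 r0; rewrite -/N in H2.
nra.
Qed.

(* For s = t - D, the function
     sg |-> K e^((t-sg-D) A) DX(sg) - int_(s-D)^(sg-D) K e^((s-tau-D) A) B v(tau) dtau
   has derivative K e^((t-sg-D) A) DGamma(sg), and its increment from s to t is
   K e^(-D A) DX(t) - v(s). *)
Lemma v_prediction t Mk G : D <= t ->
  (forall th i, 0 <= th <= D -> `|kern D A K th 0 i| <= Mk) -> 0 <= Mk ->
  (forall s, t - D <= s <= t -> `|r s - re| + L2norm L (fun x => d s x - de x) <= G) ->
  `|v (t - D)| <= Mk * \sum_i `|DX t i 0|
    + Mk * ((1 + n%:R + tailf_bound L c lambda n) * G) * D.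
Proof.
move=> Dt kM Mk0 HG; set s := t - D.
have s0 : 0 <= s by rewrite subr_ge0.
have st : s <= t by rewrite lerBlDr lerDl ltW.
have tsD : t - s = D by rewrite /s; ring.
have [vc vn] := v_causal.
pose q tau := \sum_i (K 0 i * ((expmx ((s - D - tau) *: A) *m B) i 0 * v tau)).
have qE tau : q tau = (kern D A K (s - tau) *m B) 0 0 * v tau.
  rewrite /kern -mulmxA mxE mulr_suml (_ : s - tau - D = s - D - tau); last by ring.
  by apply: eq_bigr => i _; rewrite mulrA.
have cEv i : {within Rp, continuous (fun tau =>
  (expmx ((s - D - tau) *: A) *m B) i 0 * v tau)}.
  apply: within_continuousM; last exact: vc.
  rewrite (_ : (fun tau => _) = (fun tau => \sum_j expmx ((s - D - tau) *: A) i j * B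
    j 0)); last first.
    by apply/funext => ta; rewrite mxE.
  apply: within_continuous_sum => j.
  apply: within_continuousM; last exact: within_continuous_cst.
  apply: Rp_continuousT => tau.
  apply: (@continuous_comp _ _ _ (fun tau => s - D - tau) (fun x => expmx (x *: A) i j)).
    by apply: cvgB; [exact: cvg_cst | exact: cvg_id].
  exact: (derive_continuous (fun x => is_derive_expmx A x i j)).
have cq : {within Rp, continuous q}.
  apply: within_continuous_sum => i.
  by apply: within_continuousM; [exact: within_continuous_cst | exact: cEv].
have qn tau : tau < 0 -> q tau = 0.
  by move=> t0; rewrite qE vn// mulr0.
pose phi sg := \sum_i kern D A K (t - sg) 0 i * DX sg i 0
  - \int[@lebesgue_measure R]_(tau in `[s - D, sg - D]) q tau.
have dphi sg : s < sg < t -> sg != D ->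
    is_derive sg 1 phi ((kern D A K (t - sg) *m DGamma sg) 0 0).
  move=> /andP[ssg sgt] sgD; have sg0 : 0 < sg by exact: le_lt_trans s0 ssg.
  have dk i : is_derive sg 1 (fun sg => kern D A K (t - sg) 0 i)
      (- (kern D A K (t - sg) *m A) 0 i).
    have Hs := rderivB (rderiv_cst t sg) (rderiv_id sg); rewrite sub0r in Hs.
    apply: rderiv_eq (@rderiv_comp _ (fun th => kern D A K th 0 i) (fun x => t - x)
      sg _ _ (kern_derive D A K (t - sg) i) Hs) => //; by rewrite mulrN1.
  have dI : is_derive sg 1 (fun x => \int[@lebesgue_measure R]_(tau in `[s - D, x -
    D]) q tau) (q (sg - D)).
    have Hs := rderivB (rderiv_id sg) (rderiv_cst D sg); rewrite subr0 in Hs.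
    apply: rderiv_eq (@rderiv_comp _ (fun y =>
      \int[@lebesgue_measure R]_(tau in `[s - D, y]) q tau)
      (fun x => x - D) sg _ _ _ Hs) => //; last first.
      by apply: causal_primitive_derive => //; [rewrite ltrD2r | rewrite subr_eq0].
    exact: mulr1.
  have H := rderivB (rderiv_sum (index_enum _) (fun i =>
    rderivM (dk i) (DX_derive i sg0 sgD))) dI.
  apply: rderiv_eq H => //; rewrite qE (_ : s - (sg - D) = t - sg);
    last by rewrite /s; ring.
  rewrite (_ : \sum_(i <- index_enum _) _ =
     - (kern D A K (t - sg) *m A *m DX sg) 0 0
     + (kern D A K (t - sg) *m (A *m DX sg)) 0 0
     + (kern D A K (t - sg) *m B) 0 0 * v (sg - D)
     + (kern D A K (t - sg) *m DGamma sg) 0 0); last first.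
    move: (kern D A K (t - sg)) (DX sg) (DGamma sg) => k X Gam.
    have mulE (p : 'rV[R]_(1 + n + 1)) (Y : 'cV[R]_(1 + n + 1)) :
      (p *m Y) 0 0 = \sum_i p 0 i * Y i 0 by rewrite mxE.
    rewrite !mulE mulr_suml -sumrN -!big_split /=; apply: eq_bigr => i _; ring.
  by rewrite mulmxA; ring.
have cphi : {within `[s, t], continuous phi}.
  apply: within_continuousB.
    apply: within_continuous_sum => i; apply: within_continuousM; last first.
      exact: (continuous_sub_itv s0 (@DX_continuous i)).
    apply: continuous_subspaceT => sg.
    apply: (@continuous_comp _ _ _ (fun x => t - x) (fun x => kern D A K x 0 i)).
      by apply: cvgB; [exact: cvg_cst | exact: cvg_id].
    exact: kern_continuous.
  (* A difference of values of [input q], which is continuous everywhere, also across the jump of q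
     at 0. *)
  apply: (@subspace_eq_continuous _ _ _ (fun x => input q (x - D) - input q (s - D))).
    move=> x; rewrite inE/= in_itv/= => /andP[sx xt].
    rewrite -[RHS]/(\int[@lebesgue_measure R]_(tau in `[s - D, x - D]) q tau).
    pose a := Num.min 0 (s - D).
    have a0 : a <= 0 by rewrite ge_min lexx.
    have asD : a <= s - D by rewrite ge_min lexx orbT.
    have sxD : s - D <= x - D by rewrite lerD2r.
    rewrite !(input_primitive cq qn a0)//; last exact: le_trans sxD.
    by rewrite (Rintegral_itv_sub (causal_integrable cq qn a (x - D))).
  apply: within_continuousB; last exact: within_continuous_cst.
  apply: continuous_subspaceT => x.
  apply: (@continuous_comp _ _ _ (fun x => x - D) (input q)).
    by apply: cvgB; [exact: cvg_id | exact: cvg_cst].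
  exact: input_continuous.
have B1 sg : s < sg < t -> sg != D ->
    `|(kern D A K (t - sg) *m DGamma sg) 0 0| <=
    Mk * ((1 + n%:R + tailf_bound L c lambda n) * G).
  move=> /andP[ssg sgt] _; rewrite mxE; apply: (le_trans (ler_norm_sum _ _ _)).
  apply: (@le_trans _ _ (\sum_i Mk * `|DGamma sg i 0|)).
    apply: ler_sum => i _; rewrite normrM ler_wpM2r// kM//.
    by rewrite subr_ge0 ltW//= -tsD lerB// ltW.
  rewrite -mulr_sumr ler_wpM2l//.
  apply: (le_trans (DGamma_le (le_trans s0 (ltW ssg)))).
  rewrite ler_wpM2l//; last by apply: HG; rewrite -/s !ltW.
  have [_ _ _ ?] := tail_functional; have ? : 0 <= n%:R :> R by []; lra.
have := lipschitz_except st dphi B1 cphi.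
rewrite tsD.
have [P PE] : {P | P = (kern D A K 0 *m DX t) 0 0}.
  exact: (exist _ _ erefl).
have [Q QE] : {Q | Q = (K *m DX s) 0 0}.
  exact: (exist _ _ erefl).
have -> : phi s = Q; first rewrite QE.
  by rewrite /phi set_itv1 Rintegral_set1 subr0 tsD kernD mxE.
have -> : phi t = P - (v s - Q); first rewrite PE QE.
  rewrite /phi subrr -/s [X in X - _ = _](_ : _ = (kern D A K 0 *m DX t) 0 0);
    last by rewrite mxE.
  congr (_ - _).
  have -> : v s = (K *m X_of L D e lambda n y z v s) 0 0 +
      (K *m \col_i \int[@lebesgue_measure R]_(tau in `[s - D, s])
            ((expmx ((s - D - tau) *: A) *m B) i ord0 * v tau)) 0 0.
    by rewrite (cl_v cl s0) /Z_of mulmxDr mxE.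
  (* The feedback does not see the equilibrium, so v(s), defined through X, is expressed by Delta
     X. *)
  have -> : K *m DX s = K *m X_of L D e lambda n y z v s.
    by rewrite /DX mulmxBr K_X_e// subr0.
  rewrite [RHS]addrAC subrr add0r mxE.
  have IEv i : (@lebesgue_measure R).-integrable `[s - D, s]
      (EFin \o (fun tau => (expmx ((s - D - tau) *: A) *m B) i 0 * v tau)).
    apply: causal_integrable; first exact: cEv.
    by move=> tau tau0; rewrite vn// mulr0.
  have IK i : (@lebesgue_measure R).-integrable `[s - D, s]
      (EFin \o (fun tau => K 0 i * ((expmx ((s - D - tau) *: A) *m B) i 0 * v tau))).
    exact: integrable_EFinZ.
  have [//|_ ->] := Rintegral_bigsum (index_enum _) _ IK.
  by apply: eq_bigr => i _; rewrite mxE RintegralZl.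
rewrite (_ : P - (v s - Q) - Q = P - v s); last by ring.
move=> H; rewrite (_ : v s = P - (P - v s)); last by ring.
apply: (le_trans (ler_normB _ _)); apply: lerD => //.
rewrite PE mxE; apply: (le_trans (ler_norm_sum _ _ _)).
rewrite mulr_sumr; apply: ler_sum => i _; rewrite normrM ler_wpM2r// kM//.
by rewrite lexx ltW.
Qed.

(** * Estimates of the coefficients of y_t on a unit window *)

Let Lh : L2 L (hat L) := hat_L2 L_gt0.
Let Lc : L2 L (fun x => c x * hat L x) := chat_L2 L_gt0 c_Linfty.
Let La : L2 L (fun x => x / L * c x) := aramp_L2 L_gt0 c_Linfty.
Let Lb : L2 L (fun x => - (x / L)).
Proof. by apply: L2_eq (L2Z (-1) (ramp_L2 L_gt0)) => x _; rewrite mulN1r. Qed.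
#[local] Hint Resolve Lh Lc La Lb : core.
Local Notation nh := (L2norm L (hat L)).
Local Notation nc := (L2norm L (fun x => c x * hat L x)).
Local Notation na := (L2norm L (fun x => x / L * c x)).
Local Notation nb := (L2norm L (fun x => - (x / L))).

(* Along s, sum_j h_j e^(lambda_j (t-s)) p_j(s) is dominated by a function whose
   derivative contains |lambda_j| e^(lambda_j (t-s)), which is, up to sign, the
   derivative of e^(lambda_j (t-s)). *)
Lemma trajectory_window (t1 t V F M : R) N : 0 <= t1 -> t1 <= t -> t - t1 <= 1 ->
  0 <= V -> (forall s, t1 < s < t -> `|v (s - D)| <= V) ->
  0 <= F -> (forall s, t1 < s < t -> L2norm L (dd s) <= F) ->
  (forall j x, 0 <= x <= 1 -> expR (lambda j * x) <= M) ->
  `|\sum_(0 <= j < N) (hat L)`_[j] * (expR (lambda j * (t - t)) * rate j t)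
    - \sum_(0 <= j < N) (hat L)`_[j] * (expR (lambda j * (t - t1)) * rate j t1)|
  <= M * (nh * (V * na + F)) + V * ((1 + M) * (nh * nb)).
Proof.
move=> t10 t1t dt1 V0 HV F0 HF HM.
have M0 : 0 <= M by apply: le_trans (HM 0%N 0 _); rewrite ?expR_ge0// lexx ler01.
pose h j := (hat L)`_[j]; pose b j := b_coef L e j; pose a j := a_coef L c e j.
pose E j s := expR (lambda j * (t - s)).
have dE j (s : R) : is_derive s 1 (E j) (E j s * (lambda j * -1)).
  have Hs := rderivZ (lambda j) (rderivB (rderiv_cst t s) (rderiv_id s)).
  by rewrite sub0r in Hs; exact: rderiv_expR Hs.
have EM j (s : R) : t1 <= s <= t -> 0 <= E j s <= M.
  by move=> ?; rewrite expR_ge0 HM//; lra.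
(* The sign that makes [sg j * E j] nondecreasing in s, so that its derivative is |lambda_j| E_j
   also for the nonnegative eigenvalues. *)
pose sg j : R := if lambda j < 0 then 1 else -1.
have sgE j : sg j * (lambda j * -1) = `|lambda j|.
  by rewrite /sg; case: ltP => l0; [rewrite ltr0_norm//|rewrite ger0_norm//]; ring.
have sg1 j : `|sg j| = 1 by rewrite /sg; case: ifP; rewrite ?normrN1 ?normr1.
pose G s := \sum_(0 <= j < N) h j * (E j s * rate j s).
pose C1 := M * (nh * (V * na + F)).
have C10 : 0 <= C1 by rewrite !mulr_ge0 ?addr_ge0 ?mulr_ge0 ?L2norm_ge0.
pose S s := C1 * s + V * \sum_(0 <= j < N) `|h j * b j| * (sg j * E j s).
pose dG s := \sum_(0 <= j < N) h j * ((E j s * (lambda j * -1)) * rate j s + E j s *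
   (lambda j * rate j s + (lambda j * b j + a j) * v (s - D) + (dd s)`_[j])).
pose dS s := C1 + V * \sum_(0 <= j < N) `|h j * b j| * (sg j * (E j s * (lambda j * -1))).
have HG (s : R) : t1 < s < t -> s != D -> is_derive s 1 G (dG s).
  move=> /andP[t1s st] sD; have s0 : 0 < s by exact: le_lt_trans t1s.
  apply: (rderiv_sum (index_iota 0 N)) => j.
  exact: (rderivZ (h j) (rderivM (dE j s) (rate_derive j s0 sD))).
have HS (s : R) : t1 < s < t -> s != D -> is_derive s 1 S (dS s).
  move=> _ _; have HC := rderivZ C1 (rderiv_id s); rewrite mulr1 in HC.
  have HE := rderiv_sum (index_iota 0 N)
    (fun j => rderivZ `|h j * b j| (rderivZ (sg j) (dE j s))).
  exact: (rderivD HC (rderivZ V HE)).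
have cE j : {within `[t1, t], continuous (E j)}.
  apply: continuous_subspaceT; exact: (derive_continuous (dE j)).
have dGS (s : R) : t1 < s < t -> s != D -> `|dG s| <= dS s.
  move=> sI _; have /andP[t1s st] := sI.
  have s0 : 0 <= s by rewrite ltW// (le_lt_trans t10).
  have Ldd := dd_L2 s0.
  pose g x := v (s - D) * (x / L * c x) + dd s x.
  have Lg : L2 L g by exact: (L2D (L2Z (v (s - D)) La) Ldd).
  have gN : L2norm L g <= V * na + F.
    apply: (le_trans (ler_L2normD (L2Z _ La) Ldd)); apply: lerD; last exact: HF.
    by rewrite L2normZ// ler_wpM2r ?L2norm_ge0// HV.
  (* E_j is an integrating factor, so the terms in lambda_j p_j cancel. What remains is an L^2
     forcing g with bounded weights and the unbounded part lambda_j b_j v_D. *)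
  have -> : dG s = \sum_(0 <= j < N) E j s * ((hat L)`_[j] * g`_[j]) +
      \sum_(0 <= j < N) v (s - D) * (h j * b j * (E j s * lambda j)).
    rewrite -big_split; apply: eq_bigr => j _ /=.
    rewrite /g (innerDl (L2Z (v (s - D)) La) Ldd (Le j)) (innerZl _ La (Le j)).
    by rewrite -/(a_coef L c e j) -/(a j) -/(h j); ring.
  apply: (le_trans (ler_normD _ _)); apply: lerD.
    apply: (@le_trans _ _ (M * (nh * L2norm L g))).
      apply: (weighted_sum_le (spec_basis spec)) => // j.
      have sI' : t1 <= s <= t by rewrite (ltW t1s) (ltW st).
      by have /andP[E0 E1] := EM j s sI'; rewrite ger0_norm.
    by rewrite ler_wpM2l// ler_wpM2l ?L2norm_ge0.
  apply: (le_trans (ler_norm_sum _ _ _)); rewrite mulr_sumr; apply: ler_sum => j _.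
  rewrite normrM normrM [`|E j s * _|]normrM [`|E j s|]ger0_norm ?expR_ge0//.
  rewrite [sg j * _]mulrCA sgE; apply: ler_wpM2r; last exact: HV.
  by rewrite !mulr_ge0 ?expR_ge0.
have cG : {within `[t1, t], continuous G}.
  apply: within_continuous_sum => j.
  apply: within_continuousM; first exact: within_continuous_cst.
  apply: within_continuousM; first exact: cE.
  exact: (continuous_sub_itv t10 (@rate_continuous j)).
have cS : {within `[t1, t], continuous S}.
  apply: within_continuousD.
    apply: within_continuousM; first exact: within_continuous_cst.
    by apply: continuous_subspaceT => ?; exact: cvg_id.
  apply: within_continuousM; first exact: within_continuous_cst.
  apply: within_continuous_sum => j.
  apply: within_continuousM; first exact: within_continuous_cst.
  by apply: within_continuousM; [exact: within_continuous_cst | exact: cE].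
apply: (le_trans (dominated_except t1t HG HS dGS cG cS)).
have -> : S t - S t1 = C1 * (t - t1) + V * \sum_(0 <= j < N) `|h j * b j| * (sg j *
  (E j t - E j t1)).
  rewrite /S; under [in RHS]eq_bigr do rewrite mulrBr mulrBr.
  by rewrite sumrB; ring.
apply: lerD; first by rewrite ler_piMr.
rewrite ler_wpM2l//; apply: (@le_trans _ _ (\sum_(0 <= j < N) (1 + M) * `|h j * b j|)).
  apply: ler_sum => j _; rewrite mulrC ler_wpM2r//.
  apply: (le_trans (ler_norm _)); rewrite normrM sg1 mul1r.
  apply: (le_trans (ler_normB _ _)); apply: lerD.
    by rewrite /E subrr mulr0 expR0 normr1.
  have t1I : t1 <= t1 <= t by rewrite lexx.
  by have /andP[E0 E1] := EM j t1 t1I; rewrite ger0_norm.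
rewrite -mulr_sumr ler_wpM2l ?addr_ge0//.
exact: (sum_coef_le (spec_basis spec) N Lh Lb).
Qed.

Lemma forcing_L2 t : 0 <= t -> L2 L (fun x => Du t * (x / L * c x) + (d t x - de x)).
Proof. by move=> t0; exact: (L2D (L2Z (Du t) La) (L2B (d_L2 t0) Lde)). Qed.

Lemma forcing_coef t j : 0 <= t ->
  (fun x => Du t * (x / L * c x) + (d t x - de x))`_[j] =
  a_coef L c e j * Du t + ((d t)`_[j] - de`_[j]).
Proof.
move=> t0; have Ld := d_L2 t0; have LB := L2B Ld Lde.
rewrite (innerDl (L2Z (Du t) La) LB (Le j)) (innerZl _ La (Le j)) (innerBl Ld Lde (Le j)).
by rewrite -/(a_coef L c e j); ring.
Qed.

Lemma forcing_norm t : 0 <= t ->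
  L2norm L (fun x => Du t * (x / L * c x) + (d t x - de x)) <=
  `|Du t| * na + L2norm L (fun x => d t x - de x).
Proof.
move=> t0; have LB := L2B (d_L2 t0) Lde.
by apply: (le_trans (ler_L2normD (L2Z _ La) LB)); rewrite L2normZ.
Qed.

(** Here lambda_j stays with Delta w and forms a coefficient of A Delta w. This is the bound for
    windows that start at time 0. *)
Lemma rate_initial t w M N : 0 <= t -> 0 <= M -> (forall j, `|w j| <= M) ->
  `|\sum_(0 <= j < N) (hat L)`_[j] * (w j * rate j t)| <=
  M * (nh * (L2norm L (opA L c (Dw t)) +
     (`|Du t| * na + L2norm L (fun x => d t x - de x)))).
Proof.
move=> t0 M0 wM; have Dd := Dw_domA t0; have [HD _ _] := Dd.
have LA := opA_L2 L_gt0 c_Linfty HD; have Lf := forcing_L2 t0.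
pose g x := opA L c (Dw t) x + (Du t * (x / L * c x) + (d t x - de x)).
have Lg : L2 L g by exact: L2D.
rewrite (eq_bigr (fun j => w j * ((hat L)`_[j] * g`_[j]))); last first.
  move=> j _; rewrite /g innerDl// (domA_coef L_gt0 c_Linfty spec j Dd) forcing_coef//.
  by rewrite -Dcoef_dev// /rate; ring.
apply: (le_trans (weighted_sum_le (spec_basis spec) N M0 wM Lh Lg)).
rewrite ler_wpM2l// ler_wpM2l ?L2norm_ge0//.
apply: (le_trans (ler_L2normD LA Lf)); rewrite lerD2l; exact: forcing_norm.
Qed.

(** Here lambda_j is absorbed by the weight, so that the L^2 norm of Delta w suffices. This is the
    bound for windows of full length 1. *)
Lemma rate_smoothing t w M M' N : 0 <= t -> 0 <= M -> (forall j, `|w j| <= M) ->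
  0 <= M' -> (forall j, `|w j * lambda j| <= M') ->
  `|\sum_(0 <= j < N) (hat L)`_[j] * (w j * rate j t)| <=
  M' * (nh * L2norm L (Dw t)) +
  M * (nh * (`|Du t| * na + L2norm L (fun x => d t x - de x))).
Proof.
move=> t0 M0 wM M'0 wM'; have Dd := Dw_domA t0; have [HD _ _] := Dd.
have LD := H2_L2 L_gt0 HD; have Lf := forcing_L2 t0.
pose g x := Du t * (x / L * c x) + (d t x - de x).
rewrite (eq_bigr (fun j => (w j * lambda j) * ((hat L)`_[j] * (Dw t)`_[j]) +
    w j * ((hat L)`_[j] * g`_[j]))); last first.
  by move=> j _; rewrite /g forcing_coef// -Dcoef_dev// /rate; ring.
rewrite big_split/=; apply: (le_trans (ler_normD _ _)); apply: lerD.
  exact: (weighted_sum_le (spec_basis spec) N M'0 wM' Lh LD).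
apply: (le_trans (weighted_sum_le (spec_basis spec) N M0 wM Lh Lf)).
rewrite ler_wpM2l// ler_wpM2l ?L2norm_ge0//; exact: forcing_norm.
Qed.

(** The bound P is uniform in N and therefore passes to the limit in Parseval's identity; A Delta w
    and y_t differ by an L^2 forcing term. *)
Lemma opA_dev_hat t P : 0 <= t ->
  (forall N, `|\sum_(0 <= j < N) (hat L)`_[j] * rate j t| <= P) ->
  `|inner L (opA L c (Dw t)) (hat L)| <=
  P + nh * (`|Du t| * na + L2norm L (fun x => d t x - de x)).
Proof.
move=> t0 HP; have Dd := Dw_domA t0; have [HD _ _] := Dd.
have LA := opA_L2 L_gt0 c_Linfty HD; have Lf := forcing_L2 t0.
have H := cvg_norm (Parseval (spec_basis spec) LA Lh).
apply: (cvgr_to_le (H _)); apply: nearW => N.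
pose g x := Du t * (x / L * c x) + (d t x - de x).
rewrite (eq_bigr (fun j => (hat L)`_[j] * rate j t - 1 * ((hat L)`_[j] * g`_[j])));
  last first.
  move=> j _; rewrite /g forcing_coef// (domA_coef L_gt0 c_Linfty spec j Dd).
  by rewrite -Dcoef_dev// /rate; ring.
rewrite sumrB; apply: (le_trans (ler_normB _ _)); apply: lerD => //.
apply: (@le_trans _ _ (1 * (nh * L2norm L g))).
  by apply: (weighted_sum_le (spec_basis spec)) => // j; rewrite normr1.
by rewrite mul1r ler_wpM2l ?L2norm_ge0//; exact: forcing_norm.
Qed.

Lemma flux_dev t : 0 <= t ->
  dx0 (y t) - r t = dx0 (Dw t) + Du t / L - (r t - re).
Proof.
move=> t0; have := equilibrium_dx0 AK_hurwitz L_gt0 c_Linfty spec lambda_lt0 Lde Hwe.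
rewrite (_ : Dw t = fun x => w t x - we x)// (dx0B L_gt0 (w_H2 t0) we_H2) dx0_y//.
by move=> <-; rewrite /Du; ring.
Qed.

(** Y bounds the state deviations on the window, G the perturbations on the window extended by D, W
    the norm of A Delta w(0). [V] bounds v_D: in 2 + n L, the 2 stands for Delta u_D and Delta zeta,
    and each of the n coefficients is at most L Y by Poincare. [P] bounds the partial sums for y_t;
    it adds the bounds of the two kinds of window start, of which one applies at a time. *)
Definition flux_bound (Mk M M' Y G W : R) : R :=
  let V := Mk * ((2 + n%:R * L) * Y)
    + Mk * ((1 + n%:R + tailf_bound L c lambda n) * G) * D in
  let P := M * (nh * (V * na + G)) + V * ((1 + M) * (nh * nb))
    + (M * (nh * (W + (Y * na + G))) + M' * (nh * (L * Y))) in
  nc * (L * Y) + (P + nh * (Y * na + G)) + Y / L + G.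

Lemma flux_le (t Mk M M' Y G W : R) : 0 <= t ->
  0 <= Mk -> (forall th i, 0 <= th <= D -> `|kern D A K th 0 i| <= Mk) ->
  0 <= M -> (forall j x, 0 <= x <= 1 -> expR (lambda j * x) <= M) ->
  0 <= M' -> (forall j, `|expR (lambda j) * lambda j| <= M') ->
  (forall s, 0 <= s <= t -> t - 1 <= s ->
     [/\ `|Du s| <= Y, `|Dzeta s| <= Y & H10norm L (Dw s) <= Y]) ->
  (forall s, 0 <= s <= t -> t - 1 - D <= s ->
     `|r s - re| + L2norm L (fun x => d s x - de x) + L2norm L (dd s) <= G) ->
  0 <= W -> (t <= 1 -> L2norm L (opA L c (Dw 0)) <= W) ->
  `|dx0 (y t) - r t| <= flux_bound Mk M M' Y G W.
Proof.
move=> t0 Mk0 HMk M0 HM M'0 HM' HY HG W0 HW.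
have tt : 0 <= t <= t by rewrite t0 lexx.
have t1t : t - 1 <= t by lra.
have t1Dt : t - 1 - D <= t by have := D_gt0; lra.
have [Yu _ _] := HY t tt t1t.
have Y0 : 0 <= Y := le_trans (normr_ge0 _) Yu.
have G0 : 0 <= G.
  by apply: le_trans (HG t tt t1Dt); rewrite !addr_ge0 ?L2norm_ge0.
have DwL s : 0 <= s <= t -> t - 1 <= s -> L2norm L (Dw s) <= L * Y.
  move=> sI ts; have /andP[s0 st] := sI; have [_ _ HH] := HY s sI ts.
  have [HD D0 _] := Dw_domA s0.
  have H1D : H1 L (Dw s) by have [g ? _] := HD; exists g.
  by apply: (le_trans (H10norm_Poincare L_gt0 H1D D0)); rewrite ler_wpM2l// ltW.
have Gd s : 0 <= s <= t -> t - 1 - D <= s -> L2norm L (fun x => d s x - de x) <= G.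
  move=> sI ts; apply: le_trans (HG s sI ts).
  have := L2norm_ge0 L (dd s); have := normr_ge0 (r s - re); lra.
have Gr s : 0 <= s <= t -> t - 1 - D <= s -> `|r s - re| <= G.
  move=> sI ts; apply: le_trans (HG s sI ts).
  have := L2norm_ge0 L (dd s); have := L2norm_ge0 L (fun x => d s x - de x); lra.
have Gdd s : 0 <= s <= t -> t - 1 - D <= s -> L2norm L (dd s) <= G.
  move=> sI ts; apply: le_trans (HG s sI ts).
  have := normr_ge0 (r s - re); have := L2norm_ge0 L (fun x => d s x - de x); lra.
rewrite /flux_bound.
set V := Mk * _ + _; set P := _ + (M * _ + M' * _).
have tb0 : 0 <= 1 + n%:R + tailf_bound L c lambda n.
  have [_ _ _ ?] := tail_functional; have ? : 0 <= n%:R :> R by []; lra.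
have V0 : 0 <= V.
  have L0 := ltW L_gt0; have D0 := ltW D_gt0.
  apply: addr_ge0; last by apply: mulr_ge0 => //; apply: mulr_ge0 => //; exact: mulr_ge0.
  apply: mulr_ge0 => //; apply: mulr_ge0 => //.
  by apply: addr_ge0 => //; exact: mulr_ge0.
have VB s : 0 <= s <= t -> t - 1 <= s -> `|v (s - D)| <= V.
  move=> sI ts; have /andP[s0 st] := sI.
  (* Before time D the delayed control vanishes; from D on, the predictor estimate applies. *)
  have [Ds|sD] := leP D s; last by rewrite (cl_v_neg cl) ?subr_lt0// normr0.
  have sI' x : s - D <= x <= s -> 0 <= x <= t /\ t - 1 - D <= x.
    by move=> /andP[? ?]; split; [apply/andP; split|]; lra.
  apply: (le_trans (@v_prediction s Mk G Ds HMk Mk0 _)).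
    move=> x /sI'[xt tx]; apply: le_trans (HG x xt tx).
    by have := L2norm_ge0 L (dd x); lra.
  rewrite lerD2r ler_wpM2l//; have [Y1 Y2 _] := HY s sI ts.
  rewrite sum_ix DX_u DX_z.
  have : \sum_(j < n) `|DX s (ix_w j) 0| <= n%:R * (L * Y).
    apply: (@le_trans _ _ (\sum_(j < n) L * Y)).
      apply: ler_sum => j _; rewrite DX_w Dcoef_dev//.
      apply: le_trans (DwL s sI ts); apply: (coef_le (spec_basis spec)).
      by have [HD _ _] := Dw_domA s0; exact: (H2_L2 L_gt0 HD).
    by rewrite sumr_const card_ord mulr_natl.
  by rewrite mulrDl -(mulrA n%:R); lra.
have nh0 := L2norm_ge0 L (hat L); have na0 := L2norm_ge0 L (fun x => x / L * c x).
have fB s : 0 <= s <= t -> t - 1 <= s ->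
    `|Du s| * na + L2norm L (fun x => d s x - de x) <= Y * na + G.
  move=> sI ts; have [Y1 _ _] := HY s sI ts; apply: lerD.
    by rewrite ler_wpM2r.
  by apply: Gd => //; have := D_gt0; lra.
pose t1 := Num.max 0 (t - 1).
have t10 : 0 <= t1 by rewrite le_max lexx.
have t1lt : t1 <= t by rewrite ge_max t0 t1t.
have tt1 : t - 1 <= t1 by rewrite le_max lexx orbT.
have Pbound N : `|\sum_(0 <= j < N) (hat L)`_[j] * rate j t| <= P.
  have := @trajectory_window t1 t V G M N t10 t1lt _ V0 _ G0 _ HM.
  rewrite (eq_bigr (fun j => (hat L)`_[j] * rate j t)); last first.
    by move=> j _; rewrite subrr mulr0 expR0 mul1r.
  move=> Hw; apply: (@le_trans _ _ (M * (nh * (V * na + G)) + V * ((1 + M) * (nh * nb)) +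
     `|\sum_(0 <= j < N) (hat L)`_[j] * (expR (lambda j * (t - t1)) * rate j t1)|)).
    rewrite -lerBlDr; apply: le_trans (lerB_dist _ _) _; apply: Hw.
    - by lra.
    - by move=> s /andP[? ?]; apply: VB; [apply/andP; split|]; lra.
    - by move=> s /andP[? ?]; apply: Gdd; [apply/andP; split|]; have := D_gt0; lra.
  rewrite /P lerD2l.
  have t1I : 0 <= t1 <= t by rewrite t10.
  have EM j : `|expR (lambda j * (t - t1))| <= M.
    by rewrite ger0_norm ?expR_ge0//; apply: HM; apply/andP; split; lra.
  (* For t <= 1 the window starts at 0 and A Delta w(0) is used; otherwise it has length exactly 1
     and the smoothing weight is e^(lambda_j) lambda_j. *)
  have [t1e|t1e] := leP t 1.
    have t1E : t1 = 0 by rewrite /t1 max_l//; lra.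
    apply: (le_trans (rate_initial N t10 M0 EM)).
    apply: ler_wpDr; first by rewrite !mulr_ge0// ltW.
    rewrite ler_wpM2l// ler_wpM2l//; apply: lerD; last exact: fB.
    by rewrite t1E; exact: HW.
  have t1E : t - t1 = 1 by rewrite /t1 max_r; lra.
  have HM1 j : `|expR (lambda j * (t - t1)) * lambda j| <= M' by rewrite t1E mulr1.
  apply: (le_trans (rate_smoothing N t10 M0 EM M'0 HM1)).
  rewrite addrC; apply: lerD.
    rewrite ler_wpM2l// ler_wpM2l//; apply: (le_trans (fB t1 t1I tt1)).
    by rewrite lerDr.
  by rewrite ler_wpM2l// ler_wpM2l//; exact: DwL.
rewrite flux_dev//; apply: (le_trans (ler_normB _ _)); apply: lerD; last by apply: Gr.
apply: (le_trans (ler_normD _ _)); apply: lerD; last first.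
  by rewrite normrM normfV (gtr0_norm L_gt0) ler_pM2r ?invr_gt0.
have Dd := Dw_domA t0; have [HD _ _] := Dd.
rewrite (dx0_domA L_gt0 c_Linfty Dd); apply: (le_trans (ler_normB _ _)); apply: lerD.
  rewrite mulrC; apply: (le_trans (L2_CauchySchwarz (H2_L2 L_gt0 HD) Lc)).
  by rewrite ler_wpM2r ?L2norm_ge0//; exact: DwL.
apply: (le_trans (opA_dev_hat t0 Pbound)); rewrite lerD2l ler_wpM2l//.
exact: fB.
Qed.

End trajectory.

(** * Constants and conclusion *)

Section flux_bound_linear.
Context (R : realType) (L D : R) (c : R -> R) (lambda : nat -> R) (n : nat).
Context (L_gt0 : 0 < L) (D_gt0 : 0 < D) (Mk M M' : R).
Context (Mk_ge0 : 0 <= Mk) (M_ge0 : 0 <= M) (M'_ge0 : 0 <= M').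
Local Notation bound := (flux_bound L D c lambda n Mk M M').

Lemma flux_bound_ge0 (Y G W : R) : 0 <= Y -> 0 <= G -> 0 <= W -> 0 <= bound Y G W.
Proof.
move=> Y0 G0 W0; rewrite /flux_bound.
have L0 := ltW L_gt0; have D0 := ltW D_gt0.
have V0 : 0 <= L^-1 by rewrite invr_ge0.
have T0 := tailf_bound_ge0 L c lambda n.
by repeat first [exact: L2norm_ge0 | assumption | apply: ler0n | apply: addr_ge0
  | apply: mulr_ge0].
Qed.

(** The bound is linear in (Y, G, W), so C is the sum of its values at the three unit vectors, plus
    1 to be positive. *)
Lemma flux_bound_linear : exists2 C : R, 0 < C &
  forall Y G W, 0 <= Y -> 0 <= G -> 0 <= W -> bound Y G W <= C * (Y + G + W).
Proof.
have P1 : 0 <= bound 1 0 0 by apply: flux_bound_ge0.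
have P2 : 0 <= bound 0 1 0 by apply: flux_bound_ge0.
have P3 : 0 <= bound 0 0 1 by apply: flux_bound_ge0.
exists (bound 1 0 0 + bound 0 1 0 + bound 0 0 1 + 1); first by lra.
move=> Y G W Y0 G0 W0.
have -> : bound Y G W = Y * bound 1 0 0 + G * bound 0 1 0 + W * bound 0 0 1.
  by rewrite /flux_bound; ring.
move: (bound 1 0 0) (bound 0 1 0) (bound 0 0 1) P1 P2 P3 => x1 x2 x3 P1 P2 P3.
by nra.
Qed.
End flux_bound_linear.

(** For l < 0, - l <= 1 - l <= e^(-l) gives the bound 1; for l >= 0 both factors are monotone. The
    right-hand side serves all the eigenvalues at once. *)
Lemma expR_mul_le (R : realType) (l l0 : R) : l <= l0 ->
  `|expR l * l| <= 1 + `|l0| * expR `|l0|.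
Proof.
move=> ll; have [l0'|l0'] := leP 0 l.
  rewrite ger0_norm ?mulr_ge0 ?expR_ge0// mulrC ler_wpDl//.
  apply: ler_pM; rewrite ?expR_ge0//; first exact: le_trans ll (ler_norm _).
  by rewrite ler_expR (le_trans ll)// ler_norm.
rewrite normrM ger0_norm ?expR_ge0// ltr0_norm//.
apply: ler_wpDr; first by rewrite mulr_ge0 ?expR_ge0.
rewrite -(expRxMexpNx_1 l) ler_wpM2l ?expR_ge0//.
by apply: le_trans (expR_ge1Dx (- l)); rewrite lerDr.
Qed.

Lemma expR_mul_unit_le (R : realType) (l l0 x : R) : l <= l0 -> 0 <= x <= 1 ->
  expR (l * x) <= expR `|l0|.
Proof.
move=> ll /andP[x0 x1]; rewrite ler_expR.
have := ler_norm l0; have := normr_ge0 l0; nra.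
Qed.

Lemma normr_le_sqr (R : realType) (x y : R) : 0 <= y -> x ^+ 2 <= y ^+ 2 -> `|x| <= y.
Proof.
by move=> y0; rewrite -(real_normK (num_real x)) ler_sqr// nnegrE.
Qed.

Theorem theorem2 (R : realType) (L D : R) (c : R -> R)
    (e : nat -> R -> R) (lambda : nat -> R) (n : nat)
    (K : 'rV[R]_(1 + n + 1)) (kappa : R)
    (L_gt0 : 0 < L) (D_gt0 : 0 < D) (c_Linfty : Linfty L c)
    (spec : spectral_data L c e lambda)
    (lambda_ge0 : forall j, (j < n)%N -> 0 <= lambda j)
    (lambda_lt0 : forall j, (n <= j)%N -> lambda j <= lambda n < 0)
    (AK_hurwitz : hurwitz (matAK L D c e lambda K))
    (kappa_gt0 : 0 < kappa)
    (kappa_ISS : ISS L D c e lambda K kappa) :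
  exists2 C3 : R, 0 < C3 &
  forall eps : R, 0 <= eps < 1 ->
  exists2 C4 : R, 0 < C4 &
  forall (re : R) (de we : R -> R), L2 L de ->
    is_w_e L D c e lambda K re de we ->
  forall (r : R -> R) (d dd : R -> R -> R) (y0 : R -> R) (z0 : R)
    (y : R -> R -> R) (z v : R -> R),
    closed_loop L D c e lambda K r d dd y0 z0 y z v ->
  forall t : R, 0 <= t ->
    `|dx0 (y t) - r t| <=
    C3 * expR (- kappa * t) *
      (`|u_D D v 0 - u_e L D c e lambda K re de|
       + `|zeta_of L D e lambda n y z v 0 - zeta_e L D c e lambda K re de|
       + H10norm L (dev_w L D y v we 0)
       + L2norm L (opA L c (dev_w L D y v we 0)))
    + C4 * sup_upto t (fun s => expR (- eps * kappa * (t - s)) *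
        (`|r s - re| + L2norm L (fun x => d s x - de x) + L2norm L (dd s))).
Proof.
have [Mk Mk0 HMk] := kern_bounded D (matA L c e lambda n) K.
have lam0 j : lambda j <= lambda 0%N.
  have [_ _ _ dec _] := spec.
  by elim: j => // j IH; apply: le_trans IH; exact: ltW.
pose M := expR `|lambda 0%N|; pose M' := 1 + `|lambda 0%N| * M.
have M0 : 0 <= M by exact: expR_ge0.
have M'0 : 0 <= M' by rewrite addr_ge0// mulr_ge0.
have [C C0 HC] := flux_bound_linear c lambda n L_gt0 D_gt0 Mk0 M0 M'0.
have [C1 C10 Hiss] := kappa_ISS.
(* The loss in moving an exponential weight from a time in [t - 1 - D, t] to t; as eps < 1, it also
   covers the weights of rate eps kappa. *)
pose Q := expR (kappa * (1 + D)).
have Q0 : 0 < Q by exact: expR_gt0.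
have s10 := sqrtr_ge0 C1.
(* The coefficient of the initial data in C (Y + Q S + Q E), with [Y], [S], [E] as set below: Q
   sqrt(C1) comes from (S), the other Q from A Delta w(0). It is fixed before eps. *)
exists (C * (Q * Num.sqrt C1 + Q)).
  by rewrite mulr_gt0// ltr_wpDl// mulr_ge0// ltW.
move=> eps eps01; have [C2 C20 {}Hiss] := Hiss eps eps01.
have /andP[eps0 eps1] := eps01.
have s20 := sqrtr_ge0 C2.
exists (C * (Q * Num.sqrt C2 + Q)).
  by rewrite mulr_gt0// ltr_wpDl// mulr_ge0// ltW.
move=> re de we Lde Hwe r d dd y0 z0 y z v cl t t0.
have {}Hiss := Hiss re de we Lde Hwe r d dd y0 z0 y z v cl.
set du0 := `|u_D D v 0 - _|; set dz0 := `|zeta_of _ _ _ _ _ _ _ _ 0 - _|.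
set h0 := H10norm L _; set a0 := L2norm L (opA _ _ _).
pose N s := `|r s - re| + L2norm L (fun x => d s x - de x) + L2norm L (dd s).
pose F s := expR (- eps * kappa * (t - s)) * N s.
rewrite -/(F) -[sup_upto t _]/(sup_upto t F); set S := sup_upto t F.
have N0 s : 0 <= N s by rewrite !addr_ge0 ?L2norm_ge0.
have cF : {within `[0, t], continuous F}.
  apply: (continuous_sub_itv (lexx 0)).
  apply: within_continuousM.
    apply: continuous_subspaceT.
    exact: (derive_continuous (fun s => rderiv_expR (rderivZ (- eps * kappa)
      (rderivB (rderiv_cst t s) (rderiv_id s))))).
  apply: within_continuousD; last first.
    have [Hdd _] := cl_d cl.
    have := L2norm_continuous Hdd (L2_0 L).
    rewrite (_ : (fun s => _) = (fun s => L2norm L (dd s)))//.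
    by apply/funext => s; apply: L2norm_eq => x _; rewrite subr0.
  apply: within_continuousD.
    move=> s; apply: cvg_norm; apply: cvgB; [exact: (cl_r cl) | exact: cvg_cst].
  exact: (L2norm_continuous (L2_C1_continuous (cl_d cl)) Lde).
have HS s : 0 <= s <= t -> F s <= S.
  by move=> sI; exact: (sup_upto_ub cF sI).
have S0 : 0 <= S.
  apply: le_trans (HS 0 _); last by rewrite lexx t0.
  by apply: mulr_ge0 => //; exact: expR_ge0.
have du00 : 0 <= du0 by exact: normr_ge0.
have dz00 : 0 <= dz0 by exact: normr_ge0.
have h00 : 0 <= h0 by exact: L2norm_ge0.
have a00 : 0 <= a0 by exact: L2norm_ge0.
have I0 : 0 <= du0 + dz0 + h0 + a0 by lra.
set I := du0 + dz0 + h0 + a0 in I0 *.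
pose E := expR (- kappa * t) * I.
have E0 : 0 <= E by rewrite mulr_ge0 ?expR_ge0.
have Qk s : 0 <= t - s -> t - s <= 1 + D -> expR (kappa * (t - s)) <= Q.
  by move=> ? ?; rewrite ler_expR ler_wpM2l// ltW.
have Qe s : 0 <= t - s -> t - s <= 1 + D -> expR (eps * kappa * (t - s)) <= Q.
  move=> ts0 ts; apply: le_trans (Qk s ts0 ts); rewrite ler_expR ler_wpM2r//.
  by rewrite ler_piMl ?ltW.
(* The square root of (S), transported from s in [t - 1, t] to t. *)
pose Y := Q * (Num.sqrt C1 * E + Num.sqrt C2 * S).
have Y0 : 0 <= Y by apply: mulr_ge0; [exact: ltW | rewrite addr_ge0// mulr_ge0].
have energy s : 0 <= s <= t -> t - 1 <= s ->
    (u_D D v s - u_e L D c e lambda K re de) ^+ 2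
      + (zeta_of L D e lambda n y z v s - zeta_e L D c e lambda K re de) ^+ 2
      + H10norm L (dev_w L D y v we s) ^+ 2 <= Y ^+ 2.
  move=> /andP[s0 st] ts; apply: (le_trans (Hiss s s0)).
  have ts0 : 0 <= t - s by rewrite subr_ge0.
  have ts1 : t - s <= 1 + D by have := D_gt0; lra.
  have B1 : expR (- 2 * kappa * s) *
      ((u_D D v 0 - u_e L D c e lambda K re de) ^+ 2 +
       (zeta_of L D e lambda n y z v 0 - zeta_e L D c e lambda K re de) ^+ 2 +
       H10norm L (dev_w L D y v we 0) ^+ 2) <= (Q * E) ^+ 2.
    have -> : - 2 * kappa * s = (- kappa * s) * 2 by ring.
    rewrite expRM_natr.
    apply: (@le_trans _ _ ((expR (- kappa * s) * I) ^+ 2)).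
      rewrite exprMn ler_wpM2l ?exprn_ge0 ?expR_ge0//.
      rewrite -(real_normK (num_real (_ - u_e _ _ _ _ _ _ _ _))).
      rewrite -(real_normK (num_real (_ - zeta_e _ _ _ _ _ _ _ _))).
      rewrite -/du0 -/dz0 -/h0 /I.
      have sq (p1 p2 p3 p4 : R) : 0 <= p1 -> 0 <= p2 -> 0 <= p3 -> 0 <= p4 ->
        p1 ^+ 2 + p2 ^+ 2 + p3 ^+ 2 <= (p1 + p2 + p3 + p4) ^+ 2 by nra.
      exact: sq.
    rewrite lerXn2r ?nnegrE ?mulr_ge0 ?expR_ge0 ?(ltW Q0)//.
    have -> : - kappa * s = kappa * (t - s) + - kappa * t by ring.
    by rewrite expRD -mulrA ler_wpM2r// Qk.
  (* The supremum in (S) has weights relative to s; they are rewritten relative to t at the price of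
     Q, and the squares are absorbed in the square of the sum [N tau]. *)
  have B2 : sup_upto s (fun tau => expR (- 2 * eps * kappa * (s - tau)) *
      ((r tau - re) ^+ 2 + L2norm L (fun x => d tau x - de x) ^+ 2)) <= (Q * S) ^+ 2.
    apply: sup_upto_le => // tau /andP[tau0 taus].
    have -> : - 2 * eps * kappa * (s - tau) = (- eps * kappa * (s - tau)) * 2 by ring.
    rewrite expRM_natr.
    apply: (@le_trans _ _ ((expR (- eps * kappa * (s - tau)) * N tau) ^+ 2)).
      rewrite exprMn ler_wpM2l ?exprn_ge0 ?expR_ge0//.
      rewrite -(real_normK (num_real (r tau - re))) /N.
      have sq (p1 p2 p3 : R) : 0 <= p1 -> 0 <= p2 -> 0 <= p3 ->
        p1 ^+ 2 + p2 ^+ 2 <= (p1 + p2 + p3) ^+ 2 by nra.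
      by apply: sq; rewrite ?L2norm_ge0.
    rewrite lerXn2r ?nnegrE ?mulr_ge0 ?expR_ge0 ?(ltW Q0)//.
    have -> : - eps * kappa * (s - tau) =
      eps * kappa * (t - s) + - eps * kappa * (t - tau) by ring.
    rewrite expRD -mulrA; apply: ler_pM; rewrite ?expR_ge0 ?mulr_ge0 ?expR_ge0//.
      exact: Qe.
    by apply: HS; rewrite tau0 (le_trans taus).
  rewrite -[C1 * _ * _]mulrA.
  apply: (le_trans (lerD (ler_wpM2l (ltW C10) B1) (ler_wpM2l (ltW C20) B2))).
  rewrite -{1}(sqr_sqrtr (ltW C10)) -{1}(sqr_sqrtr (ltW C20)) /Y.
  (* The cross term by which the square of the sum exceeds the sum of the squares. *)
  have : 0 <= Num.sqrt C1 * E * (Num.sqrt C2 * S) by rewrite !mulr_ge0.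
  have := sqr_ge0 Q.
  move: (Num.sqrt C1) (Num.sqrt C2) => q1 q2 HQ Hc.
  have := mulr_ge0 HQ Hc; nra.
have HY s : 0 <= s <= t -> t - 1 <= s ->
  [/\ `|Du L D c e lambda K re de v s| <= Y,
      `|Dzeta L D c e lambda K re de y z v s| <= Y
    & H10norm L (dev_w L D y v we s) <= Y].
  move=> sI ts; have := energy s sI ts; rewrite -/(Du L D c e lambda K re de v s).
  rewrite -/(Dzeta L D c e lambda K re de y z v s).
  set x1 := Du _ _ _ _ _ _ _ _ _ _; set x2 := Dzeta _ _ _ _ _ _ _ _ _ _ _ _.
  set x3 := H10norm _ _.
  have := sqr_ge0 x1; have := sqr_ge0 x2; have := sqr_ge0 x3 => ? ? ? ?.
  split; try by apply: normr_le_sqr => //; lra.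
  by apply: le_trans (ler_norm _) _; apply: normr_le_sqr => //; lra.
have HG s : 0 <= s <= t -> t - 1 - D <= s -> N s <= Q * S.
  move=> sI ts; have /andP[s0 st] := sI.
  have ts0 : 0 <= t - s by rewrite subr_ge0.
  have ts1 : t - s <= 1 + D by lra.
  have -> : N s = expR (eps * kappa * (t - s)) * F s.
    rewrite /F mulrA -expRD (_ : _ + _ = 0) ?expR0 ?mul1r//; ring.
  apply: ler_pM; rewrite ?expR_ge0//; first by rewrite mulr_ge0 ?expR_ge0.
    exact: Qe.
  exact: HS.
(* A Delta w(0) is used only for t <= 1, where e^(kappa t) <= Q supplies the decay factor contained
   in E. *)
have HW : t <= 1 -> L2norm L (opA L c (dev_w L D y v we 0)) <= Q * E.
  move=> t1; rewrite -/a0; apply: (@le_trans _ _ I).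
    by rewrite lerDr; lra.
  have -> : I = expR (kappa * (t - 0)) * E.
    rewrite /E mulrA -expRD (_ : _ + _ = 0) ?expR0 ?mul1r//; ring.
  by rewrite ler_wpM2r// Qk ?subr0//; have := D_gt0; lra.
have QE0 : 0 <= Q * E by rewrite mulr_ge0// ltW.
have QS0 : 0 <= Q * S by rewrite mulr_ge0// ltW.
apply: (le_trans (flux_le L_gt0 D_gt0 c_Linfty spec lambda_lt0 AK_hurwitz Lde Hwe
  cl t0 Mk0 HMk M0 (fun j x xI => expR_mul_unit_le (lam0 j) xI) M'0
  (fun j => expR_mul_le (lam0 j)) HY HG QE0 HW)).
apply: (le_trans (HC _ _ _ Y0 QS0 QE0)).
by rewrite le_eqVlt; apply/orP; left; apply/eqP; rewrite /Y /E; ring.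
Qed.
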